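(* Suppose Assumption A1 holds and $\mathbf X\sim\mu\in\mathcal P_{ac}(\mathbb R^p)$. Then there exists a $\mu$-a.e. unique Borel measurable map $R:\mathbb R^p\to\mathbb R^p$ such that the law of $(\mathbf X,R(\mathbf X))$ is the unique element of $\Pi(\mu,\nu)$ with a $c$-cyclically monotone support. Moreover: (i) there is a lower semicontinuous convex function $\psi:\mathbb R^p\to(-\infty,+\infty]$ with $R(\mathbf x)=q(\nabla\psi(\mathbf x))$ for $\mu$-a.e. $\mathbf x$; (ii) $\nabla\psi$ is the $\mu_S$-a.e. unique gradient of a convex function pushing $\mu_S$ forward to $\nu_S$; (iii) $\nabla\psi(Q\mathbf x)=Q\nabla\psi(\mathbf x)$ for every $Q\in\mathcal G$ and every $\mathbf x$ at which $\psi$ is differentiable (with $Q\mathbf x$ also a differentiability point); (iv) $\nabla\psi(\mathbf X)=S(\mathbf X,R(\mathbf X))R(\mathbf X)$ almost surely, where $S(\mathbf x,\mathbf h)\in\arg\min_{Q\in\mathcal G}\|Q^\top\mathbf x-\mathbf h\|^2$ (the product $S(\mathbf X,R(\mathbf X))R(\mathbf X)$ being a.s. the same for every choice of minimizer); (v) if $\mu$ and $\nu$ have finite second moments, then the law of $(\mathbf X,R(\mathbf X))$ is the unique minimizer of $\mathbb E[c(\mathbf X,\mathbf H)]$ over $(\mathbf X,\mathbf H)$ with law in $\Pi(\mu,\nu)$.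
   Context: Let $p\ge1$, $\mathcal G$ a compact subgroup of $\mathrm O(p)$, $\mathrm{Uniform}(\mathcal G)$ its normalized Haar measure, and $\mathcal P_{ac}(\mathbb R^p)$ the Borel probability measures on $\mathbb R^p$ with a Lebesgue density. $\nu$ is a fixed Borel probability measure on $\mathbb R^p$ (reference distribution). Cost: $c(\mathbf x,\mathbf h)=\min_{Q\in\mathcal G}\|Q^\top\mathbf x-\mathbf h\|^2$. $\Pi(\mu,\nu)$ is the set of Borel probability measures on $\mathbb R^p\times\mathbb R^p$ with marginals $\mu,\nu$. A set $\Gamma\subset\mathbb R^p\times\mathbb R^p$ is $c$-cyclically monotone if for all $N\in\mathbb N$ and $(\mathbf x_1,\mathbf y_1),\dots,(\mathbf x_N,\mathbf y_N)\in\Gamma$, $\sum_{i=1}^N c(\mathbf x_i,\mathbf y_i)\le\sum_{i=1}^N c(\mathbf x_i,\mathbf y_{i+1})$ with $\mathbf y_{N+1}=\mathbf y_1$. Assumption A1: there is a Borel set $B\subset\mathbb R^p$ with $\nu(B)=1$ such that for every $\mathbf x\in\mathbb R^p$ the orbit $\{Q\mathbf x:Q\in\mathcal G\}$ meets $B$ in at most one point. Under A1 the quotient map $q:\mathcal G B\to B$ (where $\mathcal G B=\{Q\mathbf x:Q\in\mathcal G,\mathbf x\in B\}$) is defined by $q(Q\mathbf x)=\mathbf x$ for $\mathbf x\in B$, $Q\in\mathcal G$. Let $S\sim\mathrm{Uniform}(\mathcal G)$ be independent of $\mathbf X\sim\mu$ and $\mathbf H\sim\nu$; $\mu_S$ and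 $\nu_S$ denote the laws of $S\mathbf X$ and $S\mathbf H$. *)

(* Defs.v *)
(* R^p is modelled as 'cV[R]_p
   (column vectors), p x p matrices as 'M[R]_p.  Both carry their usual
   (product/norm) topology from MathComp-Analysis; below we equip every
   matrix type 'M[R]_(m,n) with its Borel sigma-algebra (generated by the
   open sets). *)
From HB Require Import structures.
From mathcomp Require Import all_boot all_order all_algebra.
From mathcomp Require Import all_classical all_reals all_analysis.
From mathcomp Require Import measurable_realfun.
Set Implicit Arguments. Unset Strict Implicit. Unset Printing Implicit Defensive.
Import Order.TTheory GRing.Theory Num.Theory.
Import numFieldNormedType.Exports.
Local Open Scope classical_set_scope.
Local Open Scope ring_scope.

Section borel_mx.
Variables (R : realType) (m n : nat).
HB.instance Definition _ := @isMeasurable.Build (sigma_display (@open 'M[R]_(m,n)))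
  'M[R]_(m,n) <<s open >> (@sigma_algebra0 _ setT open)
  (@sigma_algebraC _ open) (@sigma_algebra_bigcup _ setT open).
End borel_mx.

Section defs.
Variables (R : realType) (p : nat).
Local Notation vec := 'cV[R]_p.
Local Notation mat := 'M[R]_p.

Definition compact_subgroup_O (G : set mat) : Prop :=
  [/\ compact G, G 1%:M,
      (forall Q, G Q -> Q^T *m Q = 1%:M),
      (forall P Q, G P -> G Q -> G (P *m Q)) &
      (forall Q, G Q -> G Q^T)].

Definition is_haar (G : set mat) (eta : set mat -> \bar R) : Prop :=
  eta G = 1%E /\
  forall Q A, G Q -> measurable A -> eta [set M | A (Q *m M)] = eta A.

Definition sqnorm (v : vec) : R := \sum_(i < p) v i ord0 ^+ 2.

(* c(x,h) = min_{Q in G} ||Q^T x - h||^2  (the min is attained, G compact) *)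
Definition cost (G : set mat) (x h : vec) : R :=
  inf [set sqnorm (Q^T *m x - h) | Q in G].

Definition c_cyclically_monotone (G : set mat) (Gam : set (vec * vec)) : Prop :=
  forall (N : nat) (z : 'I_N.+1 -> vec * vec),
    (forall i, Gam (z i)) ->
    \sum_(i < N.+1) cost G (z i).1 (z i).2
      <= \sum_(i < N.+1) cost G (z i).1 (z (ordS i)).2.

Definition msupport (pi : set (vec * vec) -> \bar R) : set (vec * vec) :=
  [set z | forall U, open U -> U z -> (0 < pi U)%E].

(* pi belongs to Pi(mu, nu) (pi is assumed to be a probability measure) *)
Definition coupling (mu nu : set vec -> \bar R) (pi : set (vec * vec) -> \bar R) :=
  forall A, measurable A -> pi (A `*` setT) = mu A /\ pi (setT `*` A) = nu A.

Definition is_lebesgue (lam : set vec -> \bar R) : Prop :=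
  forall a b : vec, (forall i, a i ord0 <= b i ord0) ->
    lam [set x | forall i, a i ord0 <= x i ord0 <= b i ord0]
      = (\prod_(i < p) (b i ord0 - a i ord0))%:E.

Definition has_density (lam mu : set vec -> \bar R) : Prop :=
  exists f : vec -> R, [/\ measurable_fun [set: vec] f, (forall x, 0 <= f x) &
    forall A, measurable A -> mu A = (\int[lam]_(x in A) (f x)%:E)%E].

Definition assumption_A1 (G : set mat) (nu : set vec -> \bar R) (B : set vec) :=
  [/\ measurable B, nu B = 1%E &
      forall x P Q, G P -> G Q -> B (P *m x) -> B (Q *m x) -> P *m x = Q *m x].

Definition orbit_set (G : set mat) (B : set vec) : set vec :=
  [set y | exists Q x, [/\ G Q, B x & y = Q *m x]].

Definition qmap (G : set mat) (B : set vec) (y : vec) : vec :=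
  get [set x | B x /\ exists Q, G Q /\ y = Q *m x].

Definition convex_ext (psi : vec -> \bar R) : Prop :=
  (forall x, psi x != -oo%E) /\
  forall (x y : vec) (t : R), 0 < t < 1 ->
    (psi (t *: x + (1 - t) *: y)%R <= t%:E * psi x + (1 - t)%:E * psi y)%E.

Definition diff_at (psi : vec -> \bar R) (x : vec) : Prop :=
  (\forall y \near x, psi y \is a fin_num) /\
  differentiable (fun y => fine (psi y)) x.

(* gradient (meaningful where diff_at psi x holds) *)
Definition grad (psi : vec -> \bar R) (x : vec) : vec :=
  \col_i ('d (fun y => fine (psi y)) x (delta_mx i ord0)).

Definition argmin_selector (G : set mat) (S : vec -> vec -> mat) : Prop :=
  forall x h, G (S x h) /\
    forall Q, G Q -> sqnorm ((S x h)^T *m x - h) <= sqnorm (Q^T *m x - h).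

End defs.

(* Main.v *)
(* Write c(x,h) = |x|^2 + |h|^2 - 2 s(x,h) with s(x,h) = max_Q <x, Q h>. Optimal plans
   between finite discretizations of mu and nu are c-cyclically monotone; their limit
   along an ultrafilter is an additive set function on rectangles whose support is
   c-cyclically monotone and projects onto almost everything. Rockafellar's construction
   with s in place of the scalar product gives a G-invariant convex lsc psi with
   psi(x) + phi(h) >= s(x,h), with equality on the support. A measurable set disjoint
   from its translates x + t v, for all rational t in (0,1], is Lebesgue null; applied to
   points with a kink along an axis this makes psi differentiable mu-a.e., and a contact
   point h of x then satisfies Q h = grad psi(x) for every optimal Q, so that A1
   determines h = R(x). Two pairs of potentials for couplings with the same marginals
   share their contact sets, as one sees by comparing the superlevel sets of the
   differences of the potentials; this gives all uniqueness claims, with s for the law of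
   (X, R(X)) and with the scalar product for grad psi. Haar measure being right invariant
   by Fubini, S grad psi(X) = S Q R(X) has the law of S H. *)
Require Import Defs.
From HB Require Import structures.
From mathcomp Require Import finmap.
From mathcomp Require Import all_boot all_order all_algebra.
From mathcomp Require Import all_classical all_reals all_analysis.
From mathcomp Require Import measurable_realfun.
From mathcomp Require Import ring lra.
Import Order.TTheory GRing.Theory Num.Theory.
Import numFieldNormedType.Exports.
Local Open Scope classical_set_scope.
Local Open Scope ring_scope.
Set Implicit Arguments. Unset Strict Implicit. Unset Printing Implicit Defensive.
Import Num.Def.

(** * Borel sets of matrices *)

(** No moment is assumed, so the total cost may be infinite for every coupling and optimality cannot
    be tested by integrals: only cyclical monotonicity survives, and potentials are compared on
    level sets instead of being integrated. The limit plan is never extended to a measure; as it is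
    only finitely subadditive, it is tested on compact sets, and inner regularity of [mu] and [nu]
    leads back to Borel sets. [B] is merely Borel, so it is exhausted by compact subsets up to a
    null set. Projections of closed sets along these are Borel, and since the contact point in [B]
    is unique, preimages of closed sets under the map are such projections; this makes the map
    measurable without a selection theorem. The function [s] is not bilinear, but it is a maximum of
    linear forms in [x], and a maximising [Q] turns an [s]-contact into an ordinary subgradient. A
    competitor of [grad psi] in (ii) is only convex: its gradient is shown to be measurable from
    convexity and one interior point of the domain. *)

Section matrix_borel.
Variables (R : realType) (m n : nat).
Local Notation mx := 'M[R]_(m, n).

Lemma coord_le_norm (x : mx) i j : `|x i j| <= `|x|.
Proof.
rewrite [leRHS]/Num.norm/= mx_normrE; apply/bigmax_geP; right => /=.
by exists (i, j).
Qed.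

Lemma norm_le_coord (x : mx) r : 0 <= r -> (forall i j, `|x i j| <= r) ->
  `|x| <= r.
Proof.
move=> r0 xr; rewrite [leLHS]/Num.norm/= mx_normrE; apply/bigmax_leP; split=> // -[i j] _; exact: xr.
Qed.

Lemma norm_lt_coord (x : mx) r : 0 < r -> (forall i j, `|x i j| < r) ->
  `|x| < r.
Proof.
move=> r0 xr; rewrite [ltLHS]/Num.norm/= mx_normrE; apply/bigmax_ltP; split=> // -[i j] _; exact: xr.
Qed.

Lemma coord_continuous i j : continuous (fun x : mx => x i j).
Proof.
move=> x A xA; exists (fun i' j' => if (i' == i) && (j' == j) then A else setT).
  move=> i' j'; case: ifPn => [/andP[/eqP-> /eqP->]//|_]; exact: filterT.
by move=> y /(_ i j); rewrite !eqxx.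
Qed.

Lemma cvg_coord {T : Type} (F : set_system T) {FF : Filter F} (f : T -> mx)
    (M : mx) :
  (forall i j, f x i j @[x --> F] --> M i j) -> f x @[x --> F] --> M.
Proof.
move=> h A [P MP PA]; rewrite /nbhs/=.
apply: (@filterS _ F _ [set x | forall ij, P ij.1 ij.2 (f x ij.1 ij.2)]).
  by move=> x Px; apply: PA => i j; exact: (Px (i, j)).
apply: (filter_forall FF) => -[i j] /=; apply: h; exact: MP.
Qed.

Lemma nbhs_norm_lt (x : mx) (U : set mx) : open U -> U x ->
  exists2 r : R, 0 < r & forall y, `|y - x| < r -> U y.
Proof.
move=> oU Ux; have /nbhs_ballP[r /= r0 rU] := open_nbhs_nbhs (conj oU Ux).
by exists r => // y yx; apply: rU; rewrite -ball_normE /ball_/= distrC.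
Qed.

(** A countable base indexed by [nat]: a code unpickles to a rational centre and an integer [N]
    standing for the radius [1 / N.+1]. Plain numbers as indices give a meaning to the first [n]
    balls, used by the discretizations; a number that is no code yields the unit ball at 0. *)
Definition rat_center (k : nat) : mx :=
  if @unpickle ('M[rat]_(m, n) * nat)%type k is Some dN then map_mx ratr dN.1
  else 0.

Definition rat_radius (k : nat) : R :=
  if @unpickle ('M[rat]_(m, n) * nat)%type k is Some dN then dN.2.+1%:R^-1
  else 1.

Definition rat_ball k : set mx := [set y | `|y - rat_center k| < rat_radius k].

Definition rat_cball k : set mx := [set y | `|y - rat_center k| <= rat_radius k].

Lemma rat_radius_gt0 k : 0 < rat_radius k.
Proof. by rewrite /rat_radius; case: unpickle. Qed.

Lemma open_norm_lt (x : mx) (r : R) : open [set y | `|y - x| < r].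
Proof.
have -> : [set y | `|y - x| < r] = ball x r.
  by rewrite -ball_normE; apply/seteqP; split => y; rewrite /ball_/= distrC.
exact: ball_open.
Qed.

Lemma rat_ball_open k : open (rat_ball k). Proof. exact: open_norm_lt. Qed.

Lemma closed_norm_le (x : mx) (r : R) : closed [set y | `|y - x| <= r].
Proof.
rewrite -[X in closed X]setCK; apply: open_closedC.
rewrite (_ : ~` _ = [set y | r < `|y - x|]).
  rewrite openE => y /= ry; apply/nbhs_ballP; exists (`|y - x| - r) => /=.
    by rewrite subr_gt0.
  move=> z; rewrite -ball_normE /ball_/= => yz.
  have : `|y - x| <= `|y - z| + `|z - x| by rewrite (le_trans _ (ler_normD _ _))// addrA subrK.
  by lra.
by apply/seteqP; split => y /=; rewrite ltNge; [move/negP|move=> /negP].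
Qed.

Lemma rat_cball_closed k : closed (rat_cball k).
Proof. exact: closed_norm_le. Qed.

Lemma rat_ball_sub k : rat_ball k `<=` rat_cball k.
Proof. by move=> y /= /ltW. Qed.

Lemma rat_ball_dense (x : mx) (r : R) : 0 < r -> exists k,
  [/\ rat_ball k x, rat_radius k < r & `|rat_center k - x| < r].
Proof.
move=> r0; have [N Nr] : exists N : nat, N.+1%:R^-1 < r.
  exists (Num.trunc r^-1); rewrite invf_plt ?posrE//.
  by have := truncnS_gt r^-1; rewrite ?natr1.
have Nr0 : 0 < N.+1%:R^-1 :> R by [].
have ex i j : exists q : rat, `|ratr q - x i j| < N.+1%:R^-1.
  have [q] := rat_in_itvoo (ltr_pwDr Nr0 (lexx (x i j))).
  rewrite in_itv/= => /andP[]; move: Nr0; move: (N.+1%:R^-1) => e e0 q1 q2.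
  by exists q; rewrite ltr_distl; apply/andP; split; lra.
pose d := \matrix_(i, j) xchoose (ex i j).
exists (pickle (d, N)); rewrite /rat_ball /rat_radius /rat_center !pickleK/=.
have dx : `|map_mx ratr d - x| < N.+1%:R^-1.
  apply: norm_lt_coord => // i j; rewrite !mxE; exact: (xchooseP (ex i j)).
by rewrite distrC; split => //; exact: lt_trans dx Nr.
Qed.

Lemma rat_cball_base (U : set mx) x : open U -> U x ->
  exists2 k, rat_ball k x & rat_cball k `<=` U.
Proof.
move=> oU Ux; have [r r0 rU] := nbhs_norm_lt oU Ux.
have [k [kx kr kc]] := rat_ball_dense x (divr_gt0 r0 (ltr0n R 2)).
exists k => // y; rewrite /rat_cball/= => yk; apply: rU.
have : `|y - x| <= `|y - rat_center k| + `|rat_center k - x|.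
  by rewrite (le_trans _ (ler_normD _ _))// addrA subrK.
by lra.
Qed.

Lemma rat_ball_base (U : set mx) x : open U -> U x ->
  exists2 k, rat_ball k x & rat_ball k `<=` U.
Proof.
move=> oU Ux; have [k kx kU] := rat_cball_base oU Ux; exists k => //.
by apply: subset_trans kU; exact: rat_ball_sub.
Qed.

Lemma open_bigcup_rat_cball (U : set mx) : open U ->
  U = \bigcup_(k in [set k | rat_cball k `<=` U]) rat_cball k.
Proof.
move=> oU; apply/seteqP; split => [x Ux|x [k /= + kx]]; last exact.
by have [k kx kU] := rat_cball_base oU Ux; exists k => //; exact: rat_ball_sub.
Qed.

Lemma open_borel (U : set mx) : open U -> measurable U.
Proof. by move=> oU; exact: sub_sigma_algebra. Qed.

Lemma closed_borel (U : set mx) : closed U -> measurable U.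
Proof.
by move=> cU; rewrite -[U]setCK; apply: measurableC; apply: open_borel; exact: closed_openC.
Qed.

Lemma mx_hausdorff : hausdorff_space mx.
Proof. exact: norm_hausdorff. Qed.

Lemma compact_borel (U : set mx) : compact U -> measurable U.
Proof. by move=> cU; apply: closed_borel; exact: compact_closed mx_hausdorff _. Qed.

End matrix_borel.

(** Heine-Borel for row vectors is carried over by [vec_mx], a continuous bijection: [A] is the
    image of its preimage, which is closed and bounded. *)
Lemma bounded_closed_compact_mx (R : realType) m n (A : set 'M[R]_(m, n)) (M : R) :
  (forall x, A x -> `|x| <= M) -> closed A -> compact A.
Proof.
move=> AM cA.
have vc : continuous (@vec_mx R m n : 'rV[R]_(m * n) -> 'M[R]_(m, n)).
  move=> v; apply: (@cvg_coord _ _ _ _ (nbhs v)) => i j.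
  rewrite [X in _ --> X]mxE; under eq_fun do rewrite mxE.
  exact: (@coord_continuous R 1 (m * n) ord0 (mxvec_index i j) v).
have -> : A = vec_mx @` (vec_mx @^-1` A).
  apply/seteqP; split => [x Ax|x [v Av <-]//].
  by exists (mxvec x); rewrite /preimage/= mxvecK.
apply: continuous_compact; first by apply: continuous_subspaceT; exact: vc.
apply: bounded_closed_compact; last first.
  by apply: (@preimage_closed _ _ (@vec_mx R m n : 'rV[R]_(m * n) -> 'M[R]_(m, n))) => // x _; exact: vc.
exists M; split => [|r Mr v Av /=]; first exact: num_real.
apply: norm_le_coord => [|i j].
  by rewrite (le_trans _ (ltW Mr))// (le_trans _ (AM _ Av)).
rewrite (ord1 i); case/mxvec_indexP: j => a b.
have -> : v ord0 (mxvec_index a b) = vec_mx v a b by rewrite mxE.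
by rewrite (le_trans (coord_le_norm _ _ _))// (le_trans (AM _ Av))// ltW.
Qed.

Lemma countType_bigcup_measurable d (T : sigmaRingType d) (I : countType)
    (P : set I) (F : I -> set T) :
  (forall i, P i -> measurable (F i)) -> measurable (\bigcup_(i in P) F i).
Proof.
move=> mF; rewrite bigcup_mkcond; apply: countable_bigcupT_measurable => // i.
by case: ifPn => // /set_mem; exact: mF.
Qed.

Lemma countType_bigcap_measurable d (T : measurableType d) (I : countType)
    (P : set I) (F : I -> set T) :
  (forall i, P i -> measurable (F i)) -> measurable (\bigcap_(i in P) F i).
Proof.
move=> mF; rewrite -[X in measurable X]setCK setC_bigcap; apply: measurableC.
by apply: countType_bigcup_measurable => i Pi; apply: measurableC; exact: mF.
Qed.

Section matrix_measurable_fun.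
Variables (R : realType) (m n : nat).
Local Notation mx := 'M[R]_(m, n).

Lemma measurable_gtP d (T : measurableType d) (f : T -> \bar R) :
  (forall a : R, measurable [set x | (a%:E < f x)%E]) -> measurable_fun setT f.
Proof.
move=> mf; apply: (measurability _ (ErealGenOInfty.measurableE R)).
move=> /= _ [_ [a ->]] <-; apply: measurableI => //.
by rewrite preimage_itvoy; exact: mf.
Qed.

Lemma lsc_measurable (f : mx -> \bar R) :
  lower_semicontinuous f -> measurable_fun setT f.
Proof.
move=> lf; apply: measurable_gtP => a; apply: open_borel.
by move/lower_semicontinuousP : lf; exact.
Qed.

Lemma continuous_measurable_mx (f : mx -> R) :
  continuous f -> measurable_fun setT f.
Proof.
move=> /continuousP cf; apply: (measurability _ (RGenOpens.measurableE R)).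
move=> _ [_ [a [b ->] <-]]; rewrite setTI; apply: open_borel.
exact/cf/interval_open.
Qed.

Lemma measurable_coord i j : measurable_fun setT (fun x : mx => x i j).
Proof. by apply: continuous_measurable_mx; exact: coord_continuous. Qed.

(** The norm is the maximum of the entries, so the preimage of a closed ball is a finite
    intersection of conditions on single coordinates; countably many such balls fill an open set. *)
Lemma measurable_fun_coord d (T : measurableType d) (f : T -> mx) :
  (forall i j, measurable_fun setT (fun x => f x i j)) -> measurable_fun setT f.
Proof.
move=> mf; apply: (@measurability _ _ _ _ _ _ (@open mx)) => //.
move=> _ [U oU <-]; rewrite setTI (open_bigcup_rat_cball oU) preimage_bigcup.
apply: bigcup_measurable => k _.
rewrite (_ : _ @^-1` _ = \bigcap_(ij in [set: 'I_m * 'I_n])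
   [set x | `|f x ij.1 ij.2 - rat_center R m n k ij.1 ij.2| <= rat_radius R m n k]); last first.
  apply/seteqP; split => x /= => [xk [i j] _ /=|xk].
    by apply: le_trans xk; rewrite (le_trans _ (coord_le_norm _ i j))// !mxE.
  apply: norm_le_coord => [|i j]; first exact/ltW/rat_radius_gt0.
  by have := xk (i, j) I; rewrite !mxE.
apply: fin_bigcap_measurable => // -[i j] _ /=.
rewrite -[X in measurable X]setTI; apply: measurable_fun_le => //.
by apply: measurableT_comp => //; exact: measurable_funB.
Qed.

End matrix_measurable_fun.

Section matrix_product_borel.
Variables (R : realType) (m n k l : nat).
Local Notation X := 'M[R]_(m, n).
Local Notation Y := 'M[R]_(k, l).

Lemma open_setX_base (U : set (X * Y)) z : open U -> U z ->
  exists ij : nat * nat, [/\ @rat_ball R m n ij.1 z.1, @rat_ball R k l ij.2 z.2 &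
    @rat_cball R m n ij.1 `*` @rat_cball R k l ij.2 `<=` U].
Proof.
move=> oU Uz; have /= := open_nbhs_nbhs (conj oU Uz).
case: z Uz => x y Uxy [[A B] /= [xA yB] ABU].
have [i ix iA] := rat_cball_base (@open_interior _ A) xA.
have [j jy jB] := rat_cball_base (@open_interior _ B) yB.
exists (i, j); split => // -[a b] [/iA ha /jB hb]; apply: ABU; split.
  exact: interior_subset ha.
exact: interior_subset hb.
Qed.

(** The sigma-algebra of the product is generated by rectangles; it contains the open sets because
    countably many products of closed balls fill each of them. *)
Lemma open_setX_borel (U : set (X * Y)) : open U -> measurable U.
Proof.
move=> oU; rewrite (_ : U = \bigcup_(ij in [set ij : nat * nat |
   @rat_cball R m n ij.1 `*` @rat_cball R k l ij.2 `<=` U])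
   (@rat_cball R m n ij.1 `*` @rat_cball R k l ij.2)); last first.
  apply/seteqP; split => [z Uz|z [ij /= + zij]]; last exact.
  have [ij [zi zj ijU]] := open_setX_base oU Uz; exists ij => //.
  by split; exact: rat_ball_sub.
apply: countType_bigcup_measurable.
by move=> ij _; apply: measurableX; apply: closed_borel; exact: rat_cball_closed.
Qed.

Lemma closed_setX_borel (U : set (X * Y)) : closed U -> measurable U.
Proof.
by move=> cU; rewrite -[U]setCK; apply: measurableC; apply: open_setX_borel; exact: closed_openC.
Qed.

Lemma continuous_measurable_setX (f : X * Y -> R) :
  continuous f -> measurable_fun setT f.
Proof.
move=> /continuousP cf; apply: (measurability _ (RGenOpens.measurableE R)).
move=> _ [_ [a [b ->] <-]]; rewrite setTI; apply: open_setX_borel.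
exact/cf/interval_open.
Qed.

End matrix_product_borel.

Lemma measurable_mulmx (R : realType) p :
  measurable_fun setT (fun z : 'M[R]_p * 'cV[R]_p => z.1 *m z.2).
Proof.
apply: measurable_fun_coord => i j.
under eq_fun do rewrite mxE.
apply: measurable_sum => k; apply: measurable_funM.
  exact: (measurableT_comp (@measurable_coord R p p i k) measurable_fst).
exact: (measurableT_comp (@measurable_coord R p 1 k j) measurable_snd).
Qed.

(** * Inner regularity *)

Section regularity.
Variables (R : realType).

Lemma bigcup_approx d (T : measurableType d) (P : probability T R)
    (F : nat -> set T) (e : R) : (forall k, measurable (F k)) -> 0 < e ->
  exists n, (P (\bigcup_k F k `\` \bigcup_(k in `I_n) F k) < e%:E)%E.
Proof.
move=> mF e0; pose H n := \bigcup_k F k `\` \bigcup_(k in `I_n) F k.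
have mH n : measurable (H n).
  by apply: measurableD; [apply: bigcup_measurable|apply: fin_bigcup_measurable].
have H0 : \bigcap_n H n = set0.
  rewrite -subset0 => x Hx; have [[k _ Fkx] _] := Hx 0%N I.
  by have [_] := Hx k.+1 I; apply; exists k => /=.
have : P (H n) @[n --> \oo] --> P (\bigcap_n H n).
  apply: nonincreasing_cvg_mu => //.
  - by rewrite (le_lt_trans (probability_le1 _ _))// ltry.
  - by rewrite H0.
  - move=> i j ij; apply/subsetPset; apply: setDS => x [k /= ki Fk].
    by exists k => //=; exact: leq_trans ki ij.
rewrite H0 measure0 => /fine_cvgP[Hfin] /cvgrPdist_lt/(_ _ e0) He.
near \oo => n; exists n; rewrite -/(H n).
have Hn : P (H n) \is a fin_num by near: n.
have : `|0 - fine (P (H n))| < e by near: n.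
rewrite sub0r normrN ger0_norm ?fine_ge0//.
by rewrite -lte_fin fineK.
Unshelve. all: by end_near. Qed.

Lemma measure_cover2 d (T : measurableType d) (P : {measure set T -> \bar R})
    (A B C : set T) (a b : R) :
  measurable A -> measurable B -> measurable C -> C `<=` A `|` B ->
  (P A < a%:E)%E -> (P B <= b%:E)%E -> (P C < (a + b)%:E)%E.
Proof.
move=> mA mB mC CAB PA PB; rewrite EFinD.
have mAB : measurable (A `|` B) by exact: measurableU.
apply: (@le_lt_trans _ _ (P A + P B)%E).
  apply: le_trans (measureU2 _ mA mB).
  by apply: le_measure => //; rewrite inE.
apply: lte_leD => //.
by rewrite ge0_fin_numE// (le_lt_trans PB)// ltry.
Qed.

Variables (m n : nat).
Local Notation mx := 'M[R]_(m, n).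
Variable P : probability mx R.

(** Squeezing from both sides makes the class stable under complement, as closed and open sets
    exchange roles. It is a sigma-algebra containing the open sets, hence all Borel sets. *)
Let approx := [set A : set mx | measurable A /\ forall e : R, 0 < e ->
  exists F U, [/\ closed F, open U, F `<=` A, A `<=` U & (P (U `\` F) < e%:E)%E]].

Let approx_open U : open U -> approx U.
Proof.
move=> oU; split => [|e e0]; first exact: open_borel.
pose F k := if pselect (@rat_cball R m n k `<=` U) then @rat_cball R m n k else set0.
have cF k : closed (F k).
  rewrite /F; case: pselect => ? /=; [exact: rat_cball_closed|exact: closed0].
have FU : \bigcup_k F k = U.
  rewrite (open_bigcup_rat_cball oU); apply/seteqP; split => x [k].
    by rewrite /F; case: pselect => // kU _ kx; exists k.
  by move=> kU kx; exists k => //; rewrite /F; case: pselect.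
have [N PN] := @bigcup_approx _ _ P F e (fun k => closed_borel (cF k)) e0.
exists (\bigcup_(k in `I_N) F k), U; split => //.
- by apply: closed_bigcup => //; exact: finite_II.
- by rewrite -FU => x [k _ Fk]; exists k.
- by rewrite -{1}FU.
Qed.

Let approx_sigma : sigma_algebra setT approx.
Proof.
split.
- split => // e e0; exists set0, set0; rewrite setD0 measure0 lte_fin; split => //.
  exact: closed0.
- move=> A [mA aA]; split => [|e e0]; first exact: measurableD.
  have [F [U [cF oU FA AU PUF]]] := aA _ e0.
  exists (~` U), (~` F); split => //.
  - exact: open_closedC.
  - exact: closed_openC.
  - by move=> x Ux; split => // /AU.
  - by move=> x [_ nA] /FA.
  - by rewrite setDE setCK setIC.
- move=> A aA; split => [|e e0]; first by apply: bigcup_measurable => k _; have [] := aA k.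
  have h k : exists FU : set mx * set mx, [/\ closed FU.1, open FU.2, FU.1 `<=` A k,
      A k `<=` FU.2 & (P (FU.2 `\` FU.1) < (e / 2 / (2 ^ k.+1)%:R)%:E)%E].
    have [_ /(_ (e / 2 / (2 ^ k.+1)%:R))[]] := aA k.
      by rewrite !divr_gt0// ltr0n expn_gt0.
    by move=> F [U FU]; exists (F, U).
  have {h}[FU hFU] := choice h.
  have cF k : closed (FU k).1 by have [] := hFU k.
  have oU k : open (FU k).2 by have [] := hFU k.
  have mD k : measurable ((FU k).2 `\` (FU k).1).
    by apply: measurableD; [exact: open_borel|exact: closed_borel].
  have e20 : 0 < e / 2 by rewrite divr_gt0.
  (* A countable union of closed sets need not be closed: it is cut after [N] terms at the price
     [e / 2]. The other half of [e] is shared geometrically among the gaps. *)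
  have [N PN] := @bigcup_approx _ _ P (fun k => (FU k).1) _ (fun k => closed_borel (cF k)) e20.
  have PU : (P (\bigcup_k ((FU k).2 `\` (FU k).1)) <= (e / 2)%:E)%E.
    apply: le_trans (epsilon_trick0 xpredT (ltW e20)).
    apply: (@le_trans _ _ (\sum_(0 <= k <oo) P ((FU k).2 `\` (FU k).1))%E).
      apply: measure_sigma_subadditive => //; exact: bigcup_measurable.
    by apply: lee_nneseries => // k _; have [_ _ _ _ ?] := hFU k; exact: ltW.
  exists (\bigcup_(k in `I_N) (FU k).1), (\bigcup_k (FU k).2); split.
  - by apply: closed_bigcup => //; exact: finite_II.
  - by apply: bigcup_open => k _.
  - by move=> x [k _ Fk]; exists k => //; have [_ _ h _ _] := hFU k; exact: h.
  - by move=> x [k _ Ak]; exists k => //; have [_ _ _ h _] := hFU k; exact: h.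
  - rewrite [e]splitr; apply: (measure_cover2 _ _ _ _ PN PU).
    + apply: measurableD; first by apply: bigcup_measurable => k _; exact: closed_borel.
      by apply: fin_bigcup_measurable => // k _; exact: closed_borel.
    + exact: bigcup_measurable.
    + apply: measurableD; first by apply: bigcup_measurable => k _; exact: open_borel.
      by apply: fin_bigcup_measurable => // k _; exact: closed_borel.
    + move=> x [[k _ Ux] nF]; have [Fx|nFx] := pselect ((FU k).1 x).
        by left; split => //; exists k.
      by right; exists k.
Qed.

Lemma inner_regular (A : set mx) (e : R) : measurable A -> 0 < e ->
  exists K, [/\ compact K, K `<=` A & (P (A `\` K) < e%:E)%E].
Proof.
move=> mA e0; have e20 : 0 < e / 2 by rewrite divr_gt0.
have [_ /(_ _ e20)[F [U [cF oU FA AU PUF]]]] : approx A.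
  by apply: mA; split; [exact: approx_sigma|exact: approx_open].
pose G k := F `&` [set x | `|x - 0| <= k%:R].
have cG k : closed (G k) by apply: closedI => //; exact: closed_norm_le.
have FG : \bigcup_k G k = F.
  apply/seteqP; split => [x [k _ []]//|x Fx]; exists (Num.trunc `|x|).+1 => //.
  by split => //=; rewrite subr0 ltW// truncnS_gt.
have [N PN] := @bigcup_approx _ _ P G _ (fun k => closed_borel (cG k)) e20.
exists (\bigcup_(k in `I_N) G k); split.
- apply: (@bounded_closed_compact_mx _ _ _ _ N%:R).
    by move=> x [k /= kN [_]]; rewrite /= subr0 => /le_trans; apply; rewrite ler_nat ltnW.
  by apply: closed_bigcup => //; exact: finite_II.
- by move=> x [k _ [/FA]].
- rewrite [e]splitr; apply: (measure_cover2 _ _ _ _ PN (ltW PUF)).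
  + apply: measurableD; first by rewrite FG; exact: closed_borel.
    by apply: fin_bigcup_measurable => // k _; exact: closed_borel.
  + by apply: measurableD; [exact: open_borel|exact: closed_borel].
  + apply: measurableD => //.
    by apply: fin_bigcup_measurable => // k _; exact: closed_borel.
  + move=> x [Ax nG]; have [Fx|nFx] := pselect (F x).
      by left; rewrite FG.
    by right; split => //; exact: AU.
Qed.

End regularity.

(** * Discrete and limit transport plans *)

Lemma measurable_rat_ball (R : realType) m n k : measurable (@rat_ball R m n k).
Proof. by apply: open_borel; exact: rat_ball_open. Qed.

Section discrete_plan.
Variable R : realType.

Lemma continuous_sum (T : topologicalType) (I : Type) (r : seq I) (F : I -> T -> R) :
  (forall i, continuous (F i)) -> continuous (fun x => \sum_(i <- r) F i x).
Proof.
move=> cF; elim: r => [|i r IH] x.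
  by under eq_fun do rewrite big_nil; exact: cvg_cst.
have -> : (fun x => \sum_(j <- i :: r) F j x) = F i \+ (fun x => \sum_(j <- r) F j x).
  by apply/funext => y /=; rewrite big_cons.
exact: continuousD (cF i x) (IH x).
Qed.

Lemma linear_form_continuous m n (w : 'I_m -> 'I_n -> R) :
  continuous (fun P : 'M[R]_(m, n) => \sum_i \sum_j w i j * P i j).
Proof.
apply: continuous_sum => i; apply: continuous_sum => j x.
by apply: continuousM; [exact: cst_continuous|exact: coord_continuous].
Qed.

Lemma closed_continuous_preimage (T : topologicalType) (f : T -> R) (D : set R) :
  continuous f -> closed D -> closed [set x | D (f x)].
Proof. by move=> cf cD; apply: (@preimage_closed _ _ f) => // x _; exact: cf. Qed.

Definition transport_plan m n (a : 'I_m -> R) (b : 'I_n -> R) : set 'M[R]_(m, n) :=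
  [set P | [/\ forall i j, 0 <= P i j, forall i, \sum_j P i j = a i &
    forall j, \sum_i P i j = b j]].

Lemma transport_plan_compact m n (a : 'I_m -> R) (b : 'I_n -> R) :
  compact (transport_plan a b).
Proof.
apply: (@bounded_closed_compact_mx _ _ _ _ (\sum_i `|a i|)) => [P [P0 Pa _]|].
  apply: norm_le_coord => [|i j]; first by apply: sumr_ge0.
  rewrite ger0_norm// (le_trans _ (_ : a i <= _))//.
    by rewrite -Pa (bigD1 j)//= lerDl sumr_ge0.
  by rewrite (bigD1 i)//= (le_trans (ler_norm _))// lerDl sumr_ge0.
have -> : transport_plan a b =
  (\bigcap_(ij in [set: 'I_m * 'I_n]) [set P | 0 <= P ij.1 ij.2]) `&`
  (\bigcap_(i in [set: 'I_m]) [set P | \sum_j P i j = a i]) `&`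
  (\bigcap_(j in [set: 'I_n]) [set P | \sum_i P i j = b j]).
  apply/seteqP; split => P /=.
    by move=> [P0 Pa Pb]; split; [split|] => [[i j]|i|j] _ /=.
  by move=> [[P0 Pa] Pb]; split => [i j|i|j]; [exact: (P0 (i, j))|exact: Pa|exact: Pb].
apply: closedI; [apply: closedI|]; apply: closed_bigI => i _.
- exact: (closed_continuous_preimage (@coord_continuous R m n i.1 i.2) (@closed_ge _ 0)).
- have cs : continuous (fun P : 'M[R]_(m, n) => \sum_j P i j : R).
    by apply: continuous_sum => j; exact: coord_continuous.
  exact: (closed_continuous_preimage cs (@closed_eq _ _)).
- have cs : continuous (fun P : 'M[R]_(m, n) => \sum_j P j i : R).
    by apply: continuous_sum => j; exact: coord_continuous.
  exact: (closed_continuous_preimage cs (@closed_eq _ _)).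
Qed.

Lemma sum_row_delta m n a b i :
  \sum_j (delta_mx a b : 'M[R]_(m, n)) i j = (i == a)%:R.
Proof.
rewrite (bigD1 b)//= mxE eqxx andbT big1 ?addr0// => j jb.
by rewrite mxE (negbTE jb) andbF.
Qed.

Lemma sum_col_delta m n a b j :
  \sum_i (delta_mx a b : 'M[R]_(m, n)) i j = (j == b)%:R.
Proof.
rewrite (bigD1 a)//= mxE eqxx big1 ?addr0// => i ia.
by rewrite mxE (negbTE ia).
Qed.

Lemma mx_shiftE m n (P Q1 Q2 : 'M[R]_(m, n)) d i j :
  (P + d *: (Q2 - Q1)) i j = P i j + d * (Q2 i j - Q1 i j).
Proof. by rewrite !mxE. Qed.

Lemma sum_delta m n (w : 'I_m -> 'I_n -> R) a b :
  \sum_i \sum_j w i j * (delta_mx a b : 'M[R]_(m, n)) i j = w a b.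
Proof.
rewrite (bigD1 a)//= (bigD1 b)//= mxE !eqxx mulr1 [X in _ + X + _]big1; last first.
  by move=> j jb; rewrite mxE (negbTE jb) andbF mulr0.
rewrite big1 ?addr0// => i ia; apply: big1 => j _.
by rewrite mxE (negbTE ia) mulr0.
Qed.

Lemma sum_form_add m n (w : 'I_m -> 'I_n -> R) (P Q : 'M[R]_(m, n)) d :
  \sum_i \sum_j w i j * (P + d *: Q) i j =
  \sum_i \sum_j w i j * P i j + d * (\sum_i \sum_j w i j * Q i j).
Proof.
rewrite mulr_sumr -big_split/=; apply: eq_bigr => i _.
rewrite mulr_sumr -big_split/=; apply: eq_bigr => j _.
by rewrite !mxE; ring.
Qed.

Lemma sum_form_sum m n (w : 'I_m -> 'I_n -> R) N (Q : 'I_N -> 'M[R]_(m, n)) :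
  \sum_i \sum_j w i j * (\sum_k Q k) i j =
  \sum_k \sum_i \sum_j w i j * Q k i j.
Proof.
rewrite [RHS]exchange_big/=; apply: eq_bigr => i _.
rewrite [RHS]exchange_big/=; apply: eq_bigr => j _.
by rewrite summxE mulr_sumr.
Qed.

(* Shifting a small mass along the cycle from (x_k, y_k) to (x_k, y_(k+1)) keeps
   the marginals, so it cannot lower the cost of an optimal plan. *)
Lemma exists_cyclic_plan m n (a : 'I_m -> R) (b : 'I_n -> R)
    (c : 'I_m -> 'I_n -> R) :
  (forall i, 0 <= a i) -> (forall j, 0 <= b j) ->
  \sum_i a i = 1 -> \sum_j b j = 1 ->
  exists2 P, transport_plan a b P &
    forall N (z : 'I_N.+1 -> 'I_m * 'I_n),
      (forall k, 0 < P (z k).1 (z k).2) ->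
      \sum_k c (z k).1 (z k).2 <= \sum_k c (z k).1 (z (ordS k)).2.
Proof.
move=> a0 b0 a1 b1.
have ne : transport_plan a b !=set0.
  exists (\matrix_(i, j) (a i * b j)); split => [i j|i|j].
  - by rewrite mxE mulr_ge0.
  - by under eq_bigr do rewrite mxE; rewrite -mulr_sumr b1 mulr1.
  - by under eq_bigr do rewrite mxE; rewrite -mulr_suml a1 mul1r.
have [] := compact_EVT_min ne (@transport_plan_compact m n a b)
   (continuous_subspaceT (@linear_form_continuous m n c)).
move=> P /set_mem [P0 Pa Pb] Pmin; exists P => // N z Pz.
(* The smallest mass along the cycle, divided by [N.+1] because one cell may be visited up to [N.+1]
   times. *)
pose d := \big[minr/P (z ord0).1 (z ord0).2]_k P (z k).1 (z k).2 / N.+1%:R.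
have d0 : 0 < d by rewrite divr_gt0//; apply/bigmin_gtP; split.
have dP k : d * N.+1%:R <= P (z k).1 (z k).2.
  by rewrite divfK ?pnatr_eq0//; apply: bigmin_le_cond.
pose E1 := \sum_k delta_mx (z k).1 (z k).2 : 'M[R]_(m, n).
pose E2 := \sum_k delta_mx (z k).1 (z (ordS k)).2 : 'M[R]_(m, n).
have E1le i j : d * E1 i j <= P i j.
  have [/existsP[k /eqP zk]|/existsPn nz] := boolP [exists k, z k == (i, j)].
    apply: le_trans (_ : d * N.+1%:R <= _); last by have := dP k; rewrite zk.
    rewrite ler_pM2l// /E1 summxE -[leRHS]/(N.+1%:R).
    rewrite -[in leRHS](card_ord N.+1) -sumr_const; apply: ler_sum => k' _.
    by rewrite mxE; case: (_ && _).
  rewrite /E1 summxE big1 ?mulr0// => k _; rewrite mxE.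
  have := nz k; case: (z k) => x y /=; rewrite -pair_eqE /pair_eq/= negb_and.
  by rewrite [x == i]eq_sym [y == j]eq_sym => /orP[]/negbTE ->; rewrite ?andbF.
have E2ge i j : 0 <= E2 i j.
  by rewrite /E2 summxE sumr_ge0// => k _; rewrite mxE ler0n.
pose P' := P + d *: (E2 - E1).
have P'plan : P' \in transport_plan a b.
  apply/mem_set; split => [i j|i|j].
  - rewrite mx_shiftE mulrBr; have := E1le i j.
    have := mulr_ge0 (ltW d0) (E2ge i j); lra.
  - under eq_bigr do rewrite mx_shiftE.
    rewrite big_split/= Pa -mulr_sumr sumrB [X in X - _](_ : _ = \sum_k (i == (z k).1)%:R).
      rewrite [X in _ - X](_ : _ = \sum_k (i == (z k).1)%:R) ?subrr ?mulr0 ?addr0//.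
      rewrite /E1; under eq_bigr do rewrite summxE.
      by rewrite exchange_big/=; apply: eq_bigr => k _; rewrite sum_row_delta.
    rewrite /E2; under eq_bigr do rewrite summxE.
    by rewrite exchange_big/=; apply: eq_bigr => k _; rewrite sum_row_delta.
  - under eq_bigr do rewrite mx_shiftE.
    rewrite big_split/= Pb -mulr_sumr sumrB [X in X - _](_ : _ = \sum_k (j == (z k).2)%:R).
      rewrite [X in _ - X](_ : _ = \sum_k (j == (z k).2)%:R) ?subrr ?mulr0 ?addr0//.
      rewrite /E1; under eq_bigr do rewrite summxE.
      by rewrite exchange_big/=; apply: eq_bigr => k _; rewrite sum_col_delta.
    rewrite /E2; under eq_bigr do rewrite summxE.
    (* The cyclic shift only permutes the targets, hence the column sums of [E1] and [E2] agree. *)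
    rewrite exchange_big/= [RHS](reindex_inj (@ordS_inj N.+1)).
    by apply: eq_bigr => k _; rewrite sum_col_delta.
have := Pmin _ P'plan; rewrite sum_form_add lerDl pmulr_rge0//.
rewrite -[E2 - E1]/(E2 + - E1) -scaleN1r sum_form_add mulN1r subr_ge0.
rewrite !sum_form_sum.
rewrite (eq_bigr _ (fun k _ => sum_delta c (z k).1 (z k).2)).
by rewrite (eq_bigr _ (fun k _ => sum_delta c (z k).1 (z (ordS k)).2)).
Qed.

End discrete_plan.

Section limit_plan.
Variables (R : realType) (p : nat).
Local Notation vec := 'cV[R]_p.

Lemma fine_measure_subU d (T : measurableType d) (P : probability T R) (A B C : set T) :
  measurable A -> measurable B -> measurable C -> C `<=` A `|` B ->
  fine (P C) <= fine (P A) + fine (P B).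
Proof.
move=> mA mB mC CAB; rewrite -fineD ?fin_num_measure//.
have mAB : measurable (A `|` B) by exact: measurableU.
rewrite fine_le ?fin_numD ?fin_num_measure//.
apply: le_trans (measureU2 _ mA mB).
by apply: le_measure => //; rewrite inE.
Qed.

Lemma fine_measure_le d (T : measurableType d) (P : probability T R) (A B : set T) :
  measurable A -> measurable B -> A `<=` B -> fine (P A) <= fine (P B).
Proof.
move=> mA mB AB; rewrite fine_le ?fin_num_measure//.
by apply: le_measure => //; rewrite inE.
Qed.

Lemma fine_measure_partition d (T : measurableType d) (P : probability T R) n
    (k : T -> 'I_n) (A : set T) : measurable A ->
  (forall i, measurable (k @^-1` [set i])) ->
  fine (P A) = \sum_i fine (P (A `&` k @^-1` [set i])).
Proof.
move=> mA mk.
have mAk i : measurable (A `&` k @^-1` [set i]) by exact: measurableI.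
apply: EFin_inj; rewrite -sumEFin fineK ?fin_num_measure//.
under eq_bigr do rewrite fineK ?fin_num_measure//.
rewrite -measure_bigsetU_ord//; last first.
  apply/trivIsetP => i j _ _ ij; rewrite -subset0 => x [[_ /= ->] [_ /= e]].
  by move/eqP: ij; apply.
congr (P _); apply/seteqP; split => [x Ax|x].
  by rewrite -bigcup_seq; exists (k x) => //=; rewrite mem_index_enum.
by rewrite -bigcup_seq => -[i _ []].
Qed.

(* [M A B] plays the role of [pi (A x B)], but is only required to be subadditive in
   each argument: this survives limits along an ultrafilter, and no extension to a
   measure on the product is ever needed. *)
Record approximate_plan (mu nu : probability vec R) (c : vec -> vec -> R)
    (n : nat) (M : set vec -> set vec -> R) : Prop := ApproximatePlan {
  plan_ge0 : forall A B, measurable A -> measurable B -> 0 <= M A B ;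
  plan_left : forall A, measurable A -> M A setT = fine (mu A) ;
  plan_right : forall B, measurable B -> M setT B = fine (nu B) ;
  plan_subl : forall A A1 A2 B, measurable A -> measurable A1 -> measurable A2 ->
    measurable B -> A `<=` A1 `|` A2 -> M A B <= M A1 B + M A2 B ;
  plan_subr : forall A B B1 B2, measurable B -> measurable B1 -> measurable B2 ->
    measurable A -> B `<=` B1 `|` B2 -> M A B <= M A B1 + M A B2 ;
  plan_cyclic : forall N (s : 'I_N.+1 -> nat * nat),
    (forall k, (s k).1 < n)%N -> (forall k, (s k).2 < n)%N ->
    (forall k, 0 < M (@rat_ball R p 1 (s k).1) (@rat_ball R p 1 (s k).2)) ->
    exists z : 'I_N.+1 -> vec * vec,
      (forall k, rat_ball (s k).1 (z k).1 /\ rat_ball (s k).2 (z k).2) /\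
      \sum_k c (z k).1 (z k).2 <= \sum_k c (z k).1 (z (ordS k)).2 }.

Section approximate_plan_theory.
Variables (mu nu : probability vec R) (c : vec -> vec -> R) (n : nat).
Variable (M : set vec -> set vec -> R) (hM : approximate_plan mu nu c n M).

(** Monotonicity is derived from this bound, so it cannot serve here: [B] is covered by [setT]
    twice, and [M set0 setT] is the [mu]-mass of the empty set. *)
Lemma plan_set0l B : measurable B -> M set0 B <= 0.
Proof.
move=> mB; have := plan_subr hM mB measurableT measurableT measurable0.
rewrite (plan_left hM)// measure0/= addr0; apply.
by rewrite setUT.
Qed.

Lemma plan_set0r A : measurable A -> M A set0 <= 0.
Proof.
move=> mA; have := plan_subl hM mA measurableT measurableT measurable0.
rewrite (plan_right hM)// measure0/= addr0; apply.
by rewrite setUT.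
Qed.

Lemma plan_monol A A' B : measurable A -> measurable A' -> measurable B ->
  A `<=` A' -> M A B <= M A' B.
Proof.
move=> mA mA' mB AA'; have := plan_subl hM mA mA' measurable0 mB.
rewrite setU0 => /(_ AA') h; have := plan_set0l mB; lra.
Qed.

Lemma plan_monor A B B' : measurable A -> measurable B -> measurable B' ->
  B `<=` B' -> M A B <= M A B'.
Proof.
move=> mA mB mB' BB'; have := plan_subr hM mB mB' measurable0 mA.
rewrite setU0 => /(_ BB') h; have := plan_set0r mA; lra.
Qed.

End approximate_plan_theory.

(* The cells are the atoms of the algebra generated by the first [n] rational balls; an
   optimal discrete plan between the cells is spread over each product of cells
   proportionally to the product of the conditioned measures. *)
Lemma exists_approximate_plan (mu nu : probability vec R) c n :
  exists M, approximate_plan mu nu c n M.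
Proof.
pose J := {ffun 'I_n -> bool}.
pose k (x : vec) : 'I_#|J| := enum_rank [ffun j : 'I_n => `[< rat_ball j x >]].
have kE i j x y : (j < n)%N -> k x = i -> k y = i -> rat_ball j x -> rat_ball j y.
  move=> jn <- /enum_rank_inj/ffunP/(_ (Ordinal jn)); rewrite !ffunE/= => e jx.
  by apply/asboolP; rewrite e; exact/asboolP.
have mk i : measurable (k @^-1` [set i]).
  rewrite (_ : _ @^-1` _ = \bigcap_(j in [set: 'I_n])
     (if enum_val i j then @rat_ball R p 1 j else ~` @rat_ball R p 1 j)); last first.
    apply/seteqP; split => [x <- j _|x ix].
      rewrite enum_rankK ffunE; case: asboolP => //.
    rewrite /preimage/= -[RHS]enum_valK; congr enum_rank; apply/ffunP => j.
    rewrite ffunE; have := ix j I; case: (enum_val i j) => jx; last exact/asboolPn.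
    exact/asboolP.
  apply: fin_bigcap_measurable => // j _; case: (enum_val i j).
    exact: measurable_rat_ball.
  by apply: measurableC; exact: measurable_rat_ball.
pose a i := fine (mu (k @^-1` [set i])).
pose b i := fine (nu (k @^-1` [set i])).
have a0 i : 0 <= a i by exact: fine_ge0.
have b0 i : 0 <= b i by exact: fine_ge0.
have pa A i : measurable A -> a i = 0 -> fine (mu (A `&` k @^-1` [set i])) = 0.
  move=> mA ai; apply/eqP; rewrite eq_le fine_ge0// andbT -ai.
  by apply: fine_measure_le => //; exact: measurableI.
have pb A i : measurable A -> b i = 0 -> fine (nu (A `&` k @^-1` [set i])) = 0.
  move=> mA ai; apply/eqP; rewrite eq_le fine_ge0// andbT -ai.
  by apply: fine_measure_le => //; exact: measurableI.
have a1 : \sum_i a i = 1.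
  rewrite -[RHS]/(fine 1%E) -(probability_setT mu) (fine_measure_partition mu measurableT mk).
  by apply: eq_bigr => i _; rewrite setTI.
have b1 : \sum_i b i = 1.
  rewrite -[RHS]/(fine 1%E) -(probability_setT nu) (fine_measure_partition nu measurableT mk).
  by apply: eq_bigr => i _; rewrite setTI.
(* A representative of each cell. For an empty cell it is an arbitrary point, but such a cell has no
   mass and never occurs in a cycle. *)
pose r i : vec := get (k @^-1` [set i]).
have rk i x : k x = i -> k (r i) = i by move=> kx; apply: (@getI _ (k @^-1` [set i]) x).
have [P [P0 Pa Pb] Pc] := exists_cyclic_plan (fun i j => c (r i) (r j)) a0 b0 a1 b1.
have Pa0 i j : a i = 0 -> P i j = 0.
  move=> ai; have := Pa i; rewrite ai => /psumr_eq0P; apply => //.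
have Pb0 i j : b j = 0 -> P i j = 0.
  move=> bj; have := Pb j; rewrite bj => /(psumr_eq0P (F := P^~ j)); apply => //.
(* A null cell makes the denominator 0 and the quotient 0; nothing is lost, since [P] vanishes on
   its row or column. *)
pose M A B := \sum_i \sum_j P i j / (a i * b j) *
   (fine (mu (A `&` k @^-1` [set i])) * fine (nu (B `&` k @^-1` [set j]))).
have W0 i j : 0 <= P i j / (a i * b j) by rewrite divr_ge0// mulr_ge0.
exists M; split.
- move=> A B mA mB; apply: sumr_ge0 => i _; apply: sumr_ge0 => j _.
  by rewrite mulr_ge0// mulr_ge0// fine_ge0.
- move=> A mA; rewrite (fine_measure_partition mu mA mk); apply: eq_bigr => i _.
  have [ai|ai] := eqVneq (a i) 0.
    by rewrite pa//; apply: big1 => j _; rewrite mul0r mulr0.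
  transitivity (fine (mu (A `&` k @^-1` [set i])) / a i * \sum_j P i j); last first.
    by rewrite Pa divfK.
  rewrite mulr_sumr; apply: eq_bigr => j _; rewrite setTI -/(b j).
  have [bj|bj] := eqVneq (b j) 0; first by rewrite Pb0// !mul0r mulr0.
  by field; rewrite ?ai ?bj.
- move=> B mB; rewrite (fine_measure_partition nu mB mk) /M exchange_big/=.
  apply: eq_bigr => j _; have [bj|bj] := eqVneq (b j) 0.
    by rewrite pb//; apply: big1 => i _; rewrite !mulr0.
  transitivity (fine (nu (B `&` k @^-1` [set j])) / b j * \sum_i P i j); last first.
    by rewrite Pb divfK.
  rewrite mulr_sumr; apply: eq_bigr => i _; rewrite setTI -/(a i).
  have [ai|ai] := eqVneq (a i) 0; first by rewrite Pa0// !mul0r mulr0.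
  by field; rewrite ?ai ?bj.
- move=> A A1 A2 B mA mA1 mA2 mB AA; rewrite /M -big_split/=.
  apply: ler_sum => i _; rewrite -big_split/=; apply: ler_sum => j _.
  rewrite -mulrDr ler_wpM2l// -mulrDl ler_wpM2r ?fine_ge0//.
  apply: fine_measure_subU; do ?exact: measurableI.
  by move=> x [/AA[]? ?]; [left|right].
- move=> A B B1 B2 mB mB1 mB2 mA BB; rewrite /M -big_split/=.
  apply: ler_sum => i _; rewrite -big_split/=; apply: ler_sum => j _.
  rewrite -mulrDr ler_wpM2l// -mulrDr ler_wpM2l ?fine_ge0//.
  apply: fine_measure_subU; do ?exact: measurableI.
  by move=> x [/BB[]? ?]; [left|right].
- move=> N s s1 s2 Ms.
  (* A positive mass has a nonzero term. Its two cells meet the two balls, hence are contained in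
     them together with their representatives, because these balls are among those that generate the
     cells. *)
  have ex t : exists ij : 'I_#|J| * 'I_#|J|, [/\ 0 < P ij.1 ij.2,
      rat_ball (s t).1 (r ij.1) & rat_ball (s t).2 (r ij.2)].
    have := Ms t; rewrite /M pair_big/= => /lt0r_neq0/eqP h.
    have [ij ijn0] : exists ij : 'I_#|J| * 'I_#|J|, P ij.1 ij.2 / (a ij.1 * b ij.2) *
        (fine (mu (@rat_ball R p 1 (s t).1 `&` k @^-1` [set ij.1])) *
         fine (nu (@rat_ball R p 1 (s t).2 `&` k @^-1` [set ij.2]))) != 0.
      apply: contra_notP h => h; apply: big1 => ij _; apply/eqP.
      by apply: contra_notT h => ?; exists ij.
    move: ijn0; rewrite !mulf_eq0 !negb_or => /andP[/andP[Pij _] /andP[m1 m2]].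
    exists ij; split; first by rewrite lt0r Pij P0.
      have [x [x1 x2]] : @rat_ball R p 1 (s t).1 `&` k @^-1` [set ij.1] !=set0.
        by apply/set0P; apply: contraNneq m1 => ->; rewrite measure0.
      by apply: (kE _ _ _ _ (s1 t) x2 _ x1); exact: (rk _ x).
    have [x [x1 x2]] : @rat_ball R p 1 (s t).2 `&` k @^-1` [set ij.2] !=set0.
      by apply/set0P; apply: contraNneq m2 => ->; rewrite measure0.
    by apply: (kE _ _ _ _ (s2 t) x2 _ x1); exact: (rk _ x).
  have [ij hij] := choice ex.
  exists (fun t => (r (ij t).1, r (ij t).2)); split => [t|].
    by have [] := hij t.
  by apply: Pc => t; have [] := hij t.
Qed.

(** Compactness of the segment provides a cluster point, and an ultrafilter converges to its cluster
    points. *)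
Lemma ultra_bounded_cvg (F : set_system nat) (f : nat -> R) (a b : R) :
  UltraFilter F -> (forall n, a <= f n <= b) -> exists l : R, f n @[n --> F] --> l.
Proof.
move=> UF fab; have PF := @ultra_proper _ _ UF.
have [|l [lab clu]] := @segment_compact R a b (f @ F) _.
  apply: (@filterS _ F _ setT) => [n _|]; last exact: filterT.
  by rewrite /preimage/= in_itv/=; exact: fab.
exists l; apply/cvgrPdist_lt => e e0.
have [//|nF] := in_ultra_setVsetC [set n | `|l - f n| < e] UF.
have [x [/= x1 x2]] := clu [set x | ~ `|l - x| < e] (ball l e) nF (nbhsx_ballx l e e0).
by case: x1; move: x2; rewrite -ball_normE.
Qed.

(** One [M] that meets the conditions at every stage: in the limit no bound on the indices of the
    balls remains. *)
Definition limit_plan (mu nu : probability vec R) c M :=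
  forall n, approximate_plan mu nu c n M.

Lemma exists_limit_plan (mu nu : probability vec R) c :
  exists M, limit_plan mu nu c M.
Proof.
have [Mn hM] := choice (exists_approximate_plan mu nu c).
have [F [UF Foo]] := ultraFilterLemma eventually_filter.
have PF := @ultra_proper _ _ UF.
pose M A B := lim (Mn n A B @[n --> F]).
have mono n A B : measurable A -> measurable B -> Mn n A B <= 1.
  move=> mA mB; apply: le_trans (plan_monol (hM n) mA measurableT mB (@subsetT _ _)) _.
  by rewrite (plan_right (hM n))// -lee_fin fineK ?fin_num_measure// probability_le1.
have cM A B : measurable A -> measurable B -> cvg (Mn n A B @[n --> F]).
  move=> mA mB; apply/cvg_ex; apply: (@ultra_bounded_cvg _ _ 0 1) => // n.
  by rewrite (plan_ge0 (hM n))//= mono.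
exists M => n; split.
- by move=> A B mA mB; apply: limr_ge; [exact: cM|apply: nearW => k; exact: plan_ge0 (hM k) _ _ mA mB].
- move=> A mA; apply: cvg_lim => //.
  by under eq_fun do rewrite (plan_left (hM _) mA); exact: cvg_cst.
- move=> A mA; apply: cvg_lim => //.
  by under eq_fun do rewrite (plan_right (hM _) mA); exact: cvg_cst.
- move=> A A1 A2 B mA mA1 mA2 mB AA; rewrite /M -limD; [|exact: cM|exact: cM].
  apply: ler_lim; [exact: cM|by apply: is_cvgD; exact: cM|].
  by apply: nearW => k; exact: plan_subl (hM k) _ _ _ _ mA mA1 mA2 mB AA.
- move=> A B B1 B2 mB mB1 mB2 mA BB; rewrite /M -limD; [|exact: cM|exact: cM].
  apply: ler_lim; [exact: cM|by apply: is_cvgD; exact: cM|].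
  by apply: nearW => k; exact: plan_subr (hM k) _ _ _ _ mB mB1 mB2 mA BB.
- move=> N s _ _ Ms.
  (* Positivity of the limit on finitely many rectangles already holds at [F]-almost all stages;
     among them a stage beyond all the indices can be chosen. *)
  have : F [set k | forall t, 0 < Mn k (@rat_ball R p 1 (s t).1) (@rat_ball R p 1 (s t).2)].
    apply: filter_forall => t; apply: (cvgr_gt (M (rat_ball (s t).1) (rat_ball (s t).2))); last exact: Ms.
    by apply: cM; exact: measurable_rat_ball.
  have : F [set k | forall t, (s t).1 < k /\ (s t).2 < k]%N.
    apply: filter_forall => t; apply: Foo.
    exists (maxn (s t).1 (s t).2).+1 => // k /=; rewrite gtn_max => /andP[]//.
  move=> F1 F2; have [k [k1 k2]] := filter_ex (filterI F1 F2).
  by apply: (plan_cyclic (hM k)) => t; [have [] := k1 t|have [] := k1 t|exact: k2].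
Qed.

End limit_plan.

(** * The support of a limit plan *)

Section plan_support.
Variables (R : realType) (p : nat).
Local Notation vec := 'cV[R]_p.

Definition cyclically_monotone (c : vec -> vec -> R) (Gam : set (vec * vec)) :=
  forall N (z : 'I_N.+1 -> vec * vec), (forall i, Gam (z i)) ->
    \sum_(i < N.+1) c (z i).1 (z i).2 <= \sum_(i < N.+1) c (z i).1 (z (ordS i)).2.

Lemma cball_compact (r : R) : compact [set x : vec | `|x - 0| <= r].
Proof.
apply: (@bounded_closed_compact_mx _ _ _ _ r) => [x /=|]; first by rewrite subr0.
exact: closed_norm_le.
Qed.

Lemma cball_cover (x : vec) : exists n : nat, `|x - 0| <= n%:R.
Proof. by exists (Num.trunc `|x|).+1; rewrite subr0 ltW// truncnS_gt. Qed.

(** A projection of a Borel set need not be Borel. For a closed set, cutting with balls makes the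
    pieces compact, and the projection becomes a countable union of compact sets. *)
Lemma closed_projection_borel (E : set (vec * vec)) (C : set vec) :
  closed E -> closed C -> measurable [set x | exists2 y, C y & E (x, y)].
Proof.
move=> cE cC; pose K n := [set x : vec | `|x - 0| <= n%:R].
rewrite (_ : [set x | _] = \bigcup_n (fst @` (E `&` (K n `*` (C `&` K n))))); last first.
  apply/seteqP; split => [x [y Cy Exy]|x [n _ [[a b] [Eab [_ [/= Cb _]]] /= <-]]]; last by exists b.
  have [n xn] := cball_cover x; have [m ym] := cball_cover y.
  exists (maxn n m) => //; exists (x, y) => //; split => //; split => /=.
    by rewrite /K/= (le_trans xn)// ler_nat leq_maxl.
  by split => //; rewrite /K/= (le_trans ym)// ler_nat leq_maxr.
apply: bigcup_measurable => n _; apply: compact_borel; apply: continuous_compact.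
  by apply: continuous_subspaceT => z; exact: cvg_fst.
rewrite setIC; apply: compact_closedI => //; apply: compact_setX; first exact: cball_compact.
by rewrite setIC; apply: compact_closedI => //; exact: cball_compact.
Qed.

Definition plan_support (M : set vec -> set vec -> R) : set (vec * vec) :=
  [set z | forall i j, rat_ball i z.1 -> rat_ball j z.2 ->
    0 < M (@rat_ball R p 1 i) (@rat_ball R p 1 j)].

Lemma plan_support_closed M : closed (plan_support M).
Proof.
rewrite -[X in closed X]setCK; apply: open_closedC; rewrite openE => -[x y] /=.
move=> /existsNP[i /existsNP[j /not_implyP[xi /not_implyP[yj Mij]]]].
exists (@rat_ball R p 1 i, @rat_ball R p 1 j) => /=.
  by split; apply: open_nbhs_nbhs; split => //; exact: rat_ball_open.
by move=> [a b] /= [ai bj] Eab; apply: Mij; exact: Eab.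
Qed.

Lemma continuous2_dist (c : vec -> vec -> R) :
  continuous (fun z : vec * vec => c z.1 z.2) ->
  forall x y e, 0 < e -> exists2 r : R, 0 < r &
    forall x' y', `|x' - x| < r -> `|y' - y| < r -> `|c x' y' - c x y| < e.
Proof.
move=> cc x y e e0; have /cvgrPdist_lt/(_ _ e0) := cc (x, y).
move=> [[A B] /= [/nbhs_ballP[r1 /= r10 r1A] /nbhs_ballP[r2 /= r20 r2B]] ABc].
exists (minr r1 r2) => [|x' y']; first by rewrite lt_min r10.
rewrite !lt_min => /andP[x1 _] /andP[_ y2]; rewrite distrC; apply: (ABc (x', y')).
by split; [apply: r1A|apply: r2B]; rewrite -ball_normE /ball_/= distrC.
Qed.

Lemma plan_support_cyclic mu nu c M : limit_plan mu nu c M ->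
  continuous (fun z : vec * vec => c z.1 z.2) ->
  cyclically_monotone c (plan_support M).
Proof.
move=> hM cc N z Ez; apply/ler_addgt0Pr => e e0.
(* Each of the [N.+1] terms on each of the two sides may be off by [e'], which costs [e] in all. *)
pose e' := e / 2 / N.+1%:R.
have e'0 : 0 < e' by rewrite !divr_gt0.
have h k : exists r : R, 0 < r /\ forall x y y', `|x - (z k).1| < r ->
    `|y - (z k).2| < r -> `|y' - (z (ordS k)).2| < r ->
    c (z k).1 (z k).2 <= c x y + e' /\
    c x y' <= c (z k).1 (z (ordS k)).2 + e'.
  have [r1 r10 h1] := continuous2_dist cc (z k).1 (z k).2 e'0.
  have [r2 r20 h2] := continuous2_dist cc (z k).1 (z (ordS k)).2 e'0.
  exists (minr r1 r2); split => [|x y y']; first by rewrite lt_min r10.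
  rewrite !lt_min => /andP[x1 x2] /andP[y1 _] /andP[_ y2].
  have := h1 _ _ x1 y1; have := h2 _ _ x2 y2.
  by rewrite !ltr_distl => /andP[? ?] /andP[? ?]; split; lra.
have {h}[r hr] := choice h.
(* A common radius is chosen because each target occurs in two terms of the cycle, with its own
   source and with the preceding one. *)
pose r0 := \big[minr/1]_k r k.
have r00 : 0 < r0 by apply/bigmin_gtP; split => // k _; have [] := hr k.
have rr k : r0 <= r k by apply: bigmin_le_cond.
have hs k : exists s : nat * nat, [/\ rat_ball s.1 (z k).1, rat_ball s.2 (z k).2,
    (forall x, rat_ball s.1 x -> `|x - (z k).1| < r0) &
    (forall x, rat_ball s.2 x -> `|x - (z k).2| < r0)].
  have zz (v : vec) : `|v - v| < r0 by rewrite subrr normr0.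
  have [i iz ir] := rat_ball_base (@open_norm_lt R p 1 (z k).1 r0) (zz _).
  have [j jz jr] := rat_ball_base (@open_norm_lt R p 1 (z k).2 r0) (zz _).
  by exists (i, j); split.
have [s hs'] := choice hs.
pose n := (\max_k maxn (s k).1 (s k).2).+1.
have sn k : (maxn (s k).1 (s k).2 < n)%N.
  by rewrite ltnS; exact: (leq_bigmax (F := fun k => maxn (s k).1 (s k).2)).
have [|||z' [z's z'c]] := plan_cyclic (hM n) (s := s).
- by move=> k; exact: leq_ltn_trans (leq_maxl _ _) (sn k).
- by move=> k; exact: leq_ltn_trans (leq_maxr _ _) (sn k).
- by move=> k; have [? ? _ _] := hs' k; exact: (Ez k).
have hz k : c (z k).1 (z k).2 <= c (z' k).1 (z' k).2 + e' /\
    c (z' k).1 (z' (ordS k)).2 <= c (z k).1 (z (ordS k)).2 + e'.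
  have [_ hk] := hr k; have [_ _ h1 h2] := hs' k; have [_ _ _ h3] := hs' (ordS k).
  apply: hk; apply: lt_le_trans (rr k).
  - by apply: h1; have [] := z's k.
  - by apply: h2; have [] := z's k.
  - by apply: h3; have [] := z's (ordS k).
have e'sum : \sum_(k < N.+1) e' = e / 2.
  by rewrite sumr_const card_ord -[e' *+ _]mulr_natr /e' divfK// pnatr_eq0.
have l1 : \sum_k c (z k).1 (z k).2 <= \sum_k c (z' k).1 (z' k).2 + e / 2.
  by rewrite -e'sum -big_split/=; apply: ler_sum => k _; have [] := hz k.
have l2 : \sum_k c (z' k).1 (z' (ordS k)).2 <= \sum_k c (z k).1 (z (ordS k)).2 + e / 2.
  by rewrite -e'sum -big_split/=; apply: ler_sum => k _; have [] := hz k.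
by lra.
Qed.

Section limit_plan_null.
Variables (mu nu : probability vec R) (c : vec -> vec -> R).
Variables (M : set vec -> set vec -> R) (hM : limit_plan mu nu c M).

Lemma plan_cover_le0r (A B : set vec) (I : choiceType) (s : seq I) (F : I -> set vec) :
  measurable A -> measurable B -> (forall i, measurable (F i)) ->
  B `<=` \bigcup_(i in [set` s]) F i -> (forall i, i \in s -> M A (F i) <= 0) ->
  M A B <= 0.
Proof.
move=> mA + mF; elim: s B => [|i s IH] B mB Bs Ms.
  rewrite (_ : B = set0) ?(plan_set0r (hM 0))// -subset0.
  by apply: subset_trans Bs _ => x [].
apply: (le_trans (plan_subr (hM 0) mB (mF i) (measurableD mB (mF i)) mA _)).
  by move=> x Bx; have [Fx|nFx] := pselect (F i x); [left|right].
have := Ms i (mem_head _ _); suff : M A (B `\` F i) <= 0 by lra.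
apply: IH; first exact: measurableD.
  move=> x [/Bs[j /=]]; rewrite inE => /orP[/eqP->//|js Fj _].
  by exists j.
by move=> j js; apply: Ms; rewrite inE js orbT.
Qed.

Lemma plan_cover_le0l (A B : set vec) (I : choiceType) (s : seq I) (F : I -> set vec) :
  measurable B -> measurable A -> (forall i, measurable (F i)) ->
  A `<=` \bigcup_(i in [set` s]) F i -> (forall i, i \in s -> M (F i) B <= 0) ->
  M A B <= 0.
Proof.
move=> mB + mF; elim: s A => [|i s IH] A mA As Ms.
  rewrite (_ : A = set0) ?(plan_set0l (hM 0))// -subset0.
  by apply: subset_trans As _ => x [].
apply: (le_trans (plan_subl (hM 0) mA (mF i) (measurableD mA (mF i)) mB _)).
  by move=> x Ax; have [Fx|nFx] := pselect (F i x); [left|right].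
have := Ms i (mem_head _ _); suff : M (A `\` F i) B <= 0 by lra.
apply: IH; first exact: measurableD.
  move=> x [/As[j /=]]; rewrite inE => /orP[/eqP->//|js Fj _].
  by exists j.
by move=> j js; apply: Ms; rewrite inE js orbT.
Qed.

(** Finite subadditivity allows only finite covers, hence compactness is used twice: the rectangles
    that cover [L] over a fixed [x] share a neighbourhood of [x], and finitely many such
    neighbourhoods cover [K]. *)
Lemma plan_compact_le0 (K L : set vec) : compact K -> compact L ->
  (forall x y, K x -> L y -> ~ plan_support M (x, y)) -> M K L <= 0.
Proof.
move=> cK cL KL.
have mK := compact_borel cK; have mL := compact_borel cL.
have hx x : K x -> exists i, rat_ball i x /\ M (@rat_ball R p 1 i) L <= 0.
  move=> Kx.
  pose D := [set ij : nat * nat | rat_ball ij.1 x /\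
    M (@rat_ball R p 1 ij.1) (@rat_ball R p 1 ij.2) <= 0].
  move: (cL); rewrite compact_cover => /(_ _ D (fun ij => @rat_ball R p 1 ij.2)) [].
  - by move=> ij _; exact: rat_ball_open.
  - move=> y Ly; have /existsNP[i /existsNP[j /not_implyP[xi /not_implyP[yj Mij]]]] := KL _ _ Kx Ly.
    by exists (i, j) => //; split => //; rewrite leNgt; exact/negP.
  move=> D' D'D LD'.
  have [i ix iU] : exists2 i, rat_ball i x &
      @rat_ball R p 1 i `<=` \bigcap_(ij in [set` D']) @rat_ball R p 1 ij.1.
    apply: rat_ball_base; last by move=> ij /D'D /set_mem[].
    rewrite openE => y Dy; apply: filter_bigI => ij ijD; apply: open_nbhs_nbhs.
    by split; [exact: rat_ball_open|exact: Dy].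
  exists i; split => //.
  apply: (@plan_cover_le0r _ _ _ (enum_fset D') (fun ij => @rat_ball R p 1 ij.2)) => //.
  - exact: measurable_rat_ball.
  - by move=> ij; exact: measurable_rat_ball.
  - move=> ij ijD; have /D'D /set_mem[/= _ h] := ijD.
    apply: le_trans h; apply: (plan_monol (hM 0)); do ?exact: measurable_rat_ball.
    by move=> y /iU; exact.
move: (cK); rewrite compact_cover => /(_ _ [set i | M (@rat_ball R p 1 i) L <= 0] (@rat_ball R p 1)) [].
- by move=> i _; exact: rat_ball_open.
- by move=> x /hx[i [xi Mi]]; exists i.
move=> D' D'D KD'.
apply: (@plan_cover_le0l _ _ _ (enum_fset D') (@rat_ball R p 1)) => //.
- by move=> i; exact: measurable_rat_ball.
- by move=> i /D'D /set_mem.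
Qed.

(** This stands in for concentration of the plan on its support. A compact set off the projection
    [X] receives no mass together with [C], and by inner regularity the remainder of the complement
    of [X] has small [mu]-mass. *)
Lemma plan_projection (C : set vec) : compact C ->
  (nu C <= mu [set x | exists2 y, C y & plan_support M (x, y)])%E.
Proof.
move=> cC; pose X := [set x | exists2 y, C y & plan_support M (x, y)].
have mC := compact_borel cC.
have mX : measurable X.
  apply: closed_projection_borel; first exact: plan_support_closed.
  exact: compact_closed (@mx_hausdorff _ _ _) cC.
have mCX := measurableC mX.
rewrite -/X -[leLHS]fineK ?fin_num_measure// -[leRHS]fineK ?fin_num_measure// lee_fin.
rewrite -(plan_right (hM 0))//.
apply/ler_addgt0Pr => e e0.
apply: (le_trans (plan_subl (hM 0) measurableT mX mCX mC _)); first by rewrite setUv.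
have hX : M X C <= fine (mu X).
  by rewrite -(plan_left (hM 0))//; apply: (plan_monor (hM 0)).
suff : M (~` X) C <= e by lra.
have [K [cK KX muK]] := inner_regular mu mCX e0.
have mK := compact_borel cK; have mD : measurable (~` X `\` K) by exact: measurableD.
apply: (le_trans (plan_subl (hM 0) mCX mK mD mC _)).
  by move=> x Xx; have [Kx|nKx] := pselect (K x); [left|right].
have h1 : M K C <= 0.
  by apply: plan_compact_le0 => // x y /KX Xx Cy Exy; apply: Xx; exists y.
have h2 : M (~` X `\` K) C <= fine (mu (~` X `\` K)).
  by rewrite -(plan_left (hM 0))//; apply: (plan_monor (hM 0)).
have : fine (mu (~` X `\` K)) < e by rewrite -lte_fin fineK ?fin_num_measure.
by lra.
Qed.

End limit_plan_null.

End plan_support.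

(** * Conjugates and Rockafellar potentials *)

Section potentials.
Variables (R : realType) (p : nat).
Local Notation vec := 'cV[R]_p.
Implicit Types (s : vec -> vec -> R) (f : vec -> \bar R).

(** The generalized Legendre transform for the kernel [s], applied with [gdot G] for the transport
    potentials and with [dot] for gradients. *)
Definition conjugate s f (h : vec) : \bar R :=
  ereal_sup [set ((s x h)%:E - f x)%E | x in [set: vec]].

(** Since [+oo + -oo] is [-oo] in the extended reals, the value [-oo] has to be excluded. *)
Lemma fenchel s f x h : f x != -oo%E -> conjugate s f h != -oo%E ->
  ((s x h)%:E <= f x + conjugate s f h)%E.
Proof.
have : ((s x h)%:E - f x <= conjugate s f h)%E by apply: ereal_sup_ubound; exists x.
case: (f x) => [r| |]//; case: (conjugate s f h) => [c| |]//.
- by rewrite -EFinB -EFinD !lee_fin; lra.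
- by move=> _ _ _; rewrite addey// leey.
- by move=> _ _ _; rewrite addye// leey.
- by move=> _ _ _; rewrite addye// leey.
Qed.

Lemma conjugate_neqNoo s f x h : f x \is a fin_num -> conjugate s f h != -oo%E.
Proof.
move=> fx; have : ((s x h)%:E - f x <= conjugate s f h)%E.
  by apply: ereal_sup_ubound; exists x.
by move: fx; case: (f x) => [r| |]// _; case: (conjugate s f h).
Qed.

Lemma conjugate_lsc s f : (forall x, continuous (s x)) ->
  lower_semicontinuous (conjugate s f).
Proof.
move=> cs; apply/lower_semicontinuousP => a.
rewrite (_ : [set x | _] = \bigcup_x [set h | (a%:E < (s x h)%:E - f x)%E]); last first.
  apply/seteqP; split => [h /= /ereal_sup_gt[_ [x _ <-] ax]|h [x _ /= ax]].
    by exists x.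
  by apply: (lt_le_trans ax); apply: ereal_sup_ubound; exists x.
apply: bigcup_open => x _; case: (f x) => [r| |].
- rewrite (_ : [set h | _] = s x @^-1` [set y | a + r < y]).
    by apply: open_comp; [move=> y _; exact: cs|exact: open_gt].
  by apply/seteqP; split => h /=; rewrite -EFinB lte_fin ltrBrDr.
- by rewrite (_ : [set h | _] = set0) ?(open0)//; apply/seteqP; split.
- rewrite (_ : [set h | _] = setT); first exact: openT.
  by apply/seteqP; split => h //= _; rewrite addey// ltry.
Qed.

Section rockafellar.
Variables (s : vec -> vec -> R) (Gam : set (vec * vec)) (z0 : vec * vec).
Hypothesis Gz0 : Gam z0.
Hypothesis Gcm : forall N (z : 'I_N.+1 -> vec * vec), (forall i, Gam (z i)) ->
  \sum_(i < N.+1) s (z i).1 (z (ordS i)).2 <= \sum_(i < N.+1) s (z i).1 (z i).2.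

(** Rockafellar's sum. The list is read from [x] back to the base point [z0]: its head is the last
    link before [x]. *)
Fixpoint chain_value (l : seq (vec * vec)) (x : vec) : R :=
  if l is z :: l' then s x z.2 - s z.1 z.2 + chain_value l' z.1
  else s x z0.2 - s z0.1 z0.2.

Definition chains : set (seq (vec * vec)) := [set l : seq (vec * vec) | forall z, z \in l -> Gam z].

Definition rock (x : vec) : \bar R := ereal_sup [set (chain_value l x)%:E | l in chains].

Lemma rock_ge l x : chains l -> ((chain_value l x)%:E <= rock x)%E.
Proof. by move=> cl; apply: ereal_sup_ubound; exists l. Qed.

Lemma chains_nil : chains [::]. Proof. by []. Qed.

Lemma rock_neqNoo x : rock x != -oo%E.
Proof. by have := rock_ge x chains_nil; case: (rock x). Qed.

Lemma chain_valueE l x : chain_value l x =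
  \sum_(i < (size l).+1) s (nth 0 (x :: map fst l) i) (nth 0 (rcons (map snd l) z0.2) i)
  - (s z0.1 z0.2 + \sum_(w <- l) s w.1 w.2).
Proof.
elim: l x => [|z l IH] x /=.
  by rewrite big_ord_recl big_ord0 big_nil/=; ring.
rewrite IH [in RHS]big_ord_recl/= big_cons; ring.
Qed.

(** A chain that ends at its own base point is a cycle through [z0 :: l], and its value is the
    difference that cyclical monotonicity controls. *)
Lemma chain_value_z0 l : chains l -> chain_value l z0.1 <= 0.
Proof.
move=> cl; rewrite chain_valueE subr_le0.
pose z (i : 'I_(size l).+1) := nth z0 (z0 :: l) i.
have Gz i : Gam (z i).
  have : z i \in z0 :: l by apply: mem_nth; rewrite /= ltn_ord.
  by rewrite inE => /orP[/eqP->//|/cl].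
have := Gcm Gz; rewrite [leRHS]big_ord_recl/= (big_nth z0) big_mkord.
apply: le_trans; apply: ler_sum => i _.
rewrite [X in s X _](_ : _ = (z i).1); last first.
  by rewrite /z -(nth_map z0 0 fst)//= ltnS -ltnS ltn_ord.
rewrite [X in s _ X](_ : _ = (z (ordS i)).2)//.
(* The targets are listed one place ahead of the sources: inside the list [ordS] is the successor,
   and the last index wraps around to [z0]. *)
rewrite /z /=; have [il|] := ltnP i (size l).
  rewrite modn_small ?ltnS//= nth_rcons size_map il.
  by rewrite (nth_map z0).
move=> li; have -> : (i : nat) = size l by apply/eqP; rewrite eqn_leq li -ltnS ltn_ord.
by rewrite modnn/= nth_rcons size_map ltnn eqxx.
Qed.

Lemma rock_z0 : rock z0.1 = 0%E.
Proof.
apply/eqP; rewrite eq_le; apply/andP; split.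
  by apply: ub_ereal_sup => _ [l cl <-]; rewrite lee_fin chain_value_z0.
by have := rock_ge z0.1 chains_nil; rewrite /= subrr.
Qed.

(** Prolonging a chain by [(x, h)] makes [h] an [s]-subgradient at [x]. With [y := z0.1], where the
    potential is 0, this also bounds the potential at [x]. *)
Lemma rock_step x h y : Gam (x, h) ->
  (rock x + (s y h - s x h)%:E <= rock y)%E.
Proof.
move=> Gxh; rewrite -leeBrDr//; apply: ub_ereal_sup => _ [l cl <-].
rewrite leeBrDr// -EFinD addrC; apply: (@rock_ge ((x, h) :: l)) => z.
by rewrite inE => /orP[/eqP->//|/cl].
Qed.

Lemma rock_fin x h : Gam (x, h) -> rock x \is a fin_num.
Proof.
move=> Gxh; have := rock_step z0.1 Gxh; rewrite rock_z0.
by have := rock_neqNoo x; case: (rock x).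
Qed.

Lemma rock_conj x h : Gam (x, h) ->
  (rock x + conjugate s rock h = (s x h)%:E)%E.
Proof.
move=> Gxh; have fx := rock_fin Gxh; apply/eqP; rewrite eq_le; apply/andP; split.
  rewrite -leeBrDl//; apply: ub_ereal_sup => _ [y _ <-].
  have := rock_step y Gxh; have := rock_neqNoo y.
  move: fx; case: (rock x) => [r| |]// _; case: (rock y) => [t| |]// _.
    by rewrite -!EFinB -EFinD !lee_fin; lra.
  by rewrite /= leNye.
apply: fenchel; first exact: rock_neqNoo.
by apply: (@conjugate_neqNoo _ _ z0.1); rewrite rock_z0.
Qed.

Lemma rock_lsc : (forall h, continuous (s^~ h)) -> lower_semicontinuous rock.
Proof.
move=> cs; apply/lower_semicontinuousP => a.
rewrite (_ : [set x | _] = \bigcup_(l in chains) [set x | a < chain_value l x]); last first.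
  apply/seteqP; split => [x /= /ereal_sup_gt[_ [l cl <-]]|x [l cl /= ax]].
    by rewrite lte_fin => ax; exists l.
  by apply: (lt_le_trans _ (rock_ge x cl)); rewrite lte_fin.
apply: bigcup_open => -[|z l] _ /=.
- rewrite (_ : [set x | _] = s^~ z0.2 @^-1` [set y | a + s z0.1 z0.2 < y]).
    by apply: open_comp; [move=> y _; exact: cs|exact: open_gt].
  by apply/seteqP; split => h /=; rewrite ltrBrDr.
- rewrite (_ : [set x | _] = s^~ z.2 @^-1` [set y | a + s z.1 z.2 - chain_value l z.1 < y]).
    by apply: open_comp; [move=> y _; exact: cs|exact: open_gt].
  by apply/seteqP; split => h /= ?; lra.
Qed.

Lemma rock_convex : (forall h x y (t : R), 0 < t < 1 ->
    s (t *: x + (1 - t) *: y) h <= t * s x h + (1 - t) * s y h) ->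
  convex_ext rock.
Proof.
move=> cs; split; first exact: rock_neqNoo.
move=> x y t /andP[t0 t1]; apply: ub_ereal_sup => _ [l cl <-].
apply: (@le_trans _ _ (t%:E * (chain_value l x)%:E + (1 - t)%:E * (chain_value l y)%:E)%E).
  rewrite -!EFinM -EFinD lee_fin; case: l cl => [|z l] _ /=.
    by have := cs z0.2 x y t; rewrite t0 t1 => /(_ isT); lra.
  by have := cs z.2 x y t; rewrite t0 t1 => /(_ isT); lra.
by apply: leeD; apply: lee_wpmul2l; rewrite ?lee_fin ?subr_ge0 ?(ltW t0) ?(ltW t1)//; exact: rock_ge.
Qed.

Lemma rock_invariant (A : vec -> vec) : (forall x h, s (A x) h = s x h) ->
  forall x, rock (A x) = rock x.
Proof.
move=> sA x; congr ereal_sup; apply/seteqP.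
by split => _ [l cl <-]; exists l => //; case: l cl => [|z l] _ /=; rewrite sA.
Qed.

End rockafellar.
End potentials.

(** * The cost and the group *)

Section euclid.
Variables (R : realType) (p : nat).
Local Notation vec := 'cV[R]_p.
Local Notation mat := 'M[R]_p.
Implicit Types (x y h : vec) (Q : mat).

Definition dot x y : R := \sum_i x i ord0 * y i ord0.

Lemma dotE x y : dot x y = (x^T *m y) ord0 ord0.
Proof. by rewrite mxE; apply: eq_bigr => i _; rewrite mxE. Qed.

Lemma dotC x y : dot x y = dot y x.
Proof. by apply: eq_bigr => i _; rewrite mulrC. Qed.

Lemma dotDl x y h : dot (x + y) h = dot x h + dot y h.
Proof. by rewrite /dot -big_split/=; apply: eq_bigr => i _; rewrite mxE mulrDl. Qed.

Lemma dotZl (t : R) x h : dot (t *: x) h = t * dot x h.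
Proof. by rewrite /dot mulr_sumr; apply: eq_bigr => i _; rewrite mxE mulrA. Qed.

Lemma dotNl x h : dot (- x) h = - dot x h.
Proof. by rewrite -scaleN1r dotZl mulN1r. Qed.

Lemma dotBl x y h : dot (x - y) h = dot x h - dot y h.
Proof. by rewrite dotDl dotNl. Qed.

Lemma dotBr x y h : dot h (x - y) = dot h x - dot h y.
Proof. by rewrite !(dotC h) dotBl. Qed.

Lemma dotDr x y h : dot h (x + y) = dot h x + dot h y.
Proof. by rewrite !(dotC h) dotDl. Qed.

Lemma dotZr (t : R) x h : dot h (t *: x) = t * dot h x.
Proof. by rewrite !(dotC h) dotZl. Qed.

Lemma sqnorm_dot x : sqnorm x = dot x x. Proof. by []. Qed.

Lemma sqnorm_ge0 x : 0 <= sqnorm x.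
Proof. by apply: sumr_ge0 => i _; rewrite sqr_ge0. Qed.

Lemma sqnormB x y : sqnorm (x - y) = sqnorm x + sqnorm y - 2 * dot x y.
Proof. by rewrite !sqnorm_dot dotBl !dotBr (dotC y x); ring. Qed.

Lemma dot_mulmx Q x y : dot (Q *m x) y = dot x (Q^T *m y).
Proof. by rewrite !dotE trmx_mul mulmxA. Qed.

Lemma dot_delta i x : dot (delta_mx i ord0) x = x i ord0.
Proof.
rewrite /dot (bigD1 i)//= mxE !eqxx mul1r big1 ?addr0// => j ji.
by rewrite mxE (negbTE ji) mul0r.
Qed.

Lemma dot_norm_le x y : `|dot x y| <= p%:R * (`|x| * `|y|).
Proof.
apply: le_trans (ler_norm_sum _ _ _) _.
apply: (@le_trans _ _ (\sum_(i < p) `|x| * `|y|)); last by rewrite sumr_const card_ord mulr_natl.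
by apply: ler_sum => i _; rewrite normrM ler_pM// coord_le_norm.
Qed.

Lemma norm_mulmx_le Q x : `|Q *m x| <= p%:R * (`|Q| * `|x|).
Proof.
apply: norm_le_coord => [|i j]; first by rewrite !mulr_ge0.
rewrite mxE; apply: le_trans (ler_norm_sum _ _ _) _.
apply: (@le_trans _ _ (\sum_(k < p) `|Q| * `|x|)); last by rewrite sumr_const card_ord mulr_natl.
by apply: ler_sum => k _; rewrite normrM ler_pM// coord_le_norm.
Qed.

Lemma dot_continuousr x : continuous (dot x).
Proof.
apply: continuous_sum => i y.
by apply: continuousM; [exact: cst_continuous|exact: coord_continuous].
Qed.

Lemma dot_continuousl h : continuous (dot^~ h).
Proof.
apply: continuous_sum => i y.
by apply: continuousM; [exact: coord_continuous|exact: cst_continuous].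
Qed.

Lemma sqnorm_continuous : continuous (@sqnorm R p).
Proof.
apply: continuous_sum => i y; under eq_fun do rewrite expr2.
by apply: continuousM; exact: coord_continuous.
Qed.

Lemma mulmx_continuous Q : continuous (fun x : vec => Q *m x).
Proof.
move=> x; apply: (@cvg_coord _ _ _ _ (nbhs x)) => i j.
rewrite [X in _ --> X]mxE; under eq_fun do rewrite mxE.
apply: (@continuous_sum R vec _ _ (fun k (x : vec) => Q i k * x k j)) => k y.
by apply: continuousM; [exact: cst_continuous|exact: coord_continuous].
Qed.

Section group.
Variable G : set mat.
Hypothesis hG : compact_subgroup_O G.

Lemma GT Q : G Q -> G Q^T. Proof. by case: hG => _ _ _ _; exact. Qed.

Lemma GM P Q : G P -> G Q -> G (P *m Q). Proof. by case: hG => _ _ _ h _; exact: h. Qed.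

Lemma G1 : G 1%:M. Proof. by case: hG. Qed.

Lemma GtrK Q : G Q -> Q^T *m Q = 1%:M.
Proof. by case: hG => _ _ h _ _; exact: h. Qed.

Lemma sqnorm_mulmx Q x : G Q -> sqnorm (Q *m x) = sqnorm x.
Proof. by move=> GQ; rewrite !sqnorm_dot dot_mulmx mulmxA GtrK// mul1mx. Qed.

Lemma sqnorm_displacement Q x h : G Q ->
  sqnorm (Q^T *m x - h) = sqnorm x + sqnorm h - 2 * dot x (Q *m h).
Proof.
by move=> GQ; rewrite sqnormB sqnorm_mulmx ?dot_mulmx ?trmxK//; exact: GT.
Qed.

(* [gdot x h] is the maximum over [Q] in [G] of [dot x (Q *m h)]. *)
Definition gdot x h : R := (sqnorm x + sqnorm h - cost G x h) / 2.

Lemma costE x h : cost G x h = sqnorm x + sqnorm h - 2 * gdot x h.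
Proof. by rewrite /gdot; field. Qed.

Lemma cost_attained x h : exists2 Q, G Q & cost G x h = sqnorm (Q^T *m x - h).
Proof.
have cf : continuous (fun Q : mat => sqnorm (Q^T *m x - h)).
  have -> : (fun Q : mat => sqnorm (Q^T *m x - h)) = (fun Q => \sum_i
      ((\sum_k Q k i * x k ord0 - h i ord0) * (\sum_k Q k i * x k ord0 - h i ord0))).
    apply/funext => Q; apply: eq_bigr => i _; rewrite -expr2 !mxE.
    by congr ((_ - _) ^+ 2); apply: eq_bigr => k _; rewrite mxE.
  have c1 i : continuous (fun Q : mat => \sum_k Q k i * x k ord0 - h i ord0).
    move=> Q; apply: continuousB; last exact: cst_continuous.
    apply: (@continuous_sum R mat _ _ (fun k (Q : mat) => Q k i * x k ord0)) => k y.
    by apply: continuousM; [exact: coord_continuous|exact: cst_continuous].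
  by apply: continuous_sum => i Q; exact: (continuousM (c1 i Q) (c1 i Q)).
case: (hG) => cG _ _ _ _.
have [] := compact_EVT_min (ex_intro _ _ G1) cG (continuous_subspaceT cf).
move=> Q /set_mem GQ Qmin; exists Q => //; apply/eqP; rewrite eq_le; apply/andP; split.
  apply: inf_lbound; last by exists Q.
  by exists 0 => _ [P _ <-]; exact: sqnorm_ge0.
apply: lb_le_inf; first by exists (sqnorm (Q^T *m x - h)), Q.
by move=> _ [P GP <-]; apply: Qmin; exact/mem_set.
Qed.

Lemma cost_le Q x h : G Q -> cost G x h <= sqnorm (Q^T *m x - h).
Proof.
move=> GQ; apply: inf_lbound; last by exists Q.
by exists 0 => _ [P _ <-]; exact: sqnorm_ge0.
Qed.

Lemma cost_ge0 x h : 0 <= cost G x h.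
Proof. by have [Q _ ->] := cost_attained x h; exact: sqnorm_ge0. Qed.

Lemma gdot_ge Q x h : G Q -> dot x (Q *m h) <= gdot x h.
Proof.
by move=> GQ; have := cost_le x h GQ; rewrite sqnorm_displacement// costE; lra.
Qed.

Lemma gdot_attained x h : exists2 Q, G Q & gdot x h = dot x (Q *m h).
Proof.
have [Q GQ] := cost_attained x h; rewrite costE sqnorm_displacement// => e.
by exists Q => //; lra.
Qed.

Lemma gdot_argmin Q x h : G Q ->
  (forall P, G P -> sqnorm (Q^T *m x - h) <= sqnorm (P^T *m x - h)) ->
  gdot x h = dot x (Q *m h).
Proof.
move=> GQ Qmin; apply/eqP; rewrite eq_le gdot_ge// andbT.
have [P GP ->] := gdot_attained x h.
by have := Qmin _ GP; rewrite !sqnorm_displacement//; lra.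
Qed.

Lemma gdot_invariant Q x h : G Q -> gdot (Q *m x) h = gdot x h.
Proof.
have le Q' x' : G Q' -> gdot (Q' *m x') h <= gdot x' h.
  move=> GQ; have [P GP ->] := gdot_attained (Q' *m x') h.
  by rewrite dot_mulmx mulmxA gdot_ge//; apply: GM => //; exact: GT.
move=> GQ; apply/eqP; rewrite eq_le le//=.
rewrite -[X in gdot X h <= _](_ : Q^T *m (Q *m x) = x); first exact/le/GT.
by rewrite mulmxA GtrK// mul1mx.
Qed.

Lemma gdot_convex h x y (t : R) : 0 < t < 1 ->
  gdot (t *: x + (1 - t) *: y) h <= t * gdot x h + (1 - t) * gdot y h.
Proof.
move=> /andP[t0 t1]; have [Q GQ ->] := gdot_attained (t *: x + (1 - t) *: y) h.
rewrite dotDl !dotZl lerD// ler_pM2l ?subr_gt0//; exact: gdot_ge.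
Qed.

Lemma G_bounded : exists2 M : R, 0 <= M & forall Q, G Q -> `|Q| <= M.
Proof.
case: (hG) => /compact_bounded[M [_ GM]] _ _ _ _.
exists (`|M| + 1) => [|Q GQ]; first by rewrite addr_ge0.
by apply: GM => //; rewrite (le_lt_trans (ler_norm _))// ltrDl.
Qed.

(** The forms [dot x (Q *m h)] obey one estimate, uniform over the bounded group, and a maximum
    inherits it: the maximiser of each pair is tested on the other. In [K], one factor [p] comes
    from the scalar product and one from the matrix product. *)
Lemma gdot_dist : exists2 K : R, 0 <= K & forall x h x' h',
  `|gdot x h - gdot x' h'| <= K * (`|x - x'| * `|h| + `|x'| * `|h - h'|).
Proof.
have [M M0 GM] := G_bounded; exists (p%:R * (p%:R * M)) => [|x h x' h'].
  by rewrite !mulr_ge0.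
have bd Q a b : G Q -> `|dot a (Q *m b)| <= p%:R * (p%:R * M) * (`|a| * `|b|).
  move=> GQ; apply: le_trans (dot_norm_le _ _) _; rewrite -[leRHS]mulrA ler_wpM2l//.
  apply: (@le_trans _ _ (`|a| * (p%:R * (`|Q| * `|b|)))).
    by rewrite ler_wpM2l// norm_mulmx_le.
  rewrite [leRHS](_ : _ = `|a| * (p%:R * (M * `|b|))); last by ring.
  by rewrite !ler_wpM2l// ler_wpM2r// GM.
set K := p%:R * (p%:R * M) in bd *.
have E Q : dot x (Q *m h) - dot x' (Q *m h') = dot (x - x') (Q *m h) + dot x' (Q *m (h - h')).
  by rewrite mulmxBr dotBr dotBl; ring.
have bd2 Q : G Q -> `|dot x (Q *m h) - dot x' (Q *m h')| <= K * (`|x - x'| * `|h| + `|x'| * `|h - h'|).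
  move=> GQ; rewrite E mulrDr; apply: le_trans (ler_normD _ _) _.
  by rewrite lerD// bd.
have [P GP eP] := gdot_attained x h; have [Q GQ eQ] := gdot_attained x' h'.
have := bd2 _ GP; have := bd2 _ GQ; rewrite !ler_norml => /andP[h1 h2] /andP[h3 h4].
have := gdot_ge x h GQ; have := gdot_ge x' h' GP.
by rewrite eP eQ => h5 h6; apply/andP; split; lra.
Qed.

Lemma gdot_continuous : continuous (fun z : vec * vec => gdot z.1 z.2).
Proof.
have [K K0 gK] := gdot_dist; move=> z0.
have gc : (fun z : vec * vec => K * (`|z.1 - z0.1| * `|z.2| + `|z0.1| * `|z.2 - z0.2|))
    @ nbhs z0 --> K * (`|z0.1 - z0.1| * `|z0.2| + `|z0.1| * `|z0.2 - z0.2|).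
  apply: cvgM; first exact: cvg_cst.
  have c1 : (fun z : vec * vec => z.1) @ nbhs z0 --> z0.1 by exact: cvg_fst.
  have c2 : (fun z : vec * vec => z.2) @ nbhs z0 --> z0.2 by exact: cvg_snd.
  apply: cvgD; apply: cvgM; do ?[exact: cvg_cst|exact: cvg_norm].
    by apply: cvg_norm; apply: cvgB => //; exact: cvg_cst.
  by apply: cvg_norm; apply: cvgB => //; exact: cvg_cst.
apply/cvgrPdist_lt => e e0; rewrite !subrr !normr0 mul0r mulr0 addr0 mulr0 in gc.
have h1 : \forall z \near z0, K * (`|z.1 - z0.1| * `|z.2| + `|z0.1| * `|z.2 - z0.2|) < e.
  exact: (cvgr_lt _ gc _ e0).
apply: filterS h1 => z; apply: le_lt_trans.
by rewrite distrC; exact: gK.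
Qed.

Lemma gdot_continuousl h : continuous (gdot^~ h).
Proof.
move=> x A nA; case: (gdot_continuous (x := (x, h)) nA) => -[U V] /= [xU hV] UVA.
apply: filterS xU => x' Ux'; apply: (UVA (x', h)); split => //; exact: nbhs_singleton hV.
Qed.

Lemma gdot_continuousr x : continuous (gdot x).
Proof.
move=> h A nA; case: (gdot_continuous (x := (x, h)) nA) => -[U V] /= [xU hV] UVA.
apply: filterS hV => h' Vh'; apply: (UVA (x, h')); split => //; exact: nbhs_singleton xU.
Qed.

Lemma cost_continuous : continuous (fun z : vec * vec => cost G z.1 z.2).
Proof.
have -> : (fun z : vec * vec => cost G z.1 z.2) =
  (fun z => sqnorm z.1 + sqnorm z.2 - 2 * gdot z.1 z.2).
  by apply/funext => z; rewrite costE.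
have c1 : continuous (fun z : vec * vec => sqnorm z.1).
  move=> z; apply: (continuous_comp (f := fst) (g := @sqnorm R p)).
    exact: cvg_fst.
  exact: sqnorm_continuous.
have c2 : continuous (fun z : vec * vec => sqnorm z.2).
  move=> z; apply: (continuous_comp (f := snd) (g := @sqnorm R p)).
    exact: cvg_snd.
  exact: sqnorm_continuous.
have c3 z : {for z, continuous (cst 2 : vec * vec -> R)} by exact: cst_continuous.
move=> z; exact: (continuousB (continuousD (c1 z) (c2 z)) (continuousM (c3 z) (gdot_continuous (x := z)))).
Qed.

(** Around a cycle the square norms of sources and of targets have the same sums on both sides and
    cancel. *)
Lemma cost_cyclicE (Gam : set (vec * vec)) : c_cyclically_monotone G Gam ->
  forall N (z : 'I_N.+1 -> vec * vec), (forall i, Gam (z i)) ->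
  \sum_(i < N.+1) gdot (z i).1 (z (ordS i)).2 <= \sum_(i < N.+1) gdot (z i).1 (z i).2.
Proof.
move=> cm N z Gz; have := cm _ _ Gz.
under eq_bigr do rewrite costE; under [leRHS]eq_bigr do rewrite costE.
rewrite !sumrB !big_split/= -!mulr_sumr.
have -> : \sum_(i < N.+1) sqnorm (z (ordS i)).2 = \sum_(i < N.+1) sqnorm (z i).2.
  by rewrite [RHS](reindex_inj (@ordS_inj N.+1)).
by lra.
Qed.

End group.
End euclid.

(** * Lebesgue measure and disjoint translates *)

Section push_measure.
Context d d' (T1 : measurableType d) (T2 : measurableType d') (R : realType).
Variables (m : {measure set T1 -> \bar R}) (f : T1 -> T2).
Hypothesis mf : measurable_fun setT f.

(** The same set function as the bare [pushforward] of the theorem, carrying its measure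
    structure. *)
Definition push_measure : {measure set T2 -> \bar R} :=
  measure_function_pushforward__canonical__measure_function_Measure m mf.

Lemma push_measureE A : push_measure A = m (f @^-1` A). Proof. by []. Qed.

End push_measure.

Lemma measureS d (T : measurableType d) (R : realType)
    (m : {measure set T -> \bar R}) (A B : set T) :
  measurable A -> measurable B -> A `<=` B -> (m A <= m B)%E.
Proof. by move=> mA mB AB; apply: le_measure => //; exact/mem_set. Qed.

Lemma measure_bigcup_eq0 d (T : measurableType d) (R : realType)
    (m : {measure set T -> \bar R}) (F : nat -> set T) :
  (forall n, measurable (F n)) -> (forall n, m (F n) = 0%E) ->
  m (\bigcup_n F n) = 0%E.
Proof.
move=> mF F0; apply/eqP; rewrite eq_le measure_ge0 andbT.
have := @measure_sigma_subadditive _ _ _ m (\bigcup_n F n) F mF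
  (bigcup_measurable (fun k _ => mF k)) (@subset_refl _ _).
by rewrite eseries0.
Qed.

Lemma measure_countType_bigcup_eq0 d (T : measurableType d) (R : realType)
    (m : {measure set T -> \bar R}) (I : countType) (F : I -> set T) :
  (forall i, measurable (F i)) -> (forall i, m (F i) = 0%E) ->
  m (\bigcup_(i in [set: I]) F i) = 0%E.
Proof.
move=> mF F0; have -> : \bigcup_(i in [set: I]) F i =
    \bigcup_n (if unpickle n is Some i then F i else set0).
  apply/seteqP; split => x [i _].
    by move=> Fx; exists (pickle i) => //; rewrite pickleK.
  by case: unpickle => // j Fx; exists j.
by apply: measure_bigcup_eq0 => n; case: unpickle.
Qed.

Section lebesgue.
Variables (R : realType) (p : nat).
Local Notation vec := 'cV[R]_p.

Definition box (a b : vec) : set vec :=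
  [set x | forall i, a i ord0 <= x i ord0 <= b i ord0].

(** The empty set is included so that intersections stay inside: uniqueness of measures is applied
    to this pi-system. *)
Definition boxes : set (set vec) :=
  [set A | A = set0 \/ exists a b : vec, (forall i, a i ord0 <= b i ord0) /\ A = box a b].

Lemma box_closed a b : closed (box a b).
Proof.
rewrite (_ : box a b = \bigcap_(i in [set: 'I_p])
  ([set x : vec | a i ord0 <= x i ord0] `&` [set x | x i ord0 <= b i ord0])).
  apply: closed_bigI => i _; apply: closedI.
    exact: (closed_continuous_preimage (@coord_continuous R p 1 i ord0) (@closed_ge _ _)).
  exact: (closed_continuous_preimage (@coord_continuous R p 1 i ord0) (@closed_le _ _)).
apply/seteqP; split => x xab i.
  by move=> _; have /andP[] := xab i; split.
by have [/= -> ->] := xab i I.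
Qed.

Lemma norm_box (x : vec) r y : 0 <= r ->
  (`|y - x| <= r) <-> box (x - const_mx r) (x + const_mx r) y.
Proof.
move=> r0; split => [yx i|bx].
  have : `|(y - x) i ord0| <= r by rewrite (le_trans (coord_le_norm _ _ _)).
  by rewrite !mxE ler_norml => /andP[? ?]; apply/andP; split; lra.
apply: norm_le_coord => // i j; rewrite (ord1 j).
by have := bx i; rewrite !mxE ler_norml => /andP[? ?]; apply/andP; split; lra.
Qed.

Lemma cball_boxes (x : vec) r : 0 <= r -> boxes [set y | `|y - x| <= r].
Proof.
move=> r0; right; exists (x - const_mx r), (x + const_mx r); split.
  by move=> i; rewrite !mxE; lra.
by apply/seteqP; split => y /=; move/(norm_box x y r0).
Qed.

Lemma boxes_setI : setI_closed boxes.
Proof.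
move=> A B [->|[a [b [ab ->]]]]; first by left; rewrite set0I.
move=> [->|[c [d [cd ->]]]]; first by left; rewrite setI0.
pose e : vec := \col_i maxr (a i ord0) (c i ord0).
pose f : vec := \col_i minr (b i ord0) (d i ord0).
have ef : box a b `&` box c d = box e f.
  apply/seteqP; split => [x [xab xcd] i|x xef].
    rewrite !mxE ge_max le_min.
    by have /andP[-> ->] := xab i; have /andP[-> ->] := xcd i.
  split=> i; have := xef i; rewrite !mxE ge_max le_min.
    by move=> /andP[/andP[-> _] /andP[-> _]].
  by move=> /andP[/andP[_ ->] /andP[_ ->]].
have [[x Bx]|ne] := pselect (box e f !=set0).
  right; exists e, f; split => // i; have /andP[] := Bx i; exact: le_trans.
by left; rewrite ef; apply/seteqP; split => // x Bx; apply: ne; exists x.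
Qed.

Lemma borel_boxes : @measurable _ vec = <<s boxes >>.
Proof.
apply/seteqP; split; last first.
  apply: smallest_sub; first exact: sigma_algebra_measurable.
  move=> A [->|[a [b [_ ->]]]]; first exact: measurable0.
  by apply: closed_borel; exact: box_closed.
apply: smallest_sub; first exact: smallest_sigma_algebra.
move=> U oU; rewrite (open_bigcup_rat_cball oU) bigcup_mkcond.
apply: sigma_algebra_bigcup => k; case: ifPn => _; last first.
  by apply: sub_sigma_algebra; left.
by apply: sub_sigma_algebra; apply: cball_boxes; exact/ltW/rat_radius_gt0.
Qed.

Variable lam : {measure set vec -> \bar R}.
Hypothesis hlam : is_lebesgue lam.

Lemma lebesgue_cball_fin (r : R) : 0 <= r ->
  (lam [set y : vec | (`|y - 0| <= r)%R] < +oo)%E.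
Proof.
move=> r0; have [e|[a [b [ab ->]]]] := cball_boxes 0 r0.
  by rewrite e measure0.
by rewrite /box hlam// ltry.
Qed.

Lemma measurable_translate (v : vec) : measurable_fun setT (fun x : vec => x + v).
Proof.
apply: measurable_fun_coord => i j; under eq_fun do rewrite mxE.
by apply: measurable_funD => //; exact: measurable_coord.
Qed.

(** Only the values on boxes are known, and translation preserves them; boxes are a generating
    pi-system and balls of finite measure exhaust the space. *)
Lemma lebesgue_translate (A : set vec) v : measurable A ->
  lam [set x | A (x + v)] = lam A.
Proof.
move=> mA; apply/esym; rewrite -[RHS](push_measureE lam (measurable_translate v)).
apply: (measure_unique boxes (fun n => [set y : vec | `|y - 0| <= n%:R])) => //.
- exact: borel_boxes.
- exact: boxes_setI.
- by move=> n; exact: cball_boxes.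
- rewrite -subTset => x _; have [n xn] := cball_cover x; by exists n.
- move=> _ [->|[a [b [ab ->]]]]; first by rewrite !measure0.
  rewrite push_measureE [RHS](_ : _ = lam (box (a - v) (b - v))).
    rewrite /box !hlam//; first by congr EFin; apply: eq_bigr => i _; rewrite !mxE; ring.
    by move=> i; rewrite !mxE; have := ab i; lra.
  congr (lam _); apply/seteqP; split => x xab i; have := xab i;
  rewrite !mxE => /andP[? ?]; apply/andP; split; lra.
- by move=> n; exact: lebesgue_cball_fin.
Qed.

(** Translate a bounded piece of [A] by multiples [1 / k.+1] of [v]. The differences
    [1 / i.+1 - 1 / j.+1] with [i < j] are rationals between 0 and 1, so the translates are
    disjoint. They have equal mass and lie in one ball, so any number of copies of that mass stays
    below a finite bound. *)
Lemma disjoint_translates_null (A : set vec) (v : vec) : measurable A ->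
  (forall x (t : rat), 0 < t <= 1 -> A x -> ~ A (x + ratr t *: v)) -> lam A = 0%E.
Proof.
move=> mA Av; pose C n := [set y : vec | `|y - 0| <= n%:R].
have mC n : measurable (C n) by apply: closed_borel; exact: closed_norm_le.
have -> : A = \bigcup_n (A `&` C n).
  rewrite -setI_bigcupr (_ : \bigcup_n C n = setT) ?setIT//.
  by rewrite -subTset => x _; have [n xn] := cball_cover x; exists n.
apply: measure_bigcup_eq0 => n; first exact: measurableI.
set An := A `&` C n.
have mAn : measurable An by exact: measurableI.
pose F k := [set x | An (x + k.+1%:R^-1 *: v)].
have mF k : measurable (F k).
  by rewrite -[X in measurable X]setTI; exact: measurable_translate.
have lF k : lam (F k) = lam An by exact: lebesgue_translate.
have tF : trivIset setT F.
  have key i j x : (i < j)%N -> F i x -> F j x -> False.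
    move=> ij [Ai _] [Aj _].
    have := Av _ (i.+1%:R^-1 - j.+1%:R^-1) _ Aj.
    have -> : ratr (i.+1%:R^-1 - j.+1%:R^-1) = i.+1%:R^-1 - j.+1%:R^-1 :> R.
      by rewrite rmorphB/= !fmorphV/= !ratr_nat.
    rewrite scalerBl addrA addrAC addrK => /(_ _ Ai); apply; apply/andP; split.
      by rewrite subr_gt0 ltf_pV2 ?posrE// ltr_nat.
    by rewrite (le_trans (_ : _ <= i.+1%:R^-1))// ?gerBl ?invf_le1// ler1n.
  apply/trivIsetP => i j _ _ ij; rewrite -subset0 => x [Fi Fj].
  by move: ij; rewrite neq_ltn => /orP[] ij; [exact: (key _ _ _ ij Fi Fj)|exact: (key _ _ _ ij Fj Fi)].
pose r := n%:R + `|v|.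
have r0 : 0 <= r by rewrite addr_ge0.
have FB k : F k `<=` [set y | `|y - 0| <= r].
  move=> x [_]; rewrite /C/= !subr0 => xn; rewrite -[x](addrK (k.+1%:R^-1 *: v)).
  rewrite (le_trans (ler_normB _ _))// lerD// normrZ ler_piMl// ger0_norm ?invr_ge0//.
  by rewrite invf_le1// ler1n.
have mB : measurable [set y : vec | `|y - 0| <= r] by apply: closed_borel; exact: closed_norm_le.
have Lfin := lebesgue_cball_fin r0.
have Afin : lam An \is a fin_num.
  rewrite -(lF 0%N) ge0_fin_numE//; apply: le_lt_trans Lfin.
  exact: measureS.
have Lfin' : lam [set y | `|y - 0| <= r] \is a fin_num by rewrite ge0_fin_numE.
have KL K : K%:R * fine (lam An) <= fine (lam [set y | `|y - 0| <= r]).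
  rewrite -lee_fin [leRHS]fineK//.
  apply: (@le_trans _ _ (lam (\big[setU/set0]_(i < K) F i))); last first.
    apply: measureS => //; first exact: bigsetU_measurable.
    by rewrite -bigcup_mkord => x [k _]; exact: FB.
  rewrite measure_bigsetU//; rewrite (eq_bigr (fun=> (fine (lam An))%:E)); last first.
    by move=> i _; rewrite fineK//; exact: lF.
  by rewrite sumEFin sumr_const card_ord mulr_natl.
apply/eqP; rewrite -(fineK Afin) eqe; apply/eqP/le_anti/andP; split; last exact: fine_ge0.
rewrite leNgt; apply/negP => a0.
have := KL (Num.trunc (fine (lam [set y | `|y - 0| <= r]) / fine (lam An))).+1.
by rewrite leNgt -ltr_pdivrMr// truncnS_gt.
Qed.

End lebesgue.

(** * Convex functions and their differentiability *)

Section convex_function.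
Variables (R : realType) (p : nat).
Local Notation vec := 'cV[R]_p.
Local Notation axis i := (delta_mx i ord0 : vec).

Lemma norm_axis (t : R) (i : 'I_p) : `|t *: axis i| <= `|t|.
Proof.
apply: norm_le_coord => // k j; rewrite !mxE normrM ler_piMr//.
by case: (_ && _); rewrite ?normr1 ?normr0.
Qed.

Lemma axis_sum (h : vec) : h = \sum_i h i ord0 *: axis i.
Proof.
apply/matrixP => i j; rewrite summxE (ord1 j) (bigD1 i)//= !mxE !eqxx mulr1.
by rewrite big1 ?addr0// => k ki; rewrite !mxE eq_sym (negbTE ki) mulr0.
Qed.

Variable psi : vec -> \bar R.
Hypothesis hpsi : convex_ext psi.

Definition dom : set vec := [set x | psi x \is a fin_num].

Let f x := fine (psi x).

Lemma dom_convex x y (t : R) : dom x -> dom y -> 0 <= t <= 1 ->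
  dom (t *: x + (1 - t) *: y) /\
  f (t *: x + (1 - t) *: y) <= t * f x + (1 - t) * f y.
Proof.
move=> Dx Dy /andP[t0 t1].
have [->|tn0] := eqVneq t 0.
  by rewrite scale0r subr0 scale1r add0r mul0r mul1r add0r.
have [->|tn1] := eqVneq t 1.
  by rewrite subrr scale0r scale1r addr0 mul0r mul1r addr0.
have [nNoo cv] := hpsi.
have := cv x y t; rewrite lt0r tn0 t0 lt_neqAle tn1 t1 => /(_ isT).
rewrite -[psi x]fineK// -[psi y]fineK// -!EFinM -EFinD.
have := nNoo (t *: x + (1 - t) *: y); rewrite /dom/= /f.
by case: (psi (t *: x + (1 - t) *: y)) => [r| |]//= _; rewrite lee_fin.
Qed.

Lemma dom_segment x v (t : R) : dom x -> dom (x + v) -> 0 <= t <= 1 ->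
  dom (x + t *: v) /\ f (x + t *: v) - f x <= t * (f (x + v) - f x).
Proof.
move=> Dx Dy t01; have [] := dom_convex Dy Dx t01.
have -> : t *: (x + v) + (1 - t) *: x = x + t *: v.
  by apply/matrixP => i j; rewrite !mxE; ring.
by move=> D h; split => //; lra.
Qed.

Lemma dom_midpoint x v : dom (x + v) -> dom (x - v) ->
  dom x /\ 2 * f x <= f (x + v) + f (x - v).
Proof.
move=> D1 D2; have [|] := @dom_convex _ _ 2^-1 D1 D2; first by apply/andP; split; lra.
have -> : 2^-1 *: (x + v) + (1 - 2^-1) *: (x - v) = x.
  by apply/matrixP => i j; rewrite !mxE; field.
by move=> D h; split => //; lra.
Qed.

Lemma jensen n (X : 'I_n.+1 -> vec) : (forall i, dom (X i)) ->
  dom (n.+1%:R^-1 *: \sum_i X i) /\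
  f (n.+1%:R^-1 *: \sum_i X i) <= n.+1%:R^-1 * \sum_i f (X i).
Proof.
elim: n X => [|n IH] X DX.
  by rewrite !big_ord_recl !big_ord0 !addr0 invr1 scale1r mul1r.
have [D1 h1] := IH (fun i => X (widen_ord (leqnSn _) i)) (fun i => DX _).
set S := \sum_(i < n.+1) X _ in D1 h1.
have eS : \sum_(i < n.+2) X i = S + X ord_max by rewrite big_ord_recr.
pose t : R := n.+1%:R / n.+2%:R.
have n1 : n.+1%:R != 0 :> R by rewrite pnatr_eq0.
have n2 : n.+2%:R != 0 :> R by rewrite pnatr_eq0.
have t01 : 0 <= t <= 1.
  by rewrite /t divr_ge0//= ler_pdivrMr// mul1r ler_nat.
have t1 : 1 - t = n.+2%:R^-1.
  by apply: (mulIf n2); rewrite mulVf// mulrBl divfK// mul1r -natrB// subSnn.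
have [] := dom_convex D1 (DX ord_max) t01.
rewrite scalerA t1 (_ : t / n.+1%:R = n.+2%:R^-1); last by rewrite /t mulrAC divff// mul1r.
rewrite -scalerDr -eS => D h; split => //; apply: le_trans h _.
rewrite [in leRHS]big_ord_recr/= mulrDr lerD2r.
have -> : n.+2%:R^-1 = t * n.+1%:R^-1 :> R by rewrite /t mulrAC divff// mul1r.
by rewrite -[leRHS]mulrA ler_wpM2l//; case/andP: t01.
Qed.

Let P : R := p.+1%:R.

(** [x + h] is the mean of the [p.+1] points [x] and [x + P h_i e_i], so increments along the axes
    control all others. Including [x] keeps the number of points positive even for [p = 0]. *)
Lemma axis_bound (x h : vec) : dom x -> (forall i, dom (x + (P * h i ord0) *: axis i)) ->
  dom (x + h) /\
  f (x + h) - f x <= P^-1 * \sum_i (f (x + (P * h i ord0) *: axis i) - f x).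
Proof.
move=> Dx Dh.
pose X (i : 'I_p.+1) := if unlift ord0 i is Some j then x + (P * h j ord0) *: axis j else x.
have DX i : dom (X i) by rewrite /X; case: unliftP => [j _|_].
have P0 : P != 0 by rewrite pnatr_eq0.
have e1 : p.+1%:R^-1 *: \sum_i X i = x + h.
  rewrite big_ord_recl {1}/X unlift_none.
  rewrite (eq_bigr (fun j => x + P *: (h j ord0 *: axis j))); last first.
    by move=> j _; rewrite /X liftK scalerA.
  rewrite big_split/= sumr_const card_ord -scaler_sumr -axis_sum.
  have -> : x + (x *+ p + P *: h) = P *: (x + h).
    by rewrite -[x *+ p]scaler_nat scalerDr addrA -{1}[x]scale1r -scalerDl nat1r.
  by rewrite scalerA mulVf// scale1r.
have e2 : \sum_i f (X i) = P * f x + \sum_i (f (x + (P * h i ord0) *: axis i) - f x).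
  rewrite big_ord_recl {1}/X unlift_none sumrB sumr_const card_ord.
  rewrite (eq_bigr (fun i => f (x + (P * h i ord0) *: axis i))); last first.
    by move=> j _; rewrite /X liftK.
  by rewrite /P -natr1 -[f x *+ p]mulr_natl; ring.
have [] := jensen DX; rewrite e1 e2 -/P mulrDr mulKf// => D le.
by split => //; rewrite lerBlDl.
Qed.

Lemma interior_dom_ball x : dom° x ->
  exists2 r : R, 0 < r & forall h : vec, `|h| <= r -> dom (x + h).
Proof.
move=> Ux; have [r r0 rU] := nbhs_norm_lt (@open_interior _ dom) Ux.
exists (r / 2) => [|h hr]; first by rewrite divr_gt0.
by apply: interior_subset; apply: rU; rewrite addrC addKr; lra.
Qed.

Lemma interior_dom x : dom° x -> dom x.
Proof. exact: interior_subset. Qed.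

(** For convex functions upper bounds suffice: midpoint convexity turns one for [- h] into a lower
    one for [h]. *)
Lemma lower_from_upper (x h : vec) c : dom (x + h) -> dom (x - h) ->
  f (x - h) - f x <= c -> - c <= f (x + h) - f x.
Proof. by move=> D1 D2; have [_] := dom_midpoint D1 D2; lra. Qed.

Lemma axis_coord_le (h : vec) i r : P * `|h| <= r -> `|P * h i ord0| <= r.
Proof.
move=> hr; rewrite normrM ger0_norm ?ler0n//; apply: le_trans hr.
by rewrite ler_wpM2l ?ler0n// coord_le_norm.
Qed.

(** On each axis the chords to distance [r] dominate the increments linearly, and the mean over the
    axes extends this to every [h]. The Lipschitz bound is at the single point [x], which is what
    continuity asks for. *)
Lemma convex_calm x : dom° x -> exists2 r : R, 0 < r &
  exists2 K : R, 0 <= K & forall h : vec, `|h| <= r ->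
    dom (x + h) /\ `|f (x + h) - f x| <= K * `|h|.
Proof.
move=> Ux; have [r r0 rD] := interior_dom_ball Ux.
have Dx := interior_dom Ux.
have P0 : 0 < P by rewrite ltr0n.
pose K i := `|f (x + r *: axis i) - f x| + `|f (x - r *: axis i) - f x|.
have K0 i : 0 <= K i by rewrite addr_ge0.
have Dax (t : R) i : `|t| <= r -> dom (x + t *: axis i).
  by move=> tr; apply: rD; rewrite (le_trans (norm_axis _ _)).
have up1 (t : R) i : `|t| <= r -> f (x + t *: axis i) - f x <= `|t| / r * K i.
  move=> tr.
  have tr01 : 0 <= `|t| / r <= 1 by rewrite divr_ge0 ?(ltW r0)//= ler_pdivrMr// mul1r.
  have [t0|t0] := leP 0 t.
    have [|_] := @dom_segment x (r *: axis i) (`|t| / r) Dx _ tr01.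
      by apply: Dax; rewrite gtr0_norm.
    rewrite scalerA divfK ?gt_eqF// ger0_norm// => h; apply: le_trans h _.
    rewrite ler_wpM2l ?divr_ge0 ?(ltW r0)//.
    by rewrite (le_trans (ler_norm _))// lerDl.
  have [|_] := @dom_segment x (- (r *: axis i)) (`|t| / r) Dx _ tr01.
    by rewrite -scaleNr; apply: Dax; rewrite normrN gtr0_norm.
  rewrite -scaleNr scalerA mulrN divfK ?gt_eqF// ltr0_norm// opprK => h; apply: le_trans h _.
  rewrite ler_wpM2l ?divr_ge0 ?(ltW r0)// ?oppr_ge0 ?(ltW t0)//.
  by rewrite scaleNr (le_trans (ler_norm _))// lerDr.
pose S := \sum_i K i.
have S0 : 0 <= S by apply: sumr_ge0.
have up (h : vec) : P * `|h| <= r -> dom (x + h) /\ f (x + h) - f x <= S / r * `|h|.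
  move=> hr; have [D le] := axis_bound Dx (fun i => Dax _ i (axis_coord_le i hr)).
  split => //; apply: le_trans le _.
  rewrite ler_pdivrMl//.
  rewrite [leRHS](_ : _ = \sum_i (P * `|h| / r * K i)); last by rewrite -mulr_sumr -/S; ring.
  apply: ler_sum => i _; apply: le_trans (up1 _ i (axis_coord_le i hr)) _.
  by rewrite ler_wpM2r// ler_wpM2r ?invr_ge0 ?(ltW r0)// axis_coord_le.
exists (r / P); first by rewrite divr_gt0.
exists (S / r) => [|h]; first by rewrite divr_ge0// ltW.
rewrite ler_pdivlMr// mulrC => hr.
have [D1 u1] := up h hr.
have [D2] : dom (x - h) /\ f (x - h) - f x <= S / r * `|- h| by apply: up; rewrite normrN.
rewrite normrN => u2; split => //; rewrite ler_norml u1 andbT.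
exact: lower_from_upper.
Qed.

Lemma convex_continuous (x : vec) : dom° x -> f @ nbhs x --> f x.
Proof.
move=> /convex_calm[r r0 [K K0 h]]; apply/cvgrPdist_lt => e e0.
near=> y; rewrite distrC.
have yr : `|y - x| <= r.
  by near: y; apply/nbhs_ballP; exists r => //= y; rewrite -ball_normE/= distrC => /ltW.
have ye : `|y - x| < e / (K + 1).
  near: y; apply/nbhs_ballP; exists (e / (K + 1)) => /= [|y].
    by rewrite divr_gt0// ltr_wpDl.
  by rewrite -ball_normE/= distrC.
have := h _ yr; rewrite [x + _]addrC subrK => -[_] /le_lt_trans; apply.
have K1 : 0 < K + 1 by rewrite ltr_wpDl.
move: ye; rewrite ltr_pdivlMr// => ye; apply: le_lt_trans ye.
by rewrite mulrC ler_wpM2l// lerDl.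
Unshelve. all: by end_near. Qed.

Lemma dot_linear (L : vec) : linear (dot L : vec -> R).
Proof. by move=> a x y; rewrite dotDr dotZr. Qed.

Lemma has_gradient (g : vec -> R) x (L : vec) :
  (forall e : R, 0 < e -> exists2 d : R, 0 < d & forall h : vec, `|h| <= d ->
    `|g (x + h) - g x - dot L h| <= e * `|h|) ->
  differentiable g x /\ forall h, 'd g x h = dot L h.
Proof.
move=> hg.
pose lM := GRing.isLinear.Build _ _ _ _ _ (dot_linear L).
pose lL : {linear vec -> R} := HB.pack (dot L : vec -> R) lM.
have cL : continuous lL by exact: dot_continuousr.
have hh : forall e : R, 0 < e ->
    \forall h \near (0 : vec), `|g (h + x) - (g x + dot L h)| <= e * `|h|.
  move=> e e0; have [d d0 hd] := hg _ e0.
  apply/nbhs_ballP; exists d => //= h; rewrite -ball_normE/= sub0r normrN => hdl.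
  by rewrite opprD addrA [h + x]addrC; apply: hd; exact: ltW.
have dE : 'd g x = lL :> (vec -> R).
  by apply: diff_unique => //; apply/eqaddoP => e e0; exact: hh.
split; last by move=> h; rewrite dE.
by apply/diff_locallyP; rewrite dE; split => //; apply/eqaddoP => e e0; exact: hh.
Qed.

(** For a convex function partial derivatives at the point suffice, and only their upper estimates
    are asked for: the lower ones follow by reflection at [x]. *)
Lemma convex_partials_diff x (L : vec) : dom° x ->
  (forall i (e : R), 0 < e -> exists2 d : R, 0 < d & forall t, `|t| <= d ->
    f (x + t *: axis i) - f x - L i ord0 * t <= e * `|t|) ->
  differentiable f x /\ forall h, 'd f x h = dot L h.
Proof.
move=> Ux hL; apply: has_gradient => e e0.
have [r r0 rD] := interior_dom_ball Ux.
have Dx := interior_dom Ux.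
have P0 : 0 < P by rewrite ltr0n.
(* The axis steps are [P] times longer than [h], so the rate [e / P] leaves an error [e * |h|] on
   each axis, and the mean of these errors stays below [e * |h|]. *)
have e'0 : 0 < e / P by rewrite divr_gt0.
have /choice[d hd] i : exists d : R, 0 < d /\ forall t, `|t| <= d ->
    f (x + t *: axis i) - f x - L i ord0 * t <= e / P * `|t|.
  by have [d d0 hd] := hL i _ e'0; exists d.
pose d0 := minr r (\big[minr/1]_i d i).
have d00 : 0 < d0.
  by rewrite lt_min r0; apply/bigmin_gtP; split => // i _; have [] := hd i.
have d0d i : d0 <= d i by rewrite ge_min bigmin_le_cond ?orbT.
have d0r : d0 <= r by rewrite ge_min lexx.
have up (h : vec) : P * `|h| <= d0 -> dom (x + h) /\ f (x + h) - f x - dot L h <= e * `|h|.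
  move=> hr; have [] := @axis_bound x h Dx.
    by move=> i; apply: rD; rewrite (le_trans (norm_axis _ _))// (le_trans _ d0r)// axis_coord_le.
  move=> D le; split => //; rewrite lerBlDr; apply: le_trans le _.
  rewrite ler_pdivrMl// mulrDr.
  apply: (@le_trans _ _ (\sum_i (e / P * (P * `|h|) + P * (L i ord0 * h i ord0)))).
    apply: ler_sum => i _; have [_ hdi] := hd i.
    have := hdi _ (le_trans (axis_coord_le i hr) (d0d i)).
    rewrite lerBlDr => /le_trans; apply; rewrite [L i ord0 * _]mulrCA lerD2r.
    by rewrite ler_wpM2l ?(ltW e'0)// axis_coord_le.
  rewrite big_split/= sumr_const card_ord -mulr_sumr lerD2r.
  rewrite mulrA divfK ?gt_eqF// -[leLHS]mulr_natl ler_wpM2r ?mulr_ge0 ?(ltW e0)//.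
  by rewrite ler_nat.
exists (d0 / P) => [|h]; first by rewrite divr_gt0.
rewrite ler_pdivlMr// mulrC => hr.
have [D1 u1] := up h hr.
have [D2] : dom (x - h) /\ f (x - h) - f x - dot L (- h) <= e * `|- h|.
  by apply: up; rewrite normrN.
rewrite normrN -scaleN1r dotZr mulN1r opprK scaleN1r => u2.
rewrite ler_norml u1 andbT.
have [_] := dom_midpoint D1 D2; lra.
Qed.

End convex_function.

(** * Subgradients and kinks *)

Section gradient.
Variables (R : realType) (p : nat).
Local Notation vec := 'cV[R]_p.
Local Notation axis i := (delta_mx i ord0 : vec).

Lemma dot_grad (psi : vec -> \bar R) x (v : vec) :
  'd (fun y => fine (psi y)) x v = dot (grad psi x) v.
Proof.
rewrite {1}(axis_sum v) linear_sum/=; apply: eq_bigr => i _.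
by rewrite linearZ/= mxE [LHS]mulrC.
Qed.

Lemma directional (g : vec -> R) (x v : vec) : differentiable g x ->
  forall e : R, 0 < e -> exists2 d : R, 0 < d & forall t : R, `|t| <= d ->
    `|g (x + t *: v) - g x - t * 'd g x v| <= e * `|t|.
Proof.
move=> /diff_locallyP[_ /eqaddoP hg] e e0.
have v1 : 0 < `|v| + 1 by rewrite ltr_wpDl.
have e'0 : 0 < e / (`|v| + 1) by rewrite divr_gt0.
have /nbhs_ballP[d /= d0 hd] := hg _ e'0.
exists (d / (`|v| + 1) / 2) => [|t td]; first by rewrite !divr_gt0.
have tv : ball 0 d (t *: v).
  rewrite -ball_normE/= sub0r normrN normrZ.
  apply: (@le_lt_trans _ _ (d / (`|v| + 1) / 2 * (`|v| + 1))).
    by rewrite ler_pM// lerDl.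
  by rewrite mulrAC divfK ?gt_eqF//; lra.
have := hd _ tv; rewrite /= -[(_ - _) (t *: v)]/(g (t *: v + x) - (g x + 'd g x (t *: v))).
rewrite opprD addrA [t *: v + x]addrC linearZ/= => /le_trans; apply.
rewrite normrZ mulrCA [leRHS]mulrC ler_wpM2l//.
by rewrite mulrAC ler_pdivrMr// ler_wpM2l ?(ltW e0)// lerDl.
Qed.

(** Where no differential exists, the choice operator behind ['d] returns its default point, the
    zero map. *)
Lemma diff_default (g : vec -> R) (x v : vec) : ~ differentiable g x -> 'd g x v = 0.
Proof.
move=> ng; rewrite /diff; set Q := (Q in xget _ Q).
have [[df hdf]|nQ] := pselect (exists df, Q df).
  by exfalso; apply: ng; apply/diffP; exact: (@getPex _ Q (ex_intro _ df hdf)).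
by rewrite getPN// => df hdf; apply: nQ; exists df.
Qed.

Variable psi : vec -> \bar R.
Let f x := fine (psi x).
Local Notation U := (dom psi)°.

Lemma diff_at_interior x : diff_at psi x -> U x. Proof. by case. Qed.

Lemma subgradient_unique x (w : vec) : diff_at psi x ->
  (forall z, (psi x + (dot w (z - x))%:E <= psi z)%E) -> w = grad psi x.
Proof.
move=> dx sw; have Ux := diff_at_interior dx; have [_ df] := dx.
have [r r0 rD] := interior_dom_ball Ux.
have Dx : dom psi x := interior_dom Ux.
have le (v : vec) : dot w v <= dot (grad psi x) v.
  apply/ler_addgt0Pr => e e0; have [d d0 hd] := directional v df e0.
  pose t := minr d (r / (`|v| + 1)).
  have v1 : 0 < `|v| + 1 by rewrite ltr_wpDl.
  have t0 : 0 < t by rewrite lt_min d0 divr_gt0.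
  have td : `|t| <= d by rewrite gtr0_norm// ge_min lexx.
  have := hd _ td; rewrite dot_grad (gtr0_norm t0) ler_norml => /andP[_ h].
  have Dt : dom psi (x + t *: v).
    apply: rD; rewrite normrZ gtr0_norm//.
    apply: (@le_trans _ _ (r / (`|v| + 1) * (`|v| + 1))); last by rewrite divfK ?gt_eqF.
    by rewrite ler_pM ?(ltW t0)// ?lerDl// ge_min lexx orbT.
  have := sw (x + t *: v); rewrite [x + _]addrC addrK dotZr -[psi x]fineK//.
  rewrite [t *: v + x]addrC -[psi (x + t *: v)]fineK// -EFinD lee_fin -/(f x) -/(f (x + t *: v)) => h2.
  rewrite -(ler_pM2l t0) mulrDr; rewrite -/(f x) -/(f (x + t *: v)) in h; lra.
apply/matrixP => i j; rewrite (ord1 j); apply/eqP; rewrite eq_le.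
have := le (axis i); rewrite ![dot _ (axis i)]dotC !dot_delta => ->/=.
have := le (- axis i); rewrite ![dot _ (- axis i)]dotC !dotNl !dot_delta; lra.
Qed.

Hypothesis hpsi : convex_ext psi.

Lemma grad_subgradient x z : diff_at psi x ->
  (psi x + (dot (grad psi x) (z - x))%:E <= psi z)%E.
Proof.
move=> dx; have Ux := diff_at_interior dx; have [_ df] := dx.
have Dx : dom psi x := interior_dom Ux.
have [Dz|nDz] := pselect (dom psi z); last first.
  have [nNoo _] := hpsi; have := nNoo z; move: nDz; rewrite /dom/=.
  by case: (psi z) => [? []//| |//] _ _; rewrite leey.
rewrite -[psi x]fineK// -[psi z]fineK// -EFinD lee_fin -/(f x) -/(f z).
apply/ler_addgt0Pr => e e0; have [d d0 hd] := directional (z - x) df e0.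
pose t := minr d 1.
have t0 : 0 < t by rewrite lt_min d0 ltr01.
have t1 : t <= 1 by rewrite ge_min lexx orbT.
have td : `|t| <= d by rewrite gtr0_norm// ge_min lexx.
have := hd _ td; rewrite dot_grad (gtr0_norm t0) ler_norml => /andP[h _].
have [||_ h2] := @dom_segment _ _ _ hpsi x (z - x) t Dx.
- by rewrite addrC subrK.
- by rewrite (ltW t0).
move: h2; rewrite [x + (z - x)]addrC subrK -/(f x) -/(f z) => h2.
rewrite -/(f x) in h; rewrite -(ler_pM2l t0) !mulrDr; lra.
Qed.

(* [kink i q k] collects the points where the partial derivatives in direction [i] from
   the left and from the right lie at distance at least [1 / k.+1] on both sides of [q].
   Two such points never differ by a rational multiple of the [i]-th axis. *)
Definition kink (i : 'I_p) (q : rat) (k : nat) : set vec := [set x | U x /\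
  forall t : rat, t != 0 -> U (x + ratr t *: axis i) ->
    ratr q * ratr t + `|ratr t| / k.+1%:R <= f (x + ratr t *: axis i) - f x].

Lemma diff_no_kink x i q k : diff_at psi x -> ~ kink i q k x.
Proof.
move=> dx [Ux hk]; have [_ df] := dx.
pose c : R := k.+1%:R^-1.
have c0 : 0 < c by rewrite invr_gt0.
(* Adding the kink inequalities for [t] and [- t] cancels [q] and leaves [2 c t]; the differential
   at accuracy [c / 2] allows only [c t]. *)
have [d d0 hd] := directional (axis i) df (divr_gt0 c0 (ltr0n R 2)).
have [r r0 rU] := nbhs_norm_lt (@open_interior _ (dom psi)) Ux.
have [t] : exists t : rat, ratr t \in `]0, minr d r[.
  by apply: rat_in_itvoo; rewrite lt_min d0.
rewrite in_itv/= lt_min => /and3P[t0 td tr].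
have tn0 : t != 0 by apply: contraTneq t0 => ->; rewrite rmorph0 ltxx.
have Ut (s : R) : `|s| < r -> U (x + s *: axis i).
  by move=> sr; apply: rU; rewrite addrC addKr (le_lt_trans (norm_axis _ _)).
have h1 := hk t tn0 (Ut _ _); have h2 := hk (- t) _ (Ut _ _).
move: h1 h2; rewrite oppr_eq0 tn0 rmorphN normrN (gtr0_norm t0).
move=> /(_ tr) h1 /(_ isT tr) h2.
have := hd (ratr t); have := hd (- ratr t); rewrite normrN (gtr0_norm t0).
move=> /(_ (ltW td)); rewrite ler_norml => /andP[_ h3].
move=> /(_ (ltW td)); rewrite ler_norml => /andP[_ h4].
rewrite -/c in h1 h2; rewrite -/(f x) in h3 h4.
have : 0 < c * ratr t by rewrite mulr_gt0.
rewrite /f in h1 h2 h3 h4; lra.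
Qed.

(** The slope is the left derivative, the supremum [L] of the backward quotients. If all forward
    quotients stayed above [L + e], a rational in between would make [x] a kink. *)
Lemma convex_partial x i : U x -> (forall q k, ~ kink i q k x) ->
  exists L : R, forall e : R, 0 < e -> exists2 d : R, 0 < d & forall t, `|t| <= d ->
    f (x + t *: axis i) - f x - L * t <= e * `|t|.
Proof.
move=> Ux nk; have [r r0 rD] := interior_dom_ball Ux.
have Dx : dom psi x := interior_dom Ux.
have Dax (t : R) : `|t| <= r -> dom psi (x + t *: axis i).
  by move=> tr; apply: rD; rewrite (le_trans (norm_axis _ _)).
pose S := [set (f x - f (x - t *: axis i)) / t | t in [set t | 0 < t /\ dom psi (x - t *: axis i)]].
have three (t t' : R) : 0 < t -> 0 < t' -> dom psi (x + t *: axis i) ->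
    dom psi (x - t' *: axis i) ->
    (f x - f (x - t' *: axis i)) / t' <= (f (x + t *: axis i) - f x) / t.
  move=> t0 t'0 D1 D2; have tt' : 0 < t + t' by rewrite addr_gt0.
  pose w := t' / (t + t').
  have w01 : 0 <= w <= 1.
    by rewrite divr_ge0 ?(ltW t'0) ?(ltW tt')//= ler_pdivrMr// mul1r lerDr ltW.
  have [_] := dom_convex hpsi D1 D2 w01.
  have -> : w *: (x + t *: axis i) + (1 - w) *: (x - t' *: axis i) = x.
    apply/matrixP => a b; rewrite !mxE; rewrite /w; field.
    by rewrite gt_eqF.
  rewrite -!/(f _) => h.
  have {}h : (t + t') * f x <= t' * f (x + t *: axis i) + t * f (x - t' *: axis i).
    rewrite mulrC -ler_pdivlMr//; apply: le_trans h _.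
    by rewrite le_eqVlt; apply/orP; left; apply/eqP; rewrite /w; field; rewrite gt_eqF.
  rewrite ler_pdivrMr// mulrAC ler_pdivlMr//; lra.
have rr : `|r| <= r by rewrite gtr0_norm.
have S0 : S !=set0.
  exists ((f x - f (x - r *: axis i)) / r); exists r => //; split => //.
  by rewrite -scaleNr; apply: Dax; rewrite normrN.
have hS : has_sup S.
  split => //; exists ((f (x + r *: axis i) - f x) / r) => _ [t [t0 Dt] <-].
  by apply: three => //; exact: Dax.
pose L := sup S.
have L1 (t : R) : 0 < t -> dom psi (x + t *: axis i) -> L * t <= f (x + t *: axis i) - f x.
  move=> t0 Dt; rewrite -ler_pdivlMr//; apply: ge_sup => // _ [t' [t'0 Dt'] <-].
  exact: three.
have L2 (t : R) : 0 < t -> dom psi (x - t *: axis i) -> f x - f (x - t *: axis i) <= L * t.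
  by move=> t0 Dt; rewrite -ler_pdivrMr//; apply: sup_upper_bound => //; exists t.
exists L => e e0.
have [t0 [t00 Dt0 ht0]] : exists t0 : R, [/\ 0 < t0, dom psi (x + t0 *: axis i) &
    f (x + t0 *: axis i) - f x <= (L + e) * t0].
  apply: contrapT => h.
  have {}h (t : R) : 0 < t -> dom psi (x + t *: axis i) -> (L + e) * t < f (x + t *: axis i) - f x.
    by move=> tp Dt; rewrite ltNge; apply/negP => le; apply: h; exists t.
  (* [q] lies in the middle third of the gap, which leaves [e / 3] on either side for [1 / k.+1]. *)
  have [q] : exists q : rat, ratr q \in `](L + e / 3), (L + 2 * e / 3)[.
    by apply: rat_in_itvoo; lra.
  rewrite in_itv/= => /andP[q1 q2].
  have [k hk] : exists k : nat, k.+1%:R^-1 < e / 3.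
    have e3 : 0 < e / 3 by rewrite divr_gt0.
    exists (Num.trunc (e / 3)^-1); rewrite invf_plt ?posrE//.
    by have := truncnS_gt (e / 3)^-1.
  apply: (nk q k); split => // t tn0 Ut; set s := ratr t in Ut *.
  have sn0 : s != 0 by rewrite fmorph_eq0.
  have Dt : dom psi (x + s *: axis i) := interior_dom Ut.
  move: hk; set c := k.+1%:R^-1 => hk.
  have [s0|s0] := ltP 0 s.
    rewrite gtr0_norm//; have := h _ s0 Dt.
    have : s * c <= s * (e / 3) by rewrite ler_pM2l// ltW.
    have : s * ratr q <= s * (L + 2 * e / 3) by rewrite ler_pM2l// ltW.
    lra.
  have {}s0 : 0 < - s by rewrite oppr_gt0 lt_neqAle sn0.
  have := L2 _ s0; rewrite scaleNr opprK => /(_ Dt).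
  rewrite -(normrN s) gtr0_norm//.
  have : (- s) * c <= (- s) * (e / 3) by rewrite ler_pM2l// ltW.
  have : (- s) * (L + e / 3) <= (- s) * ratr q by rewrite ler_pM2l// ltW.
  lra.
have [_ [t1 [t10 Dt1] <-] ht1] := sup_adherent e0 hS; rewrite -/L in ht1.
exists (minr t0 t1) => [|t]; first by rewrite lt_min t00.
rewrite le_min => /andP[tt0 tt1]; have [tp|] := ltP 0 t.
  rewrite gtr0_norm// in tt0 *.
  have w01 : 0 <= t / t0 <= 1 by rewrite divr_ge0 ?(ltW tp) ?(ltW t00)//= ler_pdivrMr// mul1r.
  have [_] := dom_segment hpsi Dx Dt0 w01; rewrite scalerA divfK ?gt_eqF// -!/(f _) => h.
  have : t / t0 * (f (x + t0 *: axis i) - f x) <= t / t0 * ((L + e) * t0).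
    by rewrite ler_wpM2l//; case/andP: w01.
  have -> : t / t0 * ((L + e) * t0) = t * (L + e) by field; rewrite gt_eqF.
  lra.
rewrite le_eqVlt => /orP[/eqP->|tn].
  by rewrite scale0r addr0 subrr mulr0 subr0 normr0 mulr0.
rewrite ltr0_norm// in tt1 *.
have w01 : 0 <= - t / t1 <= 1 by rewrite divr_ge0 ?oppr_ge0 ?(ltW tn) ?(ltW t10)//= ler_pdivrMr// mul1r.
have [_] := dom_segment hpsi Dx Dt1 w01; rewrite scalerN -scaleNr scalerA mulNr divfK ?gt_eqF//.
rewrite opprK -!/(f _) => h.
have : (L - e) * t1 < f x - f (x - t1 *: axis i) by rewrite -ltr_pdivlMr.
move=> h1; have : - t / t1 * (f (x - t1 *: axis i) - f x) <= - t / t1 * (- ((L - e) * t1)).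
  by rewrite ler_wpM2l//; [case/andP: w01|lra].
have -> : - t / t1 * (- ((L - e) * t1)) = t * (L - e) by field; rewrite gt_eqF.
lra.
Qed.

Lemma diff_atP x : diff_at psi x <-> U x /\ forall i q k, ~ kink i q k x.
Proof.
split => [dx|[Ux nk]].
  by split; [exact: diff_at_interior|move=> i q k; exact: diff_no_kink].
split => //; have /choice[L hL] i := convex_partial Ux (nk i).
have [] // := @convex_partials_diff _ _ _ hpsi x (\col_i L i) Ux.
by move=> i e e0; have [d d0 hd] := hL i _ e0; exists d => // t td; rewrite mxE; exact: hd.
Qed.

End gradient.

Lemma affine_bound_eq0 (R : realType) (a b : R) :
  (forall e : R, 0 < e -> exists2 d : R, 0 < d &
    forall t, 0 < t <= d -> `|a + t * b| <= e * t) -> a = 0 /\ b = 0.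
Proof.
move=> h; have a0 : a = 0.
  apply/eqP; rewrite -normr_eq0 eq_le normr_ge0 andbT; apply/ler_addgt0Pr => e e0.
  have [d d0 hd] := h 1 ltr01.
  have b1 : 0 < 1 + `|b| by rewrite ltr_pwDl.
  pose t := minr d (e / (1 + `|b|)).
  have t0 : 0 < t by rewrite lt_min d0 divr_gt0.
  have := hd t; rewrite t0 ge_min lexx/= => /(_ isT) h1.
  have h2 : t * (1 + `|b|) <= e by rewrite -ler_pdivlMr// ge_min lexx orbT.
  have : `|a| <= `|a + t * b| + `|t * b|.
    by rewrite -{1}(addrK (t * b) a) ler_normB.
  rewrite normrM (gtr0_norm t0); lra.
split => //; apply/eqP; rewrite -normr_eq0 eq_le normr_ge0 andbT.
apply/ler_addgt0Pr => e e0; have [d d0 hd] := h e e0.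
have := hd d; rewrite d0 lexx a0 !add0r normrM (gtr0_norm d0) => /(_ isT).
by rewrite mulrC ler_pM2r.
Qed.

(** * Measurability of gradients and null sets of convex functions *)

Section convex_measurable.
Variables (R : realType) (p : nat).
Local Notation vec := 'cV[R]_p.
Local Notation axis i := (delta_mx i ord0 : vec).
Variable psi : vec -> \bar R.
Hypothesis hpsi : convex_ext psi.
Let f x := fine (psi x).
Local Notation U := (dom psi)°.

(** A convex function may be irregular on the boundary of its domain, so [f] itself need not be
    measurable; kept only on the interior, where it is continuous, it is. *)
Let fU (x : vec) : R := if `[< U x >] then f x else 0.

Let fUE x : U x -> fU x = f x. Proof. by rewrite /fU; case: asboolP. Qed.

Lemma measurable_interior_dom : measurable U.
Proof. by apply: open_borel; exact: open_interior. Qed.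

Let measurable_fU : measurable_fun setT fU.
Proof.
apply: (measurability _ (RGenOpens.measurableE R)).
move=> _ [_ [a [b ->] <-]]; rewrite setTI; set V := `]a, b[%classic.
rewrite (_ : _ @^-1` _ =
  (U `&` f @^-1` V) `|` (~` U `&` [set _ | V 0])); last first.
  apply/seteqP; split => x /=; rewrite /fU; case: asboolP => Ux.
  - by left.
  - by right.
  - by case=> -[].
  - by case=> -[].
apply: measurableU.
  apply: open_borel; rewrite openE => x [Ux Vx]; apply: filterI.
    exact: open_nbhs_nbhs (conj (@open_interior _ _) Ux).
  apply: (convex_continuous hpsi Ux); apply: open_nbhs_nbhs; split => //.
apply: measurableI; first by apply: measurableC; exact: measurable_interior_dom.
have [V0|nV0] := pselect (V 0).
  by rewrite (_ : [set _ | _] = setT)//; apply/seteqP; split.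
by rewrite (_ : [set _ | _] = set0)//; apply/seteqP; split.
Qed.

Lemma measurable_kink i q k : measurable (kink psi i q k).
Proof.
pose T (t : rat) := [set x : vec | U (x + ratr t *: axis i)].
have mT t : measurable (T t).
  rewrite -[X in measurable X]setTI; apply: measurable_translate => //.
  exact: measurable_interior_dom.
rewrite (_ : kink _ _ _ _ = U `&` \bigcap_(t in [set t : rat | t != 0]) (~` T t `|`
  [set x | ratr q * ratr t + `|ratr t| / k.+1%:R <= fU (x + ratr t *: axis i) - fU x])); last first.
  apply/seteqP; split => x [Ux hx]; split => //.
    move=> t /= tn0; have [Ut|nUt] := pselect (T t x); last by left.
    by right; rewrite /= !fUE//; exact: hx.
  by move=> t tn0 Ut; have [//|/=] := hx t tn0; rewrite !fUE.
apply: measurableI; first exact: measurable_interior_dom.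
apply: countType_bigcap_measurable => t _; apply: measurableU; first exact: measurableC.
rewrite -[X in measurable X]setTI; apply: measurable_fun_le => //.
apply: measurable_funB => //.
exact: (measurableT_comp measurable_fU (measurable_translate _)).
Qed.

Lemma diff_atE : [set x | diff_at psi x] =
  U `\` \bigcup_(iqk in [set: 'I_p * rat * nat]) kink psi iqk.1.1 iqk.1.2 iqk.2.
Proof.
apply/seteqP; split => x /=.
  move=> /(diff_atP hpsi x)[Ux nk]; split => // -[[[i q] k] _ /=]; exact: nk.
move=> [Ux nk]; apply/(diff_atP hpsi x); split => // i q k kx.
by apply: nk; exists ((i, q), k).
Qed.

Lemma measurable_diff_at : measurable [set x | diff_at psi x].
Proof.
rewrite diff_atE; apply: measurableD; first exact: measurable_interior_dom.
by apply: countType_bigcup_measurable => -[[i q] k] _ /=; exact: measurable_kink.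
Qed.

Lemma interior_segment c y (w : R) : U c -> dom psi y -> 0 < w <= 1 ->
  U (w *: c + (1 - w) *: y).
Proof.
move=> Uc Dy /andP[w0 w1]; have [r r0 rD] := interior_dom_ball Uc.
apply/nbhs_ballP; exists (w * r) => /=; first by rewrite mulr_gt0.
move=> z; rewrite -ball_normE/= distrC => zr.
set m := w *: c + _ in zr *.
have -> : z = w *: (c + w^-1 *: (z - m)) + (1 - w) *: y.
  rewrite scalerDr scalerA divff ?gt_eqF// scale1r addrAC -/m.
  by rewrite addrC subrK.
have [] // := @dom_convex _ _ _ hpsi (c + w^-1 *: (z - m)) y w _ Dy.
  apply: rD; rewrite normrZ ger0_norm ?invr_ge0 ?(ltW w0)//.
  by rewrite mulrC ler_pdivrMr// mulrC ltW.
by rewrite w1 ltW.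
Qed.

(* [fine psi] vanishes outside the domain, so the only possible differential at a
   point outside the interior is 0, which is also the default value of ['d]. *)
Lemma grad_outside c x : U c -> ~ diff_at psi x -> grad psi x = 0.
Proof.
move=> Uc nd; apply/matrixP => i j; rewrite !mxE.
have [df|ndf] := pselect (differentiable f x); last exact: diff_default.
have nU : ~ U x by move=> Ux; apply: nd; split.
have zero c' : U c' -> 'd f x (x - c') = 0.
  move=> Uc'.
  (* Beyond [x], seen from the interior point [c'], the domain has ended: a further point of it
     would put [x] in the interior. *)
  have out (t : R) : 0 < t -> f (x + t *: (x - c')) = 0.
    move=> t0; rewrite /f; have [D|] := pselect (dom psi (x + t *: (x - c'))); last first.
      by rewrite /dom/=; case: (psi _) => // ? [].
    exfalso; apply: nU; have t1 : 0 < 1 + t by rewrite addr_gt0.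
    have := @interior_segment c' _ (t / (1 + t)) Uc' D.
    have -> : (t / (1 + t)) *: c' + (1 - t / (1 + t)) *: (x + t *: (x - c')) = x.
      by apply/matrixP => a b; rewrite !mxE; field; rewrite gt_eqF.
    by apply; rewrite divr_gt0//= ler_pdivrMr// mul1r lerDr.
  have [] // := @affine_bound_eq0 _ (f x) ('d f x (x - c')) => e e0.
  have [d d0 hd] := directional (x - c') df e0; exists d => // t /andP[t0 td].
  have := hd t; rewrite gtr0_norm// => /(_ td).
  by rewrite out// sub0r -opprD normrN.
have [r r0 rU] := nbhs_norm_lt (@open_interior _ (dom psi)) Uc.
have r2 : 0 < r / 2 by rewrite divr_gt0.
(* Two interior points that differ along the axis: subtracting the two vanishing derivatives
   isolates the partial derivative. *)
have Uc2 : U (c - (r / 2) *: axis i).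
  apply: rU; rewrite addrC addKr normrN (le_lt_trans (norm_axis _ _))// gtr0_norm//; lra.
have := zero _ Uc2; rewrite opprB addrCA linearD/= zero// addr0 linearZ/= => /eqP.
by rewrite mulf_eq0 (gt_eqF r2)/= => /eqP.
Qed.

(** Where [psi] is differentiable the gradient is a limit of difference quotients of [fU]; elsewhere
    it is 0, so measurability holds on the whole space. *)
Lemma measurable_grad c : U c -> measurable_fun setT (grad psi).
Proof.
move=> Uc; apply: measurable_fun_coord => i j; rewrite (ord1 j).
set D := [set x | diff_at psi x].
have mD : measurable D := measurable_diff_at.
have -> : [set: vec] = D `|` ~` D by rewrite setUv.
apply/measurable_funU => //; first exact: measurableC.
split; last first.
  apply: (@eq_measurable_fun _ _ _ _ (~` D) (cst (0 : R) : vec -> R)); last exact: measurable_cst.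
  by move=> x /set_mem nd; rewrite (grad_outside Uc nd) mxE.
pose h (n : nat) (x : vec) : R := n.+1%:R * (fU (x + n.+1%:R^-1 *: axis i) - fU x).
apply: (measurable_fun_cvg (h := h)).
  move=> n; apply: measurable_funTS; apply: measurable_funM => //.
  apply: measurable_funB => //.
  exact: (measurableT_comp measurable_fU (measurable_translate _)).
move=> x dx; have Ux := diff_at_interior dx; have [_ df] := dx.
apply/cvgrPdist_le => e e0; have [d d0 hd] := directional (axis i) df e0.
have [r r0 rU] := nbhs_norm_lt (@open_interior _ (dom psi)) Ux.
near=> n.
have n0 : 0 < n.+1%:R^-1 :> R by rewrite invr_gt0.
have nd : n.+1%:R^-1 <= d.
  by near: n; have := @near_infty_natSinv_lt R (PosNum d0); apply: filterS => n /ltW.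
have nr : n.+1%:R^-1 < r.
  by near: n; exact: (@near_infty_natSinv_lt R (PosNum r0)).
rewrite /h !fUE//; last first.
  by apply: rU; rewrite addrC addKr (le_lt_trans (norm_axis _ _))// gtr0_norm.
have := hd n.+1%:R^-1; rewrite gtr0_norm// => /(_ nd); rewrite dot_grad dotC dot_delta.
rewrite -/(f x) -/(f _) distrC => h1.
rewrite -(ler_pM2r n0) -[X in _ * X <= _](gtr0_norm n0) -normrM.
apply: le_trans h1; rewrite le_eqVlt; apply/orP; left; apply/eqP; congr `|_|.
by rewrite mulrBl -/(f _) [_ * grad psi x i ord0]mulrC mulrAC divff// mul1r opprB; ring.
Unshelve. all: by end_near. Qed.

Section null.
Variable lam : {measure set vec -> \bar R}.
Hypothesis hlam : is_lebesgue lam.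

(** The inequality at [x] with step [t] and the one at [x + t e_i] with step [- t] add up to
    [2 |t| / k.+1 <= 0]. *)
Lemma kink_null i q k : lam (kink psi i q k) = 0%E.
Proof.
apply: (disjoint_translates_null hlam (measurable_kink i q k) (v := axis i)).
move=> x t /andP[t0 _] [Ux hx] [Ut ht].
have tn0 : t != 0 by rewrite gt_eqF.
have h1 := hx t tn0 Ut; have := ht (- t); rewrite oppr_eq0 tn0 rmorphN/= scaleNr addrK.
move=> /(_ isT Ux); rewrite normrN mulrN => h2.
have : 0 < `|ratr t| / k.+1%:R :> R by rewrite divr_gt0// normr_gt0 fmorph_eq0.
by move: h1 h2; move: (`|ratr t| / k.+1%:R) (ratr q * ratr t) => a b; lra.
Qed.

Hypothesis mdom : measurable (dom psi).

(** The set is cut into pieces of radius [r], the radius of a ball of interior points around [c].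
    Moving a piece by [v] lands in that ball, and by convexity all points of the way except the
    start are interior, so no translate meets the piece again. *)
Lemma boundary_dom_null c : U c -> lam (dom psi `\` U) = 0%E.
Proof.
move=> Uc; have [r r0 rU] := nbhs_norm_lt (@open_interior _ (dom psi)) Uc.
pose A k := (dom psi `\` U) `&` [set x : vec | `|x - rat_center R p 1 k| < r].
have -> : dom psi `\` U = \bigcup_k A k.
  apply/seteqP; split => [x Dx|x [k _ []]//].
  have [k [_ _ kx]] := rat_ball_dense x r0; exists k => //; split => //=.
  by rewrite distrC.
have mA k : measurable (A k).
  apply: measurableI; first by apply: measurableD => //; exact: measurable_interior_dom.
  by apply: open_borel; exact: open_norm_lt.
apply: measure_bigcup_eq0 => // k.
apply: (disjoint_translates_null hlam (mA k) (v := c - rat_center R p 1 k)).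
move=> x t /andP[t0 t1] [[Dx _] /= xr] [[_ nU] _]; apply: nU.
set v := c - _.
have Uv : U (x + v).
  by apply: rU; rewrite /v addrCA [c + _]addrC addrK.
have -> : x + ratr t *: v = ratr t *: (x + v) + (1 - ratr t) *: x.
  by apply/matrixP => a b; rewrite !mxE; ring.
by apply: interior_segment => //; rewrite ltr0q t0/= -[X in _ <= X](rmorph1 (@ratr R)) ler_rat.
Qed.

(* If, for some axis [i], the domain contains no two points differing by a small
   multiple of [e_i], its translates along [e_i] are disjoint. Otherwise averaging one
   segment in the domain along each axis gives a box, hence an interior point. *)
Lemma thin_dom_null : (forall x, ~ U x) -> lam (dom psi) = 0%E.
Proof.
move=> nU; have [[x0 Dx0]|/set0P/negP/negPn/eqP ->] := pselect (dom psi !=set0); last exact: measure0.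
have [[i hi]|hi] := pselect (exists i, forall x (t : rat), 0 < t <= 1 -> dom psi x ->
    ~ dom psi (x + ratr t *: axis i)).
  exact: (disjoint_translates_null hlam mdom hi).
exfalso.
have /choice[xt hxt] i : exists xt : vec * R, [/\ 0 < xt.2, dom psi xt.1 &
    dom psi (xt.1 + xt.2 *: axis i)].
  apply: contrapT => h; apply: hi; exists i => x t /andP[t0 _] Dx Dt.
  by apply: h; exists (x, ratr t); split => //=; rewrite ltr0q.
pose P : R := p.+1%:R.
have P0 : 0 < P by rewrite ltr0n.
(* Midpoints of the segments, shifted along their axes by [P] times the coordinates of [h]; the mean
   then moves by exactly [h]. *)
pose X (h : vec) (i : 'I_p.+1) := if unlift ord0 i is Some j
  then (xt j).1 + ((xt j).2 / 2 + P * h j ord0) *: axis j else x0.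
pose m := P^-1 *: \sum_i X 0 i.
(* A shift of at most half the segment stays inside it; dividing by [P] makes up for the enlarged
   shift. *)
apply: (nU m); pose r := \big[minr/1]_i ((xt i).2 / 2 / P).
have r0 : 0 < r.
  by apply/bigmin_gtP; split => // i _; have [t0 _ _] := hxt i; rewrite !divr_gt0.
apply/nbhs_ballP; exists r => //= z; rewrite -ball_normE/= distrC => zr.
have -> : z = P^-1 *: \sum_i X (z - m) i.
  have -> : \sum_i X (z - m) i = \sum_i X 0 i + P *: (z - m).
    rewrite [LHS]big_ord_recl [in RHS]big_ord_recl /X unlift_none.
    rewrite -addrA; congr (_ + _); rewrite [in RHS](axis_sum (z - m)) scaler_sumr -big_split/=.
    apply: eq_bigr => j _; rewrite liftK [(0 : vec) _ _]mxE mulr0 addr0 scalerDl scalerA.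
    by rewrite addrA.
  by rewrite scalerDr scalerA mulVf ?gt_eqF// scale1r -/m addrC subrK.
have [] // := @jensen _ _ _ hpsi p (X (z - m)).
move=> i; rewrite /X; case: unliftP => [j _|_] //.
have [t0 D1 D2] := hxt j; set t := (xt j).2 in t0 D2 *.
set s := t / 2 + P * _.
have rj : r <= t / 2 / P by apply: bigmin_le_cond.
have : `|P * (z - m) j ord0| <= t / 2.
  apply: axis_coord_le; rewrite mulrC -ler_pdivlMr//; apply: le_trans rj; exact: ltW.
rewrite ler_norml => /andP[h1 h2].
have [|] // := @dom_segment _ _ _ hpsi (xt j).1 (t *: axis j) (s / t) D1 D2; last first.
  by rewrite scalerA divfK ?gt_eqF.
by apply/andP; split; [rewrite divr_ge0 ?(ltW t0)//|rewrite ler_pdivrMr// mul1r]; rewrite /s; lra.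
Qed.

Lemma nondiff_null : lam (dom psi `\` [set x | diff_at psi x]) = 0%E.
Proof.
have mD := measurable_diff_at.
have [[c Uc]|nU] := pselect (exists c, U c); last first.
  apply/eqP; rewrite eq_le measure_ge0 andbT -(thin_dom_null (fun x Ux => nU (ex_intro _ x Ux))).
  by apply: measureS => //; exact: measurableD.
pose K := \bigcup_(iqk in [set: 'I_p * rat * nat]) kink psi iqk.1.1 iqk.1.2 iqk.2.
have mK iqk : measurable (kink psi iqk.1.1 iqk.1.2 iqk.2) by exact: measurable_kink.
have K0 : lam K = 0%E.
  by apply: measure_countType_bigcup_eq0 => // iqk; exact: kink_null.
have mKK : measurable K by apply: countType_bigcup_measurable.
have mB : measurable (dom psi `\` U) by apply: measurableD => //; exact: measurable_interior_dom.
apply/eqP; rewrite eq_le measure_ge0 andbT.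
rewrite (@le_trans _ _ (lam (dom psi `\` U) + lam K)%E)//; last first.
  by rewrite (boundary_dom_null Uc) K0 adde0.
apply: le_trans (measureU2 _ mB mKK); apply: measureS; [exact: measurableD|exact: measurableU|].
rewrite diff_atE => x [Dx nD]; have [Ux|nUx] := pselect (U x); last by left.
by right; apply: contrapT => nK; apply: nD.
Qed.

End null.

End convex_measurable.

(** * Comparison of potentials *)

Lemma measure_ae_le (R : realType) dd (O : measurableType dd)
    (P : {measure set O -> \bar R}) (A B : set O) :
  measurable A -> measurable B -> {ae P, forall w, A w -> B w} -> (P A <= P B)%E.
Proof.
move=> mA mB [N [mN N0 hN]].
rewrite -[leRHS]adde0 -N0; apply: le_trans (measureU2 _ mB mN).
apply: measureS => //; first exact: measurableU.
move=> w Aw; have [Bw|nBw] := pselect (B w); first by left.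
by right; apply: hN => /(_ Aw).
Qed.

Section potentials_swap.
Variables (R : realType) (p : nat).
Local Notation vec := 'cV[R]_p.
Context d1 d2 (O1 : measurableType d1) (O2 : measurableType d2).
Variables (P1 : {measure set O1 -> \bar R}) (P2 : {measure set O2 -> \bar R}).
Hypothesis P2fin : (P2 setT < +oo)%E.
Variables (X1 Y1 : O1 -> vec) (X2 Y2 : O2 -> vec).
Hypotheses (mX1 : measurable_fun setT X1) (mY1 : measurable_fun setT Y1).
Hypotheses (mX2 : measurable_fun setT X2) (mY2 : measurable_fun setT Y2).
Hypothesis lawX : forall A, measurable A -> P1 (X1 @^-1` A) = P2 (X2 @^-1` A).
Hypothesis lawY : forall A, measurable A -> P1 (Y1 @^-1` A) = P2 (Y2 @^-1` A).
Variables (k : vec -> vec -> R) (f1 g1 f2 g2 : vec -> \bar R).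
Hypotheses (mf1 : measurable_fun setT f1) (mg1 : measurable_fun setT g1).
Hypotheses (mf2 : measurable_fun setT f2) (mg2 : measurable_fun setT g2).
Hypotheses (f1N : forall x, f1 x != -oo%E) (g1N : forall x, g1 x != -oo%E).
Hypotheses (f2N : forall x, f2 x != -oo%E) (g2N : forall x, g2 x != -oo%E).
Hypothesis k1 : forall x y, ((k x y)%:E <= f1 x + g1 y)%E.
Hypothesis k2 : forall x y, ((k x y)%:E <= f2 x + g2 y)%E.
Hypothesis eq1 : {ae P1, forall w, (f1 (X1 w) + g1 (Y1 w) = (k (X1 w) (Y1 w))%:E)%E}.
Hypothesis eq2 : {ae P2, forall w, (f2 (X2 w) + g2 (Y2 w) = (k (X2 w) (Y2 w))%:E)%E}.

Let fin_sum (a b : \bar R) (c : R) : a != -oo%E -> b != -oo%E -> (a + b = c%:E)%E ->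
  a \is a fin_num /\ b \is a fin_num.
Proof. by case: a => [a| |]//; case: b => [b| |]. Qed.

Let ae_preimage dd (O : measurableType dd) (P : {measure set O -> \bar R}) (A : set O) :
  measurable A -> {ae P, forall w, A w} -> P (~` A) = 0%E.
Proof. by move=> mA h; apply/negligibleP => //; exact: measurableC. Qed.

Let measurable_fin (f : vec -> \bar R) : measurable_fun setT f ->
  measurable [set x | f x \is a fin_num].
Proof.
move=> mf; rewrite -[X in measurable X]setTI.
exact: (emeasurable_fin_num measurableT mf).
Qed.

Let measurable_pre dd (O : measurableType dd) (X : O -> vec) A :
  measurable_fun setT X -> measurable A -> measurable (X @^-1` A).
Proof. by move=> mX mA; rewrite -[X in measurable X]setTI; exact: mX. Qed.

Let ae_law12 (X1' : O1 -> vec) (X2' : O2 -> vec) (A : set vec) :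
  measurable_fun setT X1' -> measurable_fun setT X2' ->
  (forall A, measurable A -> P1 (X1' @^-1` A) = P2 (X2' @^-1` A)) ->
  measurable A ->
  {ae P1, forall w, A (X1' w)} <-> {ae P2, forall w, A (X2' w)}.
Proof.
move=> mX1' mX2' law mA; split => h.
  apply/negligibleP; first by apply: measurableC; exact: measurable_pre.
  suff : P2 (X2' @^-1` (~` A)) = 0%E by [].
  rewrite -law; last exact: measurableC.
  exact: (ae_preimage (measurable_pre mX1' mA) h).
apply/negligibleP; first by apply: measurableC; exact: measurable_pre.
suff : P1 (X1' @^-1` (~` A)) = 0%E by [].
rewrite law; last exact: measurableC.
exact: (ae_preimage (measurable_pre mX2' mA) h).
Qed.

(** Differences taken in opposite orders, so that equality of the two sums of potentials reads
    [u x = v y]. *)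
Let u x := fine (f1 x) - fine (f2 x).
Let v y := fine (g2 y) - fine (g1 y).

Let mu_ : measurable_fun setT u.
Proof. by apply: measurable_funB; exact: measurableT_comp. Qed.

Let mv_ : measurable_fun setT v.
Proof. by apply: measurable_funB; exact: measurableT_comp. Qed.

Let mgt (g : vec -> R) (t : R) : measurable_fun setT g -> measurable [set x | t < g x].
Proof.
move=> mg; rewrite (_ : [set x | t < g x] = setT `&` g @^-1` `]t, +oo[%classic).
  by apply: mg.
by apply/seteqP; split => x /=; rewrite in_itv/= andbT => // -[].
Qed.

Let fin1 : {ae P1, forall w, f1 (X1 w) \is a fin_num /\ g1 (Y1 w) \is a fin_num}.
Proof. by apply: filterS eq1 => w; exact: fin_sum. Qed.

Let fin2 : {ae P2, forall w, f2 (X2 w) \is a fin_num /\ g2 (Y2 w) \is a fin_num}.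
Proof. by apply: filterS eq2 => w; exact: fin_sum. Qed.

Let fin12 : {ae P2, forall w, f1 (X2 w) \is a fin_num /\ g1 (Y2 w) \is a fin_num}.
Proof.
have h1 : {ae P2, forall w, f1 (X2 w) \is a fin_num}.
  apply/(ae_law12 mX1 mX2 lawX (measurable_fin mf1)).
  by apply: filterS fin1 => w [].
have h2 : {ae P2, forall w, g1 (Y2 w) \is a fin_num}.
  apply/(ae_law12 mY1 mY2 lawY (measurable_fin mg1)).
  by apply: filterS fin1 => w [].
by apply: filterS2 h1 h2.
Qed.

Let fin21 : {ae P1, forall w, f2 (X1 w) \is a fin_num /\ g2 (Y1 w) \is a fin_num}.
Proof.
have h1 : {ae P1, forall w, f2 (X1 w) \is a fin_num}.
  apply/(ae_law12 mX1 mX2 lawX (measurable_fin mf2)).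
  by apply: filterS fin2 => w [].
have h2 : {ae P1, forall w, g2 (Y1 w) \is a fin_num}.
  apply/(ae_law12 mY1 mY2 lawY (measurable_fin mg2)).
  by apply: filterS fin2 => w [].
by apply: filterS2 h1 h2.
Qed.

Let uv1 : {ae P1, forall w, u (X1 w) <= v (Y1 w)}.
Proof.
apply: filterS3 eq1 fin1 fin21 => w + [h1 h2] [h3 h4]; rewrite /u /v.
have := k2 (X1 w) (Y1 w); move: h1 h2 h3 h4.
case: (f1 (X1 w)) => [a| |]//; case: (g1 (Y1 w)) => [b| |]//.
case: (f2 (X1 w)) => [c| |]//; case: (g2 (Y1 w)) => [d| |]// _ _ _ _.
by rewrite -!EFinD lee_fin /= => h [e]; lra.
Qed.

Let vu2 : {ae P2, forall w, v (Y2 w) <= u (X2 w)}.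
Proof.
apply: filterS3 eq2 fin2 fin12 => w + [h1 h2] [h3 h4]; rewrite /u /v.
have := k1 (X2 w) (Y2 w); move: h1 h2 h3 h4.
case: (f2 (X2 w)) => [a| |]//; case: (g2 (Y2 w)) => [b| |]//.
case: (f1 (X2 w)) => [c| |]//; case: (g1 (Y2 w)) => [d| |]// _ _ _ _.
by rewrite -!EFinD lee_fin /= => h [e]; lra.
Qed.

Let level (t : R) : P2 ([set w | t < u (X2 w)] `\` [set w | t < v (Y2 w)]) = 0%E.
Proof.
set A := [set w | t < u (X2 w)]; set B := [set w | t < v (Y2 w)].
have mA : measurable A by apply: (measurable_pre mX2 (mgt t mu_)).
have mB : measurable B by apply: (measurable_pre mY2 (mgt t mv_)).
have fin C : measurable C -> P2 C \is a fin_num.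
  by move=> mC; rewrite ge0_fin_numE// (le_lt_trans _ P2fin)//; exact: measureS.
(* Under [P2] almost all of [B] lies in [A]. The reverse comparison of masses is made on the first
   space, where the inclusion goes the other way. *)
have AB : (P2 A <= P2 B)%E.
  rewrite -[P2 A](lawX (mgt t mu_)) -[P2 B](lawY (mgt t mv_)).
  apply: measure_ae_le.
  - exact: (measurable_pre mX1 (mgt t mu_)).
  - exact: (measurable_pre mY1 (mgt t mv_)).
  - by apply: filterS uv1 => w h /= /lt_le_trans; exact.
have mAB : measurable (A `&` B) by exact: measurableI.
have BAB : (P2 B <= P2 (A `&` B))%E.
  apply: measure_ae_le => //.
  by apply: filterS vu2 => w h Bw; split => //; exact: lt_le_trans Bw h.
apply/eqP; rewrite eq_le measure_ge0 andbT.
have mD : measurable (A `\` B) by exact: measurableD.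
have := le_trans AB BAB; rewrite (measureDI P2 mA mB).
by rewrite -leeBrDr ?fin// subee ?fin.
Qed.

(* [u (X w) <= v (Y w)] holds under [P1] and the reverse inequality under [P2]. Since the
   laws of [X] and of [Y] are the same, so are those of [u] and [v] on superlevel sets,
   which forces equality under [P2]. *)
Lemma potentials_swap :
  {ae P2, forall w, (f1 (X2 w) + g1 (Y2 w) = (k (X2 w) (Y2 w))%:E)%E}.
Proof.
have h : {ae P2, forall w, u (X2 w) <= v (Y2 w)}.
  exists (\bigcup_(q in [set: rat])
    ([set w | ratr q < u (X2 w)] `\` [set w | ratr q < v (Y2 w)])); split.
  - apply: countType_bigcup_measurable => q _; apply: measurableD.
      exact: (measurable_pre mX2 (mgt _ mu_)).
    exact: (measurable_pre mY2 (mgt _ mv_)).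
  - apply: measure_countType_bigcup_eq0 => q; last exact: level.
    apply: measurableD.
      exact: (measurable_pre mX2 (mgt _ mu_)).
    exact: (measurable_pre mY2 (mgt _ mv_)).
  - move=> w /= /negP; rewrite -ltNge => /rat_in_itvoo[q]; rewrite in_itv/= => /andP[q1 q2].
    by exists q => //; split => //=; apply/negP; rewrite -leNgt ltW.
apply: filterS3 (filterI h eq2) fin2 fin12 => w [] + + [h1 h2] [h3 h4]; rewrite /u /v.
have := k1 (X2 w) (Y2 w); move: h1 h2 h3 h4.
case: (f2 (X2 w)) => [a| |]//; case: (g2 (Y2 w)) => [b| |]//.
case: (f1 (X2 w)) => [c| |]//; case: (g1 (Y2 w)) => [d| |]// _ _ _ _.
rewrite -!EFinD lee_fin /= => h1 h2 [e]; congr EFin; apply/eqP; rewrite eq_le; apply/andP; split; lra.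
Qed.

End potentials_swap.

(** * The support of a measure on the product *)

Section support.
Variables (R : realType) (p : nat).
Local Notation vec := 'cV[R]_p.
Variable pi : {measure set (vec * vec)%type -> \bar R}.

Lemma msupport_sub (E : set (vec * vec)) : closed E -> pi (~` E) = 0%E ->
  msupport pi `<=` E.
Proof.
move=> cE E0 z sz; apply: contrapT => nEz.
by have := sz _ (closed_openC cE) nEz; rewrite E0 ltxx.
Qed.

(** A point outside the support lies in a null rectangle of the countable base, so the whole
    complement of the support is null. *)
Let null_rect (ij : nat * nat) : set (vec * vec) :=
  if `[< pi (@rat_ball R p 1 ij.1 `*` @rat_ball R p 1 ij.2) = 0%E >]
  then @rat_ball R p 1 ij.1 `*` @rat_ball R p 1 ij.2 else set0.

Let measurable_rect i j : measurable (@rat_ball R p 1 i `*` @rat_ball R p 1 j).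
Proof. by apply: measurableX; exact: measurable_rat_ball. Qed.

Let msupportC : ~` msupport pi = \bigcup_(ij in [set: nat * nat]) null_rect ij.
Proof.
apply/seteqP; split => z /=.
  move=> /existsNP[U /not_implyP[oU /not_implyP[Uz /negP U0]]].
  have [ij [z1 z2 ijU]] := open_setX_base oU Uz.
  exists ij => //; rewrite /null_rect; case: asboolP => [_//|]; case.
  apply/eqP; rewrite eq_le measure_ge0 andbT; apply: le_trans (_ : (pi U <= 0)%E).
    apply: measureS => //; first exact: open_setX_borel.
    by move=> w [w1 w2]; apply: ijU; split; exact: rat_ball_sub.
  by rewrite leNgt.
move=> [ij _]; rewrite /null_rect; case: asboolP => [p0 zij sz|//].
have : (0 < pi (@rat_ball R p 1 ij.1 `*` @rat_ball R p 1 ij.2))%E.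
  by apply: sz => //; rewrite openE => w [w1 w2]; exists (@rat_ball R p 1 ij.1, @rat_ball R p 1 ij.2) => //=;
     split; apply: open_nbhs_nbhs; split => //; exact: rat_ball_open.
by rewrite p0 ltxx.
Qed.

Let measurable_null_rect ij : measurable (null_rect ij).
Proof. by rewrite /null_rect; case: asboolP. Qed.

Lemma measurable_msupport : measurable (msupport pi).
Proof.
rewrite -[msupport pi]setCK msupportC; apply: measurableC.
exact: countType_bigcup_measurable.
Qed.

Lemma msupport_full : pi (~` msupport pi) = 0%E.
Proof.
rewrite msupportC; apply: measure_countType_bigcup_eq0 => // ij.
by rewrite /null_rect; case: asboolP.
Qed.

End support.

(** * The optimal map *)

Section optimal_map.
Variables (R : realType) (p : nat).
Local Notation vec := 'cV[R]_p.
Local Notation mat := 'M[R]_p.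

Lemma density_null (lam mu : {measure set vec -> \bar R}) A :
  has_density lam mu -> measurable A -> lam A = 0%E -> mu A = 0%E.
Proof.
move=> [f [mf f0 fA]] mA A0; rewrite fA//; apply: null_set_integral => //.
by apply: measurable_funTS; exact/measurable_EFinP.
Qed.

Lemma compact_core (nu : probability vec R) (B : set vec) : measurable B ->
  nu B = 1%E -> exists C : nat -> set vec, [/\ forall n, compact (C n),
    forall n, C n `<=` B & forall n, (nu (~` C n) < n.+1%:R^-1%:E)%E].
Proof.
move=> mB B1.
have h n : exists K, [/\ compact K, K `<=` B & (nu (~` K) < n.+1%:R^-1%:E)%E].
  have n0 : 0 < n.+1%:R^-1 :> R by rewrite invr_gt0.
  have [K [cK KB nuK]] := inner_regular nu mB n0.
  have mK := compact_borel cK.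
  exists K; split => //; rewrite -[n.+1%:R^-1]addr0.
  apply: (measure_cover2 _ _ _ _ nuK (_ : (nu (~` B) <= 0%:E)%E)).
  - exact: measurableD.
  - exact: measurableC.
  - exact: measurableC.
  - by move=> x nKx; have [Bx|nBx] := pselect (B x); [left|right].
  - by rewrite probability_setC// B1 subee.
have [C hC] := choice h.
by exists C; split => n; have [] := hC n.
Qed.

Lemma measure_le_eps (a b : \bar R) : a \is a fin_num -> b \is a fin_num ->
  (forall n : nat, (a <= b + n.+1%:R^-1%:E)%E) -> (a <= b)%E.
Proof.
case: a => [a| |]//; case: b => [b| |]// _ _ h; rewrite lee_fin.
apply/ler_addgt0Pr => e e0.
have [n ne] : exists n : nat, n.+1%:R^-1 < e.
  exists (Num.trunc e^-1); rewrite invf_plt ?posrE//.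
  by have := truncnS_gt e^-1.
have := h n; rewrite -EFinD lee_fin => /le_trans; apply.
by rewrite lerD2l ltW.
Qed.

Variables (G : set mat) (hG : compact_subgroup_O G).
Variables (mu nu : probability vec R) (B : set vec).
Hypothesis hB : assumption_A1 G nu B.

(** A1 speaks of one point with two images in [B]: here the point is [P *m h], whose images under
    [P^T] and [Q^T] are [h] and [h']. *)
Lemma orbit_unique P Q h h' : G P -> G Q -> B h -> B h' -> P *m h = Q *m h' -> h = h'.
Proof.
move=> GP GQ Bh Bh' e; have [_ _ uB] := hB.
have := uB (P *m h) P^T Q^T (GT hG GP) (GT hG GQ).
by rewrite {2 4}e !mulmxA !(GtrK hG)// !mul1mx => /(_ Bh Bh').
Qed.

Definition contact (psi phi : vec -> \bar R) x h :=
  (psi x + phi h = (gdot G x h)%:E)%E.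

(** [psi] lies above the affine function [z |-> <z, Q h> - phi h] and touches it at [x], so [Q h] is
    a subgradient there. *)
Lemma contact_grad psi phi x h Q : (forall y, (psi y != -oo)%E) ->
  (forall y k, ((gdot G y k)%:E <= psi y + phi k)%E) ->
  contact psi phi x h -> diff_at psi x -> G Q -> gdot G x h = dot x (Q *m h) ->
  Q *m h = grad psi x.
Proof.
move=> psiN ge cxh dx GQ gQ; apply: subgradient_unique => // z.
have := ge z h; have := gdot_ge hG z h GQ; move: cxh; rewrite /contact gQ.
have : psi x \is a fin_num := interior_dom (diff_at_interior dx).
have := psiN z; rewrite dotBr (dotC _ z) (dotC _ x).
case: (psi x) => [a| |]//; case: (psi z) => [b| |]//; case: (phi h) => [c| |]// _ _.
- by rewrite -!EFinD => -[e] h1; rewrite !lee_fin; lra.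
- by move=> _ _ _; rewrite leey.
Qed.

Lemma contact_unique psi phi x h h' : (forall y, (psi y != -oo)%E) ->
  (forall y k, ((gdot G y k)%:E <= psi y + phi k)%E) -> diff_at psi x ->
  contact psi phi x h -> contact psi phi x h' -> B h -> B h' -> h = h'.
Proof.
move=> psiN ge dx c1 c2 Bh Bh'.
have [P GP eP] := gdot_attained hG x h; have [Q GQ eQ] := gdot_attained hG x h'.
apply: (orbit_unique GP GQ Bh Bh').
by rewrite (contact_grad psiN ge c1 dx GP eP) (contact_grad psiN ge c2 dx GQ eQ).
Qed.

(** What is retained of the construction: uniqueness, optimality and the claims about [grad psi] are
    derived from these properties. *)
Record optimal_map (T : vec -> vec) (psi phi : vec -> \bar R) : Prop := OptimalMap {
  om_measurable : measurable_fun setT T ;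
  om_push : forall A, measurable A -> mu (T @^-1` A) = nu A ;
  om_convex : convex_ext psi ;
  om_lsc : lower_semicontinuous psi ;
  om_invariant : forall Q x, G Q -> psi (Q *m x) = psi x ;
  om_conj : measurable_fun setT phi ;
  om_conjN : forall h, phi h != -oo%E ;
  om_ge : forall x h, ((gdot G x h)%:E <= psi x + phi h)%E ;
  om_ae : {ae mu, forall x, [/\ diff_at psi x, B (T x) & contact psi phi x (T x)]} ;
  om_cyclic : c_cyclically_monotone G (msupport (pushforward mu (fun x => (x, T x)))) }.

Lemma measurable_graph (T : vec -> vec) : measurable_fun setT T ->
  measurable_fun setT (fun x : vec => (x, T x)).
Proof. by move=> mT; apply: measurable_fun_pair. Qed.

Lemma measurable_dom (psi : vec -> \bar R) : measurable_fun setT psi -> measurable (dom psi).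
Proof.
move=> mpsi; rewrite -[X in measurable X]setTI.
exact: (emeasurable_fin_num measurableT mpsi).
Qed.

Lemma cyclically_monotone_sub (E F : set (vec * vec)) : E `<=` F ->
  c_cyclically_monotone G F -> c_cyclically_monotone G E.
Proof. by move=> EF cF N z Ez; apply: cF => i; exact: EF. Qed.

Variables (lam : {measure set vec -> \bar R}) (hlam : is_lebesgue lam).
Hypothesis hmu : has_density lam mu.

Lemma exists_optimal_map : exists T psi phi, optimal_map T psi phi.
Proof.
have [mB B1 _] := hB.
have [C [cC CB nuC]] := compact_core mB B1.
have mC n : measurable (C n) by exact: compact_borel.
have [M hM] := exists_limit_plan mu nu (cost G).
set E := plan_support M.
have cE : closed E by exact: plan_support_closed.
have cmE : c_cyclically_monotone G E := plan_support_cyclic hM (cost_continuous hG).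
pose X (K : set vec) := [set x | exists2 y, K y & E (x, y)].
have mX K : closed K -> measurable (X K) by move=> cK; exact: closed_projection_borel.
have nuX K : compact K -> (nu K <= mu (X K))%E by exact: plan_projection.
have closedC (K : set vec) : compact K -> closed K by apply: compact_closed; exact: mx_hausdorff.
have mXc (K : set vec) : compact K -> measurable (X K) by move=> cK; apply: mX; exact: closedC.
(* Points with a partner in one of the compact parts of [B]; the projection inequality makes them
   almost all, as [nu (C n)] tends to 1. *)
pose W0 := \bigcup_n X (C n).
have mW0 : measurable W0 by apply: bigcup_measurable => n _; exact: mXc.
have W0full : mu (~` W0) = 0%E.
  apply/eqP; rewrite eq_le measure_ge0 andbT; apply: measure_le_eps => //.
    by apply: fin_num_measure; exact: measurableC.
  move=> n; rewrite add0e; apply: le_trans (ltW (nuC n)).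
  rewrite !probability_setC//; apply: leeB => //.
  apply: le_trans (nuX _ (cC n)) _; apply: measureS => //; first exact: mXc.
  by move=> x Xx; exists n.
have [z0 Ez0] : exists z0, E z0.
  apply: contrapT => nE; have : W0 = set0.
    by rewrite -subset0 => x [n _ [y _ Exy]]; apply: nE; exists (x, y).
  move=> W00; move: W0full; rewrite W00 setC0 probability_setT => /eqP.
  by rewrite eqe oner_eq0.
pose psi := rock (gdot G) E z0.
pose phi := conjugate (gdot G) psi.
have cmg := cost_cyclicE cmE.
have psiN x : psi x != -oo%E by exact: rock_neqNoo.
have psi_conv : convex_ext psi by apply: rock_convex => // h x y t t01; exact: gdot_convex.
have psi_lsc : lower_semicontinuous psi by apply: rock_lsc; exact: gdot_continuousl.
have mpsi : measurable_fun setT psi by exact: lsc_measurable.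
have phiN h : phi h != -oo%E.
  by apply: (@conjugate_neqNoo _ _ _ _ z0.1); rewrite /psi rock_z0.
have phi_lsc : lower_semicontinuous phi by apply: conjugate_lsc; exact: gdot_continuousr.
have ge x h : ((gdot G x h)%:E <= psi x + phi h)%E by exact: fenchel.
have ct x h : E (x, h) -> contact psi phi x h by exact: rock_conj.
have W0dom : W0 `<=` dom psi.
  by move=> x [n _ [y _ Exy]]; exact: (rock_fin Ez0 cmg Exy).
have mdom := measurable_dom mpsi.
pose D := [set x | diff_at psi x].
have mD : measurable D by exact: measurable_diff_at.
have Dfull : mu (~` D) = 0%E.
  have d0 : mu (dom psi `\` D) = 0%E.
    by apply: (density_null hmu); [exact: measurableD|exact: nondiff_null].
  have mdD : measurable (dom psi `\` D) by exact: measurableD.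
  have mcW := measurableC mW0.
  apply/eqP; rewrite eq_le measure_ge0 andbT -[leRHS]adde0 -{1}W0full -d0.
  apply: le_trans (measureU2 _ mcW mdD); apply: measureS.
  - exact: measurableC.
  - exact: measurableU.
  - move=> x nDx; have [/W0dom Dx|] := pselect (W0 x); [by right|by left].
pose W := D `&` W0.
have mW : measurable W by exact: measurableI.
have Wfull : mu (~` W) = 0%E.
  have mcW := measurableC mW0; have mcD := measurableC mD.
  apply/eqP; rewrite eq_le measure_ge0 andbT -[leRHS]adde0 -{1}Dfull -W0full /W setCI.
  exact: measureU2.
pose T x := if `[< W x >] then get [set h | (exists n, C n h) /\ E (x, h)] else 0.
have TW x : W x -> (exists n, C n (T x)) /\ E (x, T x).
  move=> Wx; rewrite /T; case: asboolP => // _.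
  have [_ [n _ [y Cy Exy]]] := Wx.
  by apply: (@getPex _ [set h | (exists n, C n h) /\ E (x, h)]); exists y; split => //; exists n.
have Tuniq x h : W x -> B h -> E (x, h) -> T x = h.
  move=> Wx Bh Exh; have [[n CT] ET] := TW _ Wx; have [Dx _] := Wx.
  by apply: (contact_unique psiN ge Dx (ct _ _ ET) (ct _ _ Exh)) => //; exact: CB CT.
(* On [W] the partner in [B] is unique, so being mapped into [K] is the same as having some partner
   in [K] within a compact part, a countable union of projections of closed sets. *)
have Tpre K : closed K -> measurable (T @^-1` K).
  move=> cK; rewrite (_ : _ @^-1` _ = (W `&` \bigcup_n X (K `&` C n)) `|` (~` W `&` [set _ | K 0])).
    apply: measurableU; apply: measurableI => //.
    - apply: bigcup_measurable => n _; apply: mX; apply: closedI => //; exact: closedC.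
    - exact: measurableC.
    - have [K0|nK0] := pselect (K 0).
        by rewrite (_ : [set _ | _] = setT)//; apply/seteqP; split.
      by rewrite (_ : [set _ | _] = set0)//; apply/seteqP; split.
  apply/seteqP; split => x.
    rewrite /preimage/=; have [Wx KT|nWx] := pselect (W x).
      by left; split => //; have [[n CT] ET] := TW _ Wx; exists n => //; exists (T x).
    by rewrite /T; case: asboolP => // _ K0; right.
  case=> [[Wx [n _ [h [Kh Ch] Exh]]]|[nWx K0]].
    by rewrite /preimage/= (Tuniq _ _ Wx (CB _ _ Ch) Exh).
  by rewrite /preimage/= /T; case: asboolP.
have mT : measurable_fun setT T.
  apply: (@measurability _ _ _ _ _ _ (@open vec)) => //.
  move=> _ [U oU <-]; rewrite setTI (open_bigcup_rat_cball oU) preimage_bigcup.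
  by apply: bigcup_measurable => k _; apply: Tpre; exact: rat_cball_closed.
have mTA A : measurable A -> measurable (T @^-1` A).
  by move=> mA; rewrite -[X in measurable X]setTI; exact: mT.
have pushK K : compact K -> (nu K <= mu (T @^-1` K))%E.
  move=> cK; have mK := compact_borel cK.
  apply: measure_le_eps; [exact: fin_num_measure|apply: fin_num_measure; exact: mTA|move=> n].
  have cKC : compact (K `&` C n) by apply: compact_closedI => //; exact: closedC.
  have mKC := compact_borel cKC.
  apply: (@le_trans _ _ (nu (K `&` C n) + nu (~` C n))%E).
    apply: le_trans (measureU2 _ mKC (measurableC (mC n))); apply: measureS => //.
      by apply: measurableU => //; exact: measurableC.
    by move=> x Kx; have [Cx|nCx] := pselect (C n x); [left|right].
  apply: leeD; last exact: ltW.
  apply: le_trans (nuX _ cKC) _.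
  have mXK : measurable (X (K `&` C n)) by exact: mXc.
  rewrite -[leRHS]adde0 -Wfull; apply: le_trans (measureU2 _ (mTA _ mK) (measurableC mW)).
  apply: measureS => //; first by apply: measurableU; [exact: mTA|exact: measurableC].
  move=> x [h [Kh Ch] Exh]; have [Wx|nWx] := pselect (W x); last by right.
  by left; rewrite /preimage/= (Tuniq _ _ Wx (CB _ _ Ch) Exh).
have pushA A : measurable A -> (nu A <= mu (T @^-1` A))%E.
  move=> mA; apply: measure_le_eps; [exact: fin_num_measure|apply: fin_num_measure; exact: mTA|move=> n].
  have n0 : 0 < n.+1%:R^-1 :> R by rewrite invr_gt0.
  have [K [cK KA nuK]] := inner_regular nu mA n0.
  have mK := compact_borel cK.
  apply: (@le_trans _ _ (nu K + nu (A `\` K))%E).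
    apply: le_trans (measureU2 _ mK (measurableD mA mK)); apply: measureS => //.
      by apply: measurableU => //; exact: measurableD.
    by move=> x Ax; have [Kx|nKx] := pselect (K x); [left|right].
  apply: leeD; last exact: ltW.
  apply: le_trans (pushK _ cK) _; apply: measureS; [exact: mTA|exact: mTA|].
  by move=> x; exact: KA.
have aeW : {ae mu, forall x, W x} by exists (~` W); split => //; exact: measurableC.
exists T, psi, phi; split => //.
(* Between probabilities one inequality for all sets is enough: on complements it reads the other
   way. *)
- move=> A mA; apply/eqP; rewrite eq_le pushA// andbT.
  have := pushA _ (measurableC mA); rewrite preimage_setC !probability_setC//; last exact: mTA.
  have : mu (T @^-1` A) \is a fin_num by apply: fin_num_measure; exact: mTA.
  have : nu A \is a fin_num by exact: fin_num_measure.
  case: (mu (T @^-1` A)) => [a| |]//; case: (nu A) => [b| |]// _ _.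
  by rewrite -!EFinB !lee_fin; lra.
- by move=> Q x GQ; apply: rock_invariant => y h; exact: gdot_invariant.
- exact: lsc_measurable.
- apply: filterS aeW => x Wx; have [[n CT] ET] := TW _ Wx; have [Dx _] := Wx.
  by split => //; [exact: CB CT|exact: ct].
(* Over almost every point the graph lies in the closed set [E], hence the support is contained in
   [E]. *)
- have sub := @msupport_sub _ _ (push_measure mu (measurable_graph mT)) E cE.
  apply: cyclically_monotone_sub cmE; apply: sub.
  rewrite push_measureE; apply/eqP; rewrite eq_le measure_ge0 andbT -[leRHS]Wfull.
  apply: (@measureS _ _ _ mu).
  - rewrite -[X in measurable X]setTI; apply: (measurable_graph mT) => //.
    by apply: measurableC; exact: closed_setX_borel.
  - exact: measurableC.
  - by move=> x /= nE Wx; apply: nE; have [] := TW _ Wx.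
Qed.

End optimal_map.

Section law_integral.
Variable R : realType.
Context d d' (O : measurableType d) (T : measurableType d').
Variables (P : {measure set O -> \bar R}) (X : O -> T) (mX : measurable_fun setT X).
Variable m : {measure set T -> \bar R}.
Hypothesis law : forall A, measurable A -> P (X @^-1` A) = m A.

Lemma law_integral_ge0 (f : T -> \bar R) : measurable_fun setT f ->
  (forall x, (0 <= f x)%E) -> (\int[P]_w f (X w) = \int[m]_x f x)%E.
Proof.
move=> mf f0.
rewrite -(@eq_measure_integral _ _ _ setT m (push_measure P mX) f).
  by rewrite (ge0_integral_pushforward mX).
by move=> A mA _; rewrite push_measureE law.
Qed.

Lemma law_integrable (f : T -> \bar R) : measurable_fun setT f ->
  P.-integrable setT (f \o X) <-> m.-integrable setT f.
Proof.
move=> mf; have e : (\int[P]_w `|f (X w)| = \int[m]_x `|f x|)%E.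
  by apply: (@law_integral_ge0 (fun x => `|f x|%E)) => //; exact: measurableT_comp.
split => /integrableP[_ h]; apply/integrableP; split => //.
- by rewrite -e.
- exact: measurableT_comp.
- by rewrite /= e.
Qed.

Lemma law_integral (f : T -> \bar R) : measurable_fun setT f ->
  (\int[P]_w f (X w) = \int[m]_x f x)%E.
Proof.
move=> mf; rewrite integralE [RHS]integralE; congr (_ - _)%E.
  rewrite -(law_integral_ge0 (f := f^\+%E)); [|exact: measurable_funepos|exact: funepos_ge0].
  by apply: eq_integral => w _; rewrite !funepos.unlock.
rewrite -(law_integral_ge0 (f := f^\-%E)); [|exact: measurable_funeneg|exact: funeneg_ge0].
by apply: eq_integral => w _; rewrite !funeneg.unlock.
Qed.

End law_integral.

Lemma ae_bound_integrable (R : realType) d (O : measurableType d)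
    (P : {measure set O -> \bar R}) (f g : O -> R) :
  measurable_fun setT f -> measurable_fun setT g -> (forall w, 0 <= g w) ->
  (\int[P]_w (g w)%:E < +oo)%E -> {ae P, forall w, `|f w| <= g w} ->
  P.-integrable setT (EFin \o f).
Proof.
move=> mf mg g0 gfin fg; apply/integrableP; split; first exact/measurable_EFinP.
apply: le_lt_trans gfin; apply: ae_ge0_le_integral => //.
- by apply: measurableT_comp => //; exact/measurable_EFinP.
- by move=> w _; rewrite lee_fin.
- exact/measurable_EFinP.
- by apply: filterS fg => w h _; rewrite /= lee_fin.
Qed.

(** * Uniqueness of the coupling and of the map; finite second moments *)

Section optimal_map_theory.
Variables (R : realType) (p : nat).
Local Notation vec := 'cV[R]_p.
Local Notation mat := 'M[R]_p.
Variables (G : set mat) (hG : compact_subgroup_O G).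
Variables (mu nu : probability vec R) (B : set vec).
Hypothesis hB : assumption_A1 G nu B.
Variables (T : vec -> vec) (psi phi : vec -> \bar R).
Hypothesis om : optimal_map G mu nu B T psi phi.

Let mT := om_measurable om.
Let psiN x : psi x != -oo%E. Proof. by case: (om_convex om). Qed.
Let mpsi : measurable_fun setT psi. Proof. exact: lsc_measurable (om_lsc om). Qed.

Lemma marginal_fst (pi : {measure set (vec * vec)%type -> \bar R}) A :
  coupling mu nu pi -> measurable A -> pi (fst @^-1` A) = mu A.
Proof.
move=> cpi mA; have [<- _] := cpi _ mA; congr (pi _).
by apply/seteqP; split => z //= -[].
Qed.

Lemma marginal_snd (pi : {measure set (vec * vec)%type -> \bar R}) A :
  coupling mu nu pi -> measurable A -> pi (snd @^-1` A) = nu A.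
Proof.
move=> cpi mA; have [_ <-] := cpi _ mA; congr (pi _).
by apply/seteqP; split => z //= -[].
Qed.

Lemma ae_fst (pi : {measure set (vec * vec)%type -> \bar R}) (Q : vec -> Prop) :
  coupling mu nu pi -> {ae mu, forall x, Q x} -> {ae pi, forall z, Q z.1}.
Proof.
move=> cpi [N [mN N0 QN]]; exists (fst @^-1` N); split.
- by rewrite -[X in measurable X]setTI; exact: measurable_fst.
- by rewrite marginal_fst.
- by move=> z nQ; exact: QN.
Qed.

Lemma ae_snd (pi : {measure set (vec * vec)%type -> \bar R}) (Q : vec -> Prop) :
  coupling mu nu pi -> {ae nu, forall x, Q x} -> {ae pi, forall z, Q z.2}.
Proof.
move=> cpi [N [mN N0 QN]]; exists (snd @^-1` N); split.
- by rewrite -[X in measurable X]setTI; exact: measurable_snd.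
- by rewrite marginal_snd.
- by move=> z nQ; exact: QN.
Qed.

Lemma ae_B : {ae nu, forall h, B h}.
Proof.
have [mB B1 _] := hB; apply/negligibleP; first exact: measurableC.
suff : nu (~` B) = 0%E by [].
by rewrite probability_setC// B1 subee.
Qed.

Lemma graph_law (pi : {measure set (vec * vec)%type -> \bar R}) A :
  coupling mu nu pi -> {ae pi, forall z, z.2 = T z.1} -> measurable A ->
  pi A = mu [set x | A (x, T x)].
Proof.
move=> cpi aeT mA.
have mA0 : measurable [set x | A (x, T x)].
  by rewrite -[X in measurable X]setTI; exact: (measurable_graph mT).
rewrite -(marginal_fst cpi mA0).
have mA1 : measurable (fst @^-1` [set x | A (x, T x)] : set (vec * vec)).
  by rewrite -[X in measurable X]setTI; exact: measurable_fst.
apply/eqP; rewrite eq_le; apply/andP; split; apply: measure_ae_le => //.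
  by apply: filterS aeT => -[x h] /= ->.
by apply: filterS aeT => -[x h] /= ->.
Qed.

Lemma contact_graph (pi : {measure set (vec * vec)%type -> \bar R}) :
  coupling mu nu pi -> {ae pi, forall z, contact G psi phi z.1 z.2} ->
  {ae pi, forall z, z.2 = T z.1}.
Proof.
move=> cpi ac; have h1 := ae_fst cpi (om_ae om); have h2 := ae_snd cpi ae_B.
apply: filterS3 ac h1 h2 => z c [dz BT cT] Bz.
exact: (contact_unique hG hB psiN (om_ge om) dz c cT).
Qed.

Lemma graph_coupling : coupling mu nu (push_measure mu (measurable_graph mT)).
Proof.
move=> A mA; rewrite !push_measureE; split.
  by congr (mu _); apply/seteqP; split => x //= -[].
rewrite -(om_push om mA); congr (mu _).
by apply/seteqP; split => x //= -[].
Qed.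

Lemma coupling_setT (pi : {measure set (vec * vec)%type -> \bar R}) :
  coupling mu nu pi -> pi setT = 1%E.
Proof.
by move=> cpi; rewrite -(probability_setT mu) -(marginal_fst cpi measurableT) preimage_setT.
Qed.

(** The support of [pi] yields a second pair of potentials. Swapping it with [(psi, phi)], which is
    in contact along the graph of [T], shows that [pi] too is concentrated on the contact set of
    [(psi, phi)]. *)
Lemma coupling_ae (pi : {measure set (vec * vec)%type -> \bar R}) :
  coupling mu nu pi -> c_cyclically_monotone G (msupport pi) ->
  {ae pi, forall z, z.2 = T z.1}.
Proof.
move=> cpi cm; apply: contact_graph => //.
have sfull := msupport_full pi; have ms := measurable_msupport pi.
have [z0 sz0] : exists z0, msupport pi z0.
  apply: contrapT => nE; have s0 : msupport pi = set0.
    by rewrite -subset0 => z sz; apply: nE; exists z.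
  by move: sfull; rewrite s0 setC0 (coupling_setT cpi) => /eqP; rewrite eqe oner_eq0.
have cmg := cost_cyclicE cm.
pose psi2 := rock (gdot G) (msupport pi) z0.
pose phi2 := conjugate (gdot G) psi2.
have psi2N x : psi2 x != -oo%E by exact: rock_neqNoo.
have phi2N h : phi2 h != -oo%E.
  by apply: (@conjugate_neqNoo _ _ _ _ z0.1); rewrite /psi2 rock_z0.
apply: (@potentials_swap R p _ _ _ _ mu pi _ id T fst snd _ _ _ _ _ _ (gdot G) psi phi psi2 phi2).
- by rewrite (coupling_setT cpi) ltry.
- exact: measurable_id.
- exact: mT.
- exact: measurable_fst.
- exact: measurable_snd.
- by move=> C mC; rewrite (marginal_fst cpi).
- by move=> C mC; exact: etrans (om_push om mC) (esym (marginal_snd cpi mC)).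
- exact: mpsi.
- exact: om_conj om.
- by apply: lsc_measurable; apply: rock_lsc; exact: gdot_continuousl.
- by apply: lsc_measurable; apply: conjugate_lsc; exact: gdot_continuousr.
- exact: psiN.
- exact: om_conjN om.
- exact: psi2N.
- exact: phi2N.
- exact: om_ge om.
- by move=> x h; exact: fenchel.
- by apply: filterS (om_ae om) => x [].
- exists (~` msupport pi); split => //; first exact: measurableC.
  by move=> -[x h] /= nc sz; apply: nc; exact: rock_conj.
Qed.

Lemma map_unique T' : measurable_fun setT T' ->
  coupling mu nu (pushforward mu (fun x => (x, T' x))) ->
  c_cyclically_monotone G (msupport (pushforward mu (fun x => (x, T' x)))) ->
  {ae mu, forall x, T' x = T x}.
Proof.
move=> mT' cT' cm; have mg := measurable_graph mT'.
have [N [mN N0 hN]] := @coupling_ae (push_measure mu mg) cT' cm.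
exists ((fun x => (x, T' x)) @^-1` N); split => //.
  by rewrite -[X in measurable X]setTI; exact: (measurable_graph mT').
by move=> x nT; exact: hN.
Qed.

Section quadratic.
Hypothesis mu2 : (\int[mu]_x (sqnorm x)%:E < +oo)%E.
Hypothesis nu2 : (\int[nu]_x (sqnorm x)%:E < +oo)%E.

(** Potentials for the cost itself: [c = |x|^2 + |h|^2 - 2 s] turns the inequality for [s] into
    [a x + b h <= c]. *)
Let a x := sqnorm x - 2 * fine (psi x).
Let b h := sqnorm h - 2 * fine (phi h).

Let msq : measurable_fun setT (@sqnorm R p).
Proof. by apply: continuous_measurable_mx; exact: sqnorm_continuous. Qed.

Let ma : measurable_fun setT a.
Proof.
apply: measurable_funB => //; apply: measurable_funM => //.
exact: measurableT_comp.
Qed.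

Let mb : measurable_fun setT b.
Proof.
apply: measurable_funB => //; apply: measurable_funM => //.
by apply: measurableT_comp => //; exact: om_conj om.
Qed.

Let cost_bound x h : cost G x h <= 2 * sqnorm x + 2 * sqnorm h.
Proof.
apply: le_trans (cost_le x h (G1 hG)) _; rewrite trmx1 mul1mx sqnormB.
have := sqnorm_ge0 (x + h); rewrite sqnorm_dot dotDl !dotDr -!sqnorm_dot (dotC h x); lra.
Qed.

Let ab_le x h : psi x \is a fin_num -> phi h \is a fin_num -> a x + b h <= cost G x h.
Proof.
have := om_ge om x h; rewrite (costE G x h) /a /b.
by case: (psi x) => [r| |]//; case: (phi h) => [t| |]// + _ _; rewrite -EFinD lee_fin/=; lra.
Qed.

Let ab_eq x h : contact G psi phi x h -> psi x \is a fin_num ->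
  phi h \is a fin_num /\ a x + b h = cost G x h.
Proof.
rewrite /contact (costE G x h) /a /b.
case: (psi x) => [r| |]//; case: (phi h) => [t| |]// + _; rewrite -EFinD => -[e].
by split => //=; lra.
Qed.

Let diff_fin x : diff_at psi x -> psi x \is a fin_num.
Proof. by move=> dx; exact: (interior_dom (diff_at_interior dx)). Qed.

Let good : {ae mu, forall x, [/\ psi x \is a fin_num, phi (T x) \is a fin_num &
  a x + b (T x) = cost G x (T x)]}.
Proof.
apply: filterS (om_ae om) => x [dx _ ct]; have fx := diff_fin dx.
by have [? ?] := ab_eq ct fx.
Qed.

(** Pairing with a fixed contact point [(x0, T x0)] bounds [a] and [b] from above by square norms;
    since [a x + b (T x)] equals a nonnegative cost, these upper bounds entail lower ones. *)
Let bound_ab : exists C : R, 0 <= C /\ {ae mu, forall x,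
  `|a x| <= 2 * sqnorm x + 2 * sqnorm (T x) + C /\
  `|b (T x)| <= 2 * sqnorm x + 2 * sqnorm (T x) + C}.
Proof.
have [x0 [fx0 fh0 _]] : exists x0, [/\ psi x0 \is a fin_num, phi (T x0) \is a fin_num &
    a x0 + b (T x0) = cost G x0 (T x0)].
  apply: contrapT => nx; have [N [mN N0 gN]] := good.
  have : N = setT by rewrite -subTset => x _; apply: gN => gx; apply: nx; exists x.
  by move=> NT; move: N0; rewrite NT probability_setT => /eqP; rewrite eqe oner_eq0.
pose C := 2 * sqnorm x0 + 2 * sqnorm (T x0) + `|a x0| + `|b (T x0)|.
have C0 : 0 <= C.
  by rewrite /C !addr_ge0// mulr_ge0// sqnorm_ge0.
exists C; split => //; apply: filterS good => x [fx fh e].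
have h1 : a x <= 2 * sqnorm x + C.
  have := ab_le fx fh0; have := cost_bound x (T x0); have := ler_norm (- b (T x0)).
  have := sqnorm_ge0 x0; have := normr_ge0 (a x0); rewrite normrN /C; lra.
have h2 : b (T x) <= 2 * sqnorm (T x) + C.
  have := ab_le fx0 fh; have := cost_bound x0 (T x); have := ler_norm (- a x0).
  have := sqnorm_ge0 (T x0); have := normr_ge0 (b (T x0)); rewrite normrN /C; lra.
have := cost_ge0 hG x (T x); have := sqnorm_ge0 x; have := sqnorm_ge0 (T x).
by rewrite !ler_norml => ? ? ?; split; apply/andP; split; lra.
Qed.

Let mTsq : measurable_fun setT (fun x => sqnorm (T x)).
Proof. exact: measurableT_comp. Qed.

Let int_a : mu.-integrable setT (EFin \o a) /\ mu.-integrable setT (EFin \o (b \o T)).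
Proof.
have [C [C0 hC]] := bound_ab.
pose g x := 2 * sqnorm x + 2 * sqnorm (T x) + C.
have mg : measurable_fun setT g.
  by apply: measurable_funD => //; apply: measurable_funD; apply: measurable_funM.
have g0 x : 0 <= g x by rewrite !addr_ge0// mulr_ge0// sqnorm_ge0.
have gfin : (\int[mu]_x (g x)%:E < +oo)%E.
  have T2 : (\int[mu]_x (sqnorm (T x))%:E < +oo)%E.
    rewrite (law_integral_ge0 mT (om_push om) (f := fun x => (sqnorm x)%:E))//.
      exact/measurable_EFinP.
    by move=> x; rewrite lee_fin sqnorm_ge0.
  have -> : (fun x => (g x)%:E) =
      (fun x => 2%:E * (sqnorm x)%:E + 2%:E * (sqnorm (T x))%:E + C%:E)%E.
    by apply/funext => x; rewrite -!EFinM -!EFinD.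
  have m1 : measurable_fun setT (fun x : vec => 2%:E * (sqnorm x)%:E)%E.
    by apply: emeasurable_funM => //; exact/measurable_EFinP.
  have m2 : measurable_fun setT (fun x : vec => 2%:E * (sqnorm (T x))%:E)%E.
    by apply: emeasurable_funM => //; exact/measurable_EFinP.
  have p1 x : (0 <= 2%:E * (sqnorm x)%:E)%E by rewrite -EFinM lee_fin mulr_ge0// sqnorm_ge0.
  have p2 x : (0 <= 2%:E * (sqnorm (T x))%:E)%E by rewrite -EFinM lee_fin mulr_ge0// sqnorm_ge0.
  rewrite ge0_integralD//; last 2 first.
  - by move=> x _; rewrite adde_ge0.
  - exact: emeasurable_funD.
  rewrite ge0_integralD//.
  rewrite !ge0_integralZl//; do ?[exact/measurable_EFinP|by move=> x _; rewrite lee_fin sqnorm_ge0].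
  rewrite integral_cst//= probability_setT mule1.
  by rewrite !lte_add_pinfty ?ltry// lte_mul_pinfty.
split; apply: (ae_bound_integrable _ mg g0 gfin).
- exact: ma.
- by apply: filterS hC => x [].
- exact: measurableT_comp.
- by apply: filterS hC => x [].
Qed.

Let int_b : nu.-integrable setT (EFin \o b).
Proof.
apply/(law_integrable mT (om_push om)); first exact/measurable_EFinP.
by have [] := int_a.
Qed.

Let w (z : vec * vec) := cost G z.1 z.2 - a z.1 - b z.2.

Let mcost : measurable_fun setT (fun z : vec * vec => cost G z.1 z.2).
Proof. by apply: continuous_measurable_setX; exact: cost_continuous. Qed.

Let ma1 : measurable_fun setT (fun z : vec * vec => a z.1).
Proof. exact: (measurableT_comp ma measurable_fst). Qed.

Let mb2 : measurable_fun setT (fun z : vec * vec => b z.2).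
Proof. exact: (measurableT_comp mb measurable_snd). Qed.

Let mw : measurable_fun setT w.
Proof. by apply: measurable_funB => //; exact: measurable_funB. Qed.

Let Itot := (\int[mu]_x (a x)%:E + \int[nu]_h (b h)%:E)%E.

Let Ifin : Itot \is a fin_num.
Proof.
have [ia _] := int_a.
by rewrite fin_numD (integrable_fin_num measurableT ia) (integrable_fin_num measurableT int_b).
Qed.

Let ae_psi_fin : {ae mu, forall x, psi x \is a fin_num}.
Proof. by apply: filterS good => x []. Qed.

Let ae_phi_fin : {ae nu, forall h, phi h \is a fin_num}.
Proof.
have mF : measurable [set h | phi h \is a fin_num] by exact: measurable_dom (om_conj om).
apply/negligibleP; first exact: measurableC.
apply: etrans (esym (om_push om (measurableC mF))) _.
have [N [mN N0 gN]] := good; apply/eqP; rewrite eq_le measure_ge0 andbT -N0.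
apply: measureS => //.
  by rewrite -[X in measurable X]setTI; apply: mT => //; exact: measurableC.
by move=> x nf; apply: gN => -[].
Qed.

(* The excess [w] of the cost over the dual potentials [a] and [b] is nonnegative, and
   [Itot] does not depend on the coupling. *)
Lemma cost_decomposition (pi : {measure set (vec * vec)%type -> \bar R}) :
  coupling mu nu pi ->
  (\int[pi]_z (cost G z.1 z.2)%:E = \int[pi]_z `|w z|%:E + Itot)%E /\
  {ae pi, forall z, 0 <= w z}.
Proof.
move=> cpi.
have w0 : {ae pi, forall z, 0 <= w z}.
  apply: filterS2 (ae_fst cpi ae_psi_fin) (ae_snd cpi ae_phi_fin) => z f1 f2.
  by rewrite /w; have := ab_le f1 f2; lra.
split => //; have [ia _] := int_a.
have m1 C : measurable C -> pi (fst @^-1` C) = mu C by move=> mC; exact: marginal_fst.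
have m2 C : measurable C -> pi (snd @^-1` C) = nu C by move=> mC; exact: marginal_snd.
have ia1 : pi.-integrable setT (fun z => (a z.1)%:E).
  by apply/(law_integrable measurable_fst m1 (f := EFin \o a)) => //; exact/measurable_EFinP.
have ib2 : pi.-integrable setT (fun z => (b z.2)%:E).
  by apply/(law_integrable measurable_snd m2 (f := EFin \o b)) => //; exact/measurable_EFinP.
have isq1 : pi.-integrable setT (fun z => (sqnorm z.1)%:E).
  apply/(law_integrable measurable_fst m1 (f := EFin \o @sqnorm R p)); first exact/measurable_EFinP.
  apply/integrableP; split; first exact/measurable_EFinP.
  by under eq_integral do rewrite /= ger0_norm ?sqnorm_ge0//.
have isq2 : pi.-integrable setT (fun z => (sqnorm z.2)%:E).
  apply/(law_integrable measurable_snd m2 (f := EFin \o @sqnorm R p)); first exact/measurable_EFinP.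
  apply/integrableP; split; first exact/measurable_EFinP.
  by under eq_integral do rewrite /= ger0_norm ?sqnorm_ge0//.
have ic : pi.-integrable setT (fun z => (cost G z.1 z.2)%:E).
  apply: (le_integrable measurableT _ _ (integrableD measurableT
    (integrableZl measurableT 2 isq1) (integrableZl measurableT 2 isq2))).
    exact/measurable_EFinP.
  move=> z _; rewrite [X in (_ <= `|X|)%E](_ : _ = (2 * sqnorm z.1 + 2 * sqnorm z.2)%:E)//.
  rewrite /= lee_fin ger0_norm ?cost_ge0//.
  by rewrite (le_trans (cost_bound _ _))// ler_norm.
(* The absolute value makes the integrand nonnegative everywhere, whereas [w] is so only almost
   everywhere. *)
have iw : pi.-integrable setT (fun z => `|w z|%:E).
  have -> : (fun z => `|w z|%:E) =
      abse \o (fun z => ((cost G z.1 z.2)%:E - (a z.1)%:E - (b z.2)%:E)%E).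
    by apply/funext => z /=.
  by apply: integrable_abse; apply: integrableB => //; exact: integrableB.
rewrite /Itot -(law_integral measurable_fst m1 (f := EFin \o a)); last exact/measurable_EFinP.
rewrite -(law_integral measurable_snd m2 (f := EFin \o b)); last exact/measurable_EFinP.
rewrite -integralD// -integralD//; last exact: integrableD.
apply: ae_eq_integral => //.
- exact/measurable_EFinP.
- apply: emeasurable_funD; first by apply/measurable_EFinP; exact: measurableT_comp.
  by apply: emeasurable_funD; exact/measurable_EFinP.
- apply: filterS w0 => z wz _; rewrite ger0_norm// -!EFinD; congr EFin; rewrite /w; ring.
Qed.

(** On the graph of [T] the excess [w] vanishes, so its cost is [Itot], a lower bound for every
    coupling. Equality forces [w = 0] almost everywhere, which is contact, and contact leads back to
    the graph. *)
Lemma cost_optimal (pi : {measure set (vec * vec)%type -> \bar R}) :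
  coupling mu nu pi ->
  let law := pushforward mu (fun x => (x, T x)) in
  (\int[law]_z (cost G z.1 z.2)%:E <= \int[pi]_z (cost G z.1 z.2)%:E)%E /\
  ((\int[pi]_z (cost G z.1 z.2)%:E <= \int[law]_z (cost G z.1 z.2)%:E)%E ->
    forall A, measurable A -> pi A = law A).
Proof.
move=> cpi law.
have [eT _] := cost_decomposition graph_coupling.
have wT : (\int[push_measure mu (measurable_graph mT)]_z `|w z|%:E = 0)%E.
  have mg := measurable_graph mT.
  rewrite -(@law_integral_ge0 R _ _ _ _ mu _ mg (push_measure mu mg)
    (fun A _ => erefl) (fun z => `|w z|%:E))//.
  - rewrite (@ae_eq_integral _ _ _ mu setT (cst 0%E)) ?integral0//.
      by apply/measurable_EFinP; apply: measurableT_comp => //; exact: measurableT_comp.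
    by apply: filterS good => x [_ _ e] _; rewrite /w/= -addrA -opprD e subrr normr0.
  - by apply/measurable_EFinP; exact: measurableT_comp.
have [e w0] := cost_decomposition cpi.
have -> : (\int[law]_z (cost G z.1 z.2)%:E = Itot)%E by rewrite [LHS]eT wT add0e.
rewrite e; split; first by rewrite leeDr// integral_ge0.
move=> le A mA; apply: graph_law => //; apply: contact_graph => //.
have iw0 : (\int[pi]_z `|w z|%:E = 0)%E.
  apply/eqP; rewrite eq_le integral_ge0 ?andbT//.
  by rewrite -(subee Ifin) leeBrDr.
have : ae_eq pi setT (EFin \o w) (cst 0%E).
  by apply/ae_eq_integral_abs => //; exact/measurable_EFinP.
move=> wae; apply: filterS3 wae (ae_fst cpi ae_psi_fin) (ae_snd cpi ae_phi_fin).
move=> z /(_ I) /= [wz] f1 f2; rewrite /contact -[psi z.1]fineK// -[phi z.2]fineK// -EFinD.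
congr EFin; move: wz; rewrite /w /a /b (costE G z.1 z.2); lra.
Qed.


End quadratic.

End optimal_map_theory.

(** * Haar measure and the symmetrized problem *)

Section product_swap.
Context d1 d2 (T1 : measurableType d1) (T2 : measurableType d2) (R : realType).
Variables (P1 : probability T1 R) (P2 : probability T2 R).

Lemma product_xsection (E : set (T1 * T2)) :
  ((P1 \x P2) E = \int[P1]_x P2 [set y | E (x, y)])%E.
Proof.
rewrite /product_measure1; apply: eq_integral => x _ /=; congr (P2 _).
by apply/seteqP; split => y /=; rewrite /xsection/= inE.
Qed.

Lemma product_ysection (E : set (T1 * T2)) : measurable E ->
  ((P1 \x P2) E = \int[P2]_y P1 [set x | E (x, y)])%E.
Proof.
move=> mE; have -> : ((P1 \x P2) E = (P1 \x^ P2) E)%E.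
  by apply: product_measure_unique => //= A B mA mB; rewrite product_measure2E.
rewrite /product_measure2; apply: eq_integral => y _ /=; congr (P1 _).
by apply/seteqP; split => x /=; rewrite /ysection/= inE.
Qed.

Lemma measurable_measure_xsection (E : set (T1 * T2)) : measurable E ->
  measurable_fun setT (fun x => P2 [set y | E (x, y)]).
Proof.
move=> mE; have := measurable_fun_xsection P2 mE; congr measurable_fun.
apply/funext => x /=; congr (P2 _).
by apply/seteqP; split => y /=; rewrite /xsection/= inE.
Qed.

Lemma measurable_measure_ysection (E : set (T1 * T2)) : measurable E ->
  measurable_fun setT (fun y => P1 [set x | E (x, y)]).
Proof.
move=> mE; have := measurable_fun_ysection P1 mE; congr measurable_fun.
apply/funext => y /=; congr (P1 _).
by apply/seteqP; split => x /=; rewrite /ysection/= inE.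
Qed.

End product_swap.

Lemma ae_const_integral (R : realType) d (T : measurableType d)
    (P : probability T R) (f : T -> \bar R) (c : \bar R) : measurable_fun setT f ->
  {ae P, forall x, f x = c} -> (\int[P]_x f x = c)%E.
Proof.
move=> mf fc; rewrite (ae_eq_integral (cst c))//.
  by rewrite integral_cst//= probability_setT mule1.
by apply: filterS fc => x e _.
Qed.

Section haar.
Variables (R : realType) (p : nat).
Local Notation vec := 'cV[R]_p.
Local Notation mat := 'M[R]_p.
Variables (G : set mat) (hG : compact_subgroup_O G).
Variables (eta : probability mat R) (haar : is_haar G eta).

Lemma measurable_group : measurable G.
Proof. by case: hG => cG _ _ _ _; exact: compact_borel. Qed.

Lemma haar_ae : {ae eta, forall Q, G Q}.
Proof.
have [G1 _] := haar; apply/negligibleP; first by apply: measurableC; exact: measurable_group.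
suff : eta (~` G) = 0%E by [].
by rewrite probability_setC ?G1 ?subee//; exact: measurable_group.
Qed.

Lemma measurable_mulmxr (S : mat) : measurable_fun setT (fun M : mat => M *m S).
Proof.
apply: measurable_fun_coord => i j; under eq_fun do rewrite mxE.
by apply: measurable_sum => k; apply: measurable_funM => //; exact: measurable_coord.
Qed.

Lemma measurable_trmx : measurable_fun setT (fun M : mat => M^T).
Proof.
apply: measurable_fun_coord => i j; under eq_fun do rewrite mxE.
exact: measurable_coord.
Qed.

Lemma measurable_trmx_mulmx :
  measurable_fun setT (fun z : mat * mat => z.1^T *m z.2).
Proof.
apply: measurable_fun_coord => i j; under eq_fun do rewrite mxE.
apply: measurable_sum => k; apply: measurable_funM.
  under eq_fun do rewrite mxE.
  exact: (measurableT_comp (@measurable_coord R p p k i) measurable_fst).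
exact: (measurableT_comp (@measurable_coord R p p k j) measurable_snd).
Qed.

(* Both sides are [(eta x eta) {(P, Q) | A (P^T Q)}], integrated in either order. *)
Lemma haar_trmx (A : set mat) : measurable A -> eta [set M | A M^T] = eta A.
Proof.
move=> mA; have [_ inv] := haar.
pose E := [set z : mat * mat | A (z.1^T *m z.2)].
have mE : measurable E.
  by rewrite -[X in measurable X]setTI; exact: measurable_trmx_mulmx.
have mAT : measurable [set M : mat | A M^T].
  by rewrite -[X in measurable X]setTI; exact: measurable_trmx.
have h1 : ((eta \x eta) E = eta A)%E.
  rewrite product_xsection; apply: ae_const_integral.
    exact: (measurable_measure_xsection eta mE).
  apply: filterS haar_ae => Q GQ; apply: (inv Q^T) => //; exact: GT.
have h2 : ((eta \x eta) E = eta [set M | A M^T])%E.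
  rewrite product_ysection//; apply: ae_const_integral.
    exact: (measurable_measure_ysection eta mE).
  apply: filterS haar_ae => Q GQ.
  rewrite -(inv _ _ (GT hG GQ) mAT); congr (eta _).
  by apply/seteqP; split => M /=; rewrite trmx_mul trmxK.
by rewrite -h2 h1.
Qed.

(** Inversion on [G] is transposition: it preserves [eta] and exchanges left and right
    translations. *)
Lemma haar_mulr (S : mat) (A : set mat) : G S -> measurable A ->
  eta [set M | A (M *m S)] = eta A.
Proof.
move=> GS mA; have [_ inv] := haar.
have mAS : measurable [set M : mat | A (M *m S)].
  by rewrite -[X in measurable X]setTI; exact: measurable_mulmxr.
have mAT : measurable [set M : mat | A M^T].
  by rewrite -[X in measurable X]setTI; exact: measurable_trmx.
rewrite -(haar_trmx mAS) -(haar_trmx mA) -(inv _ _ (GT hG GS) mAT); congr (eta _).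
by apply/seteqP; split => M /=; rewrite trmx_mul trmxK.
Qed.

Lemma measurable_orbit_map (x : vec) : measurable_fun setT (fun M : mat => M *m x).
Proof.
apply: measurable_fun_coord => i j; under eq_fun do rewrite mxE.
by apply: measurable_sum => k; apply: measurable_funM => //; exact: measurable_coord.
Qed.

Lemma haar_orbit (S : mat) (A : set vec) (x : vec) : G S -> measurable A ->
  eta [set M | A (M *m (S *m x))] = eta [set M | A (M *m x)].
Proof.
move=> GS mA.
have mAx : measurable [set M : mat | A (M *m x)].
  by rewrite -[X in measurable X]setTI; exact: measurable_orbit_map.
rewrite -(haar_mulr GS mAx); congr (eta _).
by apply/seteqP; split => M /=; rewrite mulmxA.
Qed.

Definition symmetrized (mu : probability vec R) : {measure set vec -> \bar R} :=
  push_measure (eta \x mu)%E (@measurable_mulmx R p).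

Lemma symmetrizedE (mu : probability vec R) (A : set vec) : measurable A ->
  (symmetrized mu A = \int[mu]_x eta [set M | A (M *m x)])%E.
Proof.
move=> mA; pose E := [set z : mat * vec | A (z.1 *m z.2)].
apply: (product_ysection eta mu (E := E)).
by rewrite -[X in measurable X]setTI; exact: measurable_mulmx.
Qed.

Lemma measurable_orbit_measure (A : set vec) : measurable A ->
  measurable_fun setT (fun x : vec => eta [set M | A (M *m x)]).
Proof.
move=> mA; pose E := [set z : mat * vec | A (z.1 *m z.2)].
have mE : measurable E.
  by rewrite -[X in measurable X]setTI; exact: measurable_mulmx.
exact: (measurable_measure_ysection eta mE).
Qed.

Section equivariance.
Variable psi : vec -> \bar R.
Hypothesis cpsi : convex_ext psi.
Hypothesis inv : forall Q x, G Q -> psi (Q *m x) = psi x.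

Lemma diff_at_mulmx Q x : G Q -> diff_at psi x -> diff_at psi (Q *m x).
Proof.
move=> GQ [fx dx].
have e : Q^T *m (Q *m x) = x by rewrite mulmxA (GtrK hG)// mul1mx.
have psiE y : psi y = psi (Q^T *m y) by rewrite inv//; exact: GT.
split.
  have := @mulmx_continuous R p Q^T (Q *m x) [set y | psi y \is a fin_num].
  rewrite /= e => /(_ fx) h; apply: (@filterS _ (nbhs (Q *m x)) _ _ _ _ h) => y /=.
  by rewrite [psi y]psiE.
have -> : (fun y => fine (psi y)) = (fun y => fine (psi y)) \o (fun y => Q^T *m y).
  by apply/funext => y /=; rewrite psiE.
apply: differentiable_comp; last by rewrite e.
apply: (@linear_differentiable _ _ _ (mulmx Q^T : {linear vec -> vec})).
exact: mulmx_continuous.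
Qed.

(** Invariance carries the subgradient inequality at [x] to [Q *m x], where the subgradient is
    unique. *)
Lemma grad_mulmx Q x : G Q -> diff_at psi x -> grad psi (Q *m x) = Q *m grad psi x.
Proof.
move=> GQ dx; apply/esym; apply: subgradient_unique; first exact: diff_at_mulmx.
move=> z; have := grad_subgradient cpsi (Q^T *m z) dx.
rewrite !inv//; last exact: GT.
by rewrite dot_mulmx mulmxBr mulmxA (GtrK hG)// mul1mx.
Qed.

End equivariance.

Lemma conj_grad (f : vec -> \bar R) x : convex_ext f -> diff_at f x ->
  (f x + conjugate (@dot R p) f (grad f x) = (dot x (grad f x))%:E)%E.
Proof.
move=> cf dx; have fx : f x \is a fin_num := interior_dom (diff_at_interior dx).
apply/eqP; rewrite eq_le; apply/andP; split; last first.
  by apply: fenchel; [case: cf|exact: conjugate_neqNoo fx].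
rewrite -leeBrDl//; apply: ub_ereal_sup => _ [y _ <-].
have := grad_subgradient cf y dx; rewrite dotBr !(dotC (grad f x)).
have [fN _] := cf; have := fN y; move: fx.
case: (f x) => [a| |]// _; case: (f y) => [b| |]// _.
  by rewrite -!EFinB -EFinD !lee_fin; lra.
by rewrite /= leNye.
Qed.

Section symmetrized_map.
Variables (mu nu : probability vec R) (B : set vec).
Variables (T : vec -> vec) (psi phi : vec -> \bar R).
Hypothesis om : optimal_map G mu nu B T psi phi.

Let cpsi := om_convex om.
Let psiN x : psi x != -oo%E. Proof. by case: cpsi. Qed.
Let inv := om_invariant om.

Lemma symmetrized_setT (m : probability vec R) : symmetrized m setT = 1%E.
Proof.
rewrite symmetrizedE//; apply: ae_const_integral; first exact: measurable_orbit_measure.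
by apply: aeW => x; rewrite -(probability_setT eta); congr (eta _); apply/seteqP; split.
Qed.

Lemma exists_diff_at (m : {measure set vec -> \bar R}) (f : vec -> \bar R) :
  m setT = 1%E -> {ae m, forall x, diff_at f x} -> exists x, diff_at f x.
Proof.
move=> m1 [N [mN N0 hN]]; apply: contrapT => nx.
have NT : N = setT by rewrite -subTset => x _; apply: hN => dx; apply: nx; exists x.
by move: N0; rewrite NT m1 => /eqP; rewrite eqe oner_eq0.
Qed.

Lemma symmetrized_diff_at : {ae symmetrized mu, forall x, diff_at psi x}.
Proof.
have mD := measurable_diff_at cpsi; have mC := measurableC mD.
apply/negligibleP => //; apply: etrans (symmetrizedE mu mC) _.
apply: ae_const_integral; first exact: measurable_orbit_measure.
apply: filterS (om_ae om) => x [dx _ _].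
have [N [mN N0 hN]] := haar_ae.
apply/eqP; rewrite eq_le measure_ge0 andbT -N0; apply: measureS => //.
  by rewrite -[X in measurable X]setTI; exact: measurable_orbit_map.
by move=> Q /= nd; apply: hN => GQ; apply: nd; exact: (diff_at_mulmx inv).
Qed.

Lemma optimal_map_grad : {ae mu, forall x, exists2 S, G S &
  diff_at psi x /\ grad psi x = S *m T x}.
Proof.
apply: filterS (om_ae om) => x [dx _ cx]; have [S GS gS] := gdot_attained hG x (T x).
by exists S => //; split => //; apply/esym; exact: (contact_grad hG psiN (om_ge om) cx).
Qed.

Lemma measurable_grad_potential : measurable_fun setT (grad psi).
Proof.
have [c dc] : exists c, diff_at psi c.
  by apply: (exists_diff_at (symmetrized_setT mu)); exact: symmetrized_diff_at.
exact: (measurable_grad cpsi (diff_at_interior dc)).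
Qed.

Lemma symmetrized_push A : measurable A ->
  symmetrized mu (grad psi @^-1` A) = symmetrized nu A.
Proof.
move=> mA; have mg := measurable_grad_potential.
have mgA : measurable (grad psi @^-1` A) by rewrite -[X in measurable X]setTI; exact: mg.
rewrite !symmetrizedE//.
have mo := measurable_orbit_measure mA.
rewrite -(law_integral_ge0 (om_measurable om) (om_push om) mo)//.
apply: ae_eq_integral => //.
- exact: measurable_orbit_measure.
- exact: (measurableT_comp mo (om_measurable om)).
apply: filterS optimal_map_grad => x [S GS [dx gx]] _.
rewrite -(haar_orbit (T x) GS mA) -gx.
have mB1 : measurable [set M : mat | (grad psi @^-1` A) (M *m x)].
  by rewrite -[X in measurable X]setTI; exact: measurable_orbit_map.
have mB2 : measurable [set M : mat | A (M *m grad psi x)].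
  by rewrite -[X in measurable X]setTI; exact: measurable_orbit_map.
apply/eqP; rewrite eq_le; apply/andP; split; apply: measure_ae_le => //.
  by apply: filterS haar_ae => Q GQ /=; rewrite (grad_mulmx cpsi inv GQ dx).
by apply: filterS haar_ae => Q GQ /=; rewrite (grad_mulmx cpsi inv GQ dx).
Qed.

(** [f] is convex but perhaps neither lower semicontinuous nor measurable, so it is replaced by its
    biconjugate [f2], which agrees with it where [f] is differentiable. The swap of potentials then
    makes [grad psi x] a subgradient of [f] at [x]. *)
Lemma symmetrized_unique (f : vec -> \bar R) : convex_ext f ->
  {ae symmetrized mu, forall x, diff_at f x} ->
  (forall A, measurable A -> symmetrized mu (grad f @^-1` A) = symmetrized nu A) ->
  {ae symmetrized mu, forall x, grad f x = grad psi x}.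
Proof.
move=> cf df pushf; have [fN _] := cf.
have [c dc] := exists_diff_at (symmetrized_setT mu) df.
have [c' dc'] := exists_diff_at (symmetrized_setT mu) symmetrized_diff_at.
have fc : f c \is a fin_num := interior_dom (diff_at_interior dc).
have psic : psi c' \is a fin_num := interior_dom (diff_at_interior dc').
pose g := conjugate (@dot R p) f; pose f2 := conjugate (fun h x => dot x h) g.
pose g2 := conjugate (@dot R p) psi.
have gN h : g h != -oo%E by exact: conjugate_neqNoo fc.
have f2le x : (f2 x <= f x)%E.
  apply: ub_ereal_sup => _ [h _ <-]; have := fenchel (s := @dot R p) (fN x) (gN h).
  rewrite -/g; move: (fN x) (gN h).
  case: (f x) => [a| |]//; case: (g h) => [b| |]// _ _; rewrite ?leey// /= ?leNye//.
  by rewrite -EFinD -EFinB !lee_fin; lra.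
have gfin x : diff_at f x -> g (grad f x) \is a fin_num.
  move=> dx; have := conj_grad cf dx; have := gN (grad f x); rewrite -/g.
  have : f x \is a fin_num := interior_dom (diff_at_interior dx).
  by case: (f x) => [a| |]//; case: (g (grad f x)).
have f2E x : diff_at f x -> f2 x = f x.
  move=> dx; apply/eqP; rewrite eq_le f2le /=.
  have := conj_grad cf dx; rewrite -/g.
  have : ((dot x (grad f x))%:E - g (grad f x) <= f2 x)%E.
    by apply: ereal_sup_ubound; exists (grad f x).
  have : f x \is a fin_num := interior_dom (diff_at_interior dx).
  have := gfin _ dx; case: (f x) => [a| |]//; case: (g (grad f x)) => [b| |]// _ _ + [e].
  by apply: le_trans; rewrite lee_fin; lra.
have f2N x : f2 x != -oo%E by exact: conjugate_neqNoo (gfin _ dc).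
have aeq : {ae symmetrized mu, forall x, (f2 x + g (grad psi x) = (dot x (grad psi x))%:E)%E}.
  apply: (@potentials_swap R p _ _ _ _ (symmetrized mu) (symmetrized mu) _ id (grad f) id
    (grad psi) _ _ _ _ _ _ (@dot R p) f2 g psi g2).
  - by rewrite symmetrized_setT ltry.
  - exact: measurable_id.
  - exact: (measurable_grad cf (diff_at_interior dc)).
  - exact: measurable_id.
  - exact: measurable_grad_potential.
  - by [].
  - by move=> A mA; rewrite pushf// symmetrized_push.
  - by apply: lsc_measurable; apply: conjugate_lsc => h; exact: dot_continuousl.
  - by apply: lsc_measurable; apply: conjugate_lsc => h; exact: dot_continuousr.
  - exact: lsc_measurable (om_lsc om).
  - by apply: lsc_measurable; apply: conjugate_lsc => h; exact: dot_continuousr.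
  - exact: f2N.
  - exact: gN.
  - exact: psiN.
  - by move=> h; exact: conjugate_neqNoo psic.
  - by move=> x h; rewrite addeC; exact: (fenchel (s := fun h x => dot x h) (gN h) (f2N x)).
  - by move=> x h; apply: fenchel => //; exact: conjugate_neqNoo psic.
  - by apply: filterS df => x dx /=; rewrite f2E// conj_grad.
  - by apply: filterS symmetrized_diff_at => x dx /=; rewrite conj_grad.
apply: filterS2 aeq df => x + dx; rewrite f2E// => e.
apply/esym; apply: subgradient_unique => // z.
have := fenchel (s := @dot R p) (fN z) (gN (grad psi x)); rewrite -/g.
have : f x \is a fin_num := interior_dom (diff_at_interior dx).
move: e (gN (grad psi x)) (fN z); rewrite dotBr !(dotC (grad psi x)).
case: (f x) => [a| |]//; case: (g (grad psi x)) => [b| |]//.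
case: (f z) => [t| |]//; last by move=> *; rewrite leey.
by move=> [e] _ _ _; rewrite -!EFinD !lee_fin; lra.
Qed.

End symmetrized_map.
End haar.

Theorem mainTheorem3 (R : realType) (p : nat)
  (G : set 'M[R]_p) (eta : probability 'M[R]_p R)
  (lam : {measure set 'cV[R]_p -> \bar R})
  (mu nu : probability 'cV[R]_p R) (B : set 'cV[R]_p) :
  compact_subgroup_O G -> is_haar G eta ->
  is_lebesgue lam -> has_density lam mu ->
  assumption_A1 G nu B ->
  let muS := pushforward (eta \x mu)%E (fun z : ('M[R]_p * 'cV[R]_p)%type => z.1 *m z.2) in
  let nuS := pushforward (eta \x nu)%E (fun z : ('M[R]_p * 'cV[R]_p)%type => z.1 *m z.2) in
  let law := fun T : 'cV[R]_p -> 'cV[R]_p =>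
    pushforward mu (fun x : 'cV[R]_p => (x, T x)) in
  let OT := fun T : 'cV[R]_p -> 'cV[R]_p =>
    [/\ measurable_fun setT T,
        coupling mu nu (law T),
        c_cyclically_monotone G (msupport (law T)) &
        forall pi : probability ('cV[R]_p * 'cV[R]_p)%type R,
          coupling mu nu pi -> c_cyclically_monotone G (msupport pi) ->
          forall A, measurable A -> pi A = law T A] in
  exists T : 'cV[R]_p -> 'cV[R]_p,
    [/\ OT T,
        (forall T', OT T' -> {ae mu, forall x, T' x = T x}),
        (* (i)-(iv) *)
        (exists psi : 'cV[R]_p -> \bar R,
          [/\ lower_semicontinuous psi /\ convex_ext psi,
              (* (i) *)
              {ae mu, forall x, [/\ diff_at psi x, orbit_set G B (grad psi x)
                                   & T x = qmap G B (grad psi x)]},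
              (* (ii) *)
              [/\ {ae muS, forall x, diff_at psi x},
                  (forall A, measurable A -> muS (grad psi @^-1` A) = nuS A) &
                  forall phi : 'cV[R]_p -> \bar R, convex_ext phi ->
                    {ae muS, forall x, diff_at phi x} ->
                    (forall A, measurable A -> muS (grad phi @^-1` A) = nuS A) ->
                    {ae muS, forall x, grad phi x = grad psi x}],
              (* (iii) *)
              (forall Q x, G Q -> diff_at psi x -> diff_at psi (Q *m x) ->
                 grad psi (Q *m x) = Q *m grad psi x) &
              (* (iv) *)
              (forall S, argmin_selector G S ->
                 {ae mu, forall x, grad psi x = S x (T x) *m T x})]) &
        (* (v) *)
        ((\int[mu]_x (sqnorm x)%:E < +oo)%E ->
         (\int[nu]_x (sqnorm x)%:E < +oo)%E ->
         forall pi : probability ('cV[R]_p * 'cV[R]_p)%type R, coupling mu nu pi ->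
           (\int[law T]_z (cost G z.1 z.2)%:E <= \int[pi]_z (cost G z.1 z.2)%:E)%E /\
           ((\int[pi]_z (cost G z.1 z.2)%:E <= \int[law T]_z (cost G z.1 z.2)%:E)%E ->
              forall A, measurable A -> pi A = law T A))].

Proof.
move=> hG haar hlam hmu hB muS nuS law OT.
have [T [psi [phi om]]] := exists_optimal_map hG hB hlam hmu.
have psiN x : psi x != -oo%E by case: (om_convex om).
exists T; split.
- split.
  + exact: om_measurable om.
  + exact: (graph_coupling om).
  + exact: om_cyclic om.
  + by move=> pi cpi cm A mA; exact: (graph_law om cpi (coupling_ae hG hB om cpi cm) mA).
- by move=> T' [mT' cT' cmT' _]; exact: (map_unique hG hB om mT' cT' cmT').
- exists psi; split.
  + by split; [exact: om_lsc om|exact: om_convex om].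
  + apply: filterS2 (om_ae om) (optimal_map_grad hG om) => x [dx BT _] [S GS [_ gx]].
    split => //; first by exists S, (T x).
    (* [qmap] chooses a representative of the orbit in [B]; [T x] is one, and A1 leaves no other. *)
    have [] := @getPex _ [set y | B y /\ exists Q, G Q /\ grad psi x = Q *m y].
      by exists (T x); split => //; exists S.
    rewrite -/(qmap G B (grad psi x)) => Bq [Q [GQ gq]].
    by apply: (orbit_unique hG hB GS GQ BT Bq); rewrite -gx.
  + split.
    * exact: (symmetrized_diff_at hG haar om).
    * by move=> A mA; exact: (symmetrized_push hG haar om mA).
    * by move=> f cf df pf; exact: (symmetrized_unique hG haar om cf df pf).
  + by move=> Q x GQ dx _; exact: (grad_mulmx hG (om_convex om) (om_invariant om)).
  + move=> S hS; apply: filterS (om_ae om) => x [dx _ cx]; have [GS Smin] := hS x (T x).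
    (* Every minimiser realises [gdot G x (T x)], and every such product is the gradient, whence
       independence of the choice. *)
    apply/esym; apply: (contact_grad hG psiN (om_ge om) cx dx GS).
    exact: (gdot_argmin hG GS Smin).
- by move=> mu2 nu2 pi cpi; exact: (cost_optimal hG hB om mu2 nu2 cpi).
Qed.
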